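(* Suppose that the spectral density matrix operator $\mathscr F_{\mathbf X,\theta}$, $\theta\in[-\pi,\pi]$, exists and $\mathcal M(\mathscr F_{\mathbf X})<\infty$, that the marginal-covariance functions $\Sigma_{0,jj}$ are continuous on $\mathcal U^2$ and bounded uniformly in $j\in\{1,\dots,p\}$ and $(u,v)\in\mathcal U^2$, and that $\lambda_0=\max_{1\le j\le p}\int_{\mathcal U}\Sigma_{0,jj}(u,u)\,du<\infty$. Then for any given $\boldsymbol\Phi_1,\boldsymbol\Phi_2\in\mathbb H_0^p$ with $\max(\|\boldsymbol\Phi_1\|_0,\|\boldsymbol\Phi_2\|_0)\le k$, $k\in\{1,\dots,p\}$, there exists some universal constant $c>0$ such that for any $\eta>0$, $$P\left\{\left|\frac{\langle\boldsymbol\Phi_1,(\widehat{\boldsymbol\Xi}_0-\boldsymbol\Xi_0)(\boldsymbol\Phi_1)\rangle}{\langle\boldsymbol\Phi_1,\boldsymbol\Xi_0(\boldsymbol\Phi_1)\rangle}\right|>\mathcal M_k(\mathscr F_{\mathbf X})\,\eta\right\}\le 2\exp\{-cn\min(\eta^2,\eta)\}$$ and $$P\left\{\left|\frac{\langle\boldsymbol\Phi_1,(\widehat{\boldsymbol\Xi}_0-\boldsymbol\Xi_0)(\boldsymbol\Phi_2)\rangle}{\langle\boldsymbol\Phi_1,\boldsymbol\Xi_0(\boldsymbol\Phi_1)\rangle+\langle\boldsymbol\Phi_2,\boldsymbol\Xi_0(\boldsymbol\Phi_2)\rangle}\right|>\mathcal M_k(\mathscr F_{\mathbf X})\,\eta\right\}\le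 4\exp\{-cn\min(\eta^2,\eta)\}.$$
   Context: $\mathcal U$ is a compact interval, $\mathbb H=L_2(\mathcal U)$ is real with $\langle f,g\rangle=\int_{\mathcal U}f(u)g(u)\,du$, and $\mathbb H^p$ has inner product $\langle\mathbf f,\mathbf g\rangle=\sum_{j=1}^p\langle f_j,g_j\rangle$ and norm $\|\mathbf f\|=\langle\mathbf f,\mathbf f\rangle^{1/2}$; $\|\mathbf f\|_0=\sum_{j=1}^pI(\|f_j\|\ne0)$. $\{\mathbf X_t(\cdot)\}_{t\in\mathbb Z}$, $\mathbf X_t=(X_{t1},\dots,X_{tp})^{T}$, is a sequence of $p$-dimensional mean-zero, covariance-stationary (jointly) Gaussian random curves on $\mathcal U$, with autocovariance matrix functions $\boldsymbol\Sigma_h(u,v)=\mathrm{Cov}\{\mathbf X_t(u),\mathbf X_{t+h}(v)\}=(\Sigma_{h,jk}(u,v))_{1\le j,k\le p}$, $h\in\mathbb Z$, and autocovariance matrix operators $\boldsymbol\Xi_h(\boldsymbol\Phi)(u)=\int_{\mathcal U}\boldsymbol\Sigma_h(u,v)\boldsymbol\Phi(v)\,dv$ on $\mathbb H^p$. The spectral density matrix operator at frequency $\theta\in[-\pi,\pi]$ is $\mathscr F_{\mathbf X,\theta}(\boldsymbol\Phi)=\frac1{2\pi}\sum_{h\in\mathbb Z}\boldsymbol\Xi_h(\boldsymbol\Phi)\exp(-ih\theta)$ (it ''exists'' when this series converges). Let $\mathbb H_0^p=\{\boldsymbol\Phi\in\mathbb H^p:\langle\boldsymbol\Phi,\boldsymbol\Xi_0(\boldsymbol\Phi)\rangle\in(0,\infty)\}$.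 The functional stability measure is $$\mathcal M(\mathscr F_{\mathbf X})=2\pi\cdot\operatorname*{ess\,sup}_{\theta\in[-\pi,\pi],\,\boldsymbol\Phi\in\mathbb H_0^p}\frac{\langle\boldsymbol\Phi,\mathscr F_{\mathbf X,\theta}(\boldsymbol\Phi)\rangle}{\langle\boldsymbol\Phi,\boldsymbol\Xi_0(\boldsymbol\Phi)\rangle},$$ and for $k=1,\dots,p$, $\mathcal M_k(\mathscr F_{\mathbf X})$ is the same quantity with the supremum restricted to $\boldsymbol\Phi\in\mathbb H_0^p$ with $\|\boldsymbol\Phi\|_0\le k$. Based on observations $\mathbf X_1,\dots,\mathbf X_n$, $\widehat{\boldsymbol\Sigma}_0(u,v)=n^{-1}\sum_{t=1}^n\mathbf X_t(u)\mathbf X_t(v)^{T}$ and $\widehat{\boldsymbol\Xi}_0$ is the operator on $\mathbb H^p$ with kernel $\widehat{\boldsymbol\Sigma}_0$. *)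

(* Defs.v *)
From HB Require Import structures.
From mathcomp Require Import all_boot all_order all_algebra.
From mathcomp Require Import complex.
From mathcomp Require Import all_classical all_reals all_analysis.
From mathcomp Require Import ess_sup_inf.

Set Implicit Arguments.
Unset Strict Implicit.
Unset Printing Implicit Defensive.

Import Order.TTheory GRing.Theory Num.Theory.
Import numFieldNormedType.Exports.

Local Open Scope classical_set_scope.
Local Open Scope ring_scope.

(* Elements of H = L_2([a, b]) are represented by functions on R of which only the
   restriction to [a, b] matters; no quotient by a.e. equality is taken, as
   every quantity below is invariant under it. *)

Definition L2 (R : realType) (a b : R) : set (R -> R) :=
  [set f : R -> R | measurable_fun `[a, b] f /\
           (\int[lebesgue_measure]_(u in `[a, b]) (f u ^+ 2)%:E < +oo)%E].

Definition L2inner (R : realType) (a b : R) (f g : R -> R) : R :=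
  \int[lebesgue_measure]_(u in `[a, b]) (f u * g u).

Definition L2norm (R : realType) (a b : R) (f : R -> R) : R :=
  Num.sqrt (L2inner a b f f).

Definition Hp (R : realType) (a b : R) (p : nat) : set ('I_p -> R -> R) :=
  [set Phi | forall j, L2 a b (Phi j)].
Arguments Hp {R} a b p.

Definition innerp (R : realType) (a b : R) (p : nat)
    (Phi Psi : 'I_p -> R -> R) : R :=
  \sum_(j < p) L2inner a b (Phi j) (Psi j).

Definition norm0 (R : realType) (a b : R) (p : nat)
    (Phi : 'I_p -> R -> R) : nat :=
  (\sum_(j < p) (L2norm a b (Phi j) != 0%R))%N.

(* The complexification of H^p, in which the spectral density operator takes
   its values, is represented by real and imaginary parts. *)
Definition Re_fun (R : realType) (p : nat) (G : 'I_p -> R -> R[i]) :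
  'I_p -> R -> R := fun j u => complex.Re (G j u).

Definition Im_fun (R : realType) (p : nat) (G : 'I_p -> R -> R[i]) :
  'I_p -> R -> R := fun j u => complex.Im (G j u).

Definition HpC (R : realType) (a b : R) (p : nat) : set ('I_p -> R -> R[i]) :=
  [set G | Hp a b p (Re_fun G) /\ Hp a b p (Im_fun G)].
Arguments HpC {R} a b p.

(* The squared norm; extended-real, so that it is +oo (and not the default
   value 0) for functions that are not square integrable. *)
Definition sqnormC (R : realType) (a b : R) (p : nat)
    (G : 'I_p -> R -> R[i]) : \bar R :=
  (\sum_(j < p)
    \int[lebesgue_measure]_(u in `[a, b]) (Normc.normc (G j u) ^+ 2)%:E)%E.

(* The inner product with a real element on the left. *)
Definition innerC (R : realType) (a b : R) (p : nat)
    (Phi : 'I_p -> R -> R) (G : 'I_p -> R -> R[i]) : R[i] :=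
  (innerp a b Phi (Re_fun G) +i* innerp a b Phi (Im_fun G))%C.

Definition kernel_op (R : realType) (a b : R) (p : nat)
    (K : 'I_p -> 'I_p -> R -> R -> R) (Phi : 'I_p -> R -> R) :
    'I_p -> R -> R :=
  fun j u =>
    \sum_(k < p) \int[lebesgue_measure]_(v in `[a, b]) (K j k u v * Phi k v).

(* The case s = 0 is the point mass at m; it has to be singled out because
   [normal_prob m 0] is, by convention, a uniform distribution. *)
Definition gaussian_rv d (Omega : measurableType d) (R : realType)
    (P : probability Omega R) (Y : Omega -> R) : Prop :=
  measurable_fun setT Y /\
  exists m s : R, forall A : set R, measurable A ->
    P (Y @^-1` A) = if s == 0 then \d_m A else normal_prob m s A.

(* X t j u is the random variable X_{tj}(u); each coordinate curve is jointly
   measurable in the sample point and u, so that its integrals over [a, b] are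
   random variables. *)
Definition random_curves d (Omega : measurableType d) (R : realType)
    (a b : R) (p : nat) (X : int -> 'I_p -> R -> Omega -> R) : Prop :=
  forall t j, measurable_fun (setT `*` `[a, b])
    (fun z : Omega * measurableTypeR R => X t j z.2 z.1).

(* The whole family (X_{tj}(u))_{t, j, u} is a Gaussian process. *)
Definition jointly_gaussian d (Omega : measurableType d) (R : realType)
    (P : probability Omega R) (a b : R) (p : nat)
    (X : int -> 'I_p -> R -> Omega -> R) : Prop :=
  forall (m : nat) (c : 'I_m -> R) (t : 'I_m -> int) (j : 'I_m -> 'I_p)
    (u : 'I_m -> R), (forall i, u i \in `[a, b]) ->
    gaussian_rv P (fun w => \sum_(i < m) c i * X (t i) (j i) (u i) w).

Definition mean_zero d (Omega : measurableType d) (R : realType)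
    (P : probability Omega R) (a b : R) (p : nat)
    (X : int -> 'I_p -> R -> Omega -> R) : Prop :=
  forall t j u, u \in `[a, b] -> 'E_P[X t j u]%E = 0%E.

Definition cov_stationary d (Omega : measurableType d) (R : realType)
    (P : probability Omega R) (a b : R) (p : nat)
    (X : int -> 'I_p -> R -> Omega -> R) : Prop :=
  forall t h j k u v, u \in `[a, b] -> v \in `[a, b] ->
    covariance P (X t j u) (X (t + h) k v) =
    covariance P (X 0 j u) (X h k v).

(* Sigma_{h,jk}(u, v); under [cov_stationary] the base time 0 is immaterial. *)
Definition Sigma d (Omega : measurableType d) (R : realType)
    (P : probability Omega R) (p : nat)
    (X : int -> 'I_p -> R -> Omega -> R) (h : int) :
    'I_p -> 'I_p -> R -> R -> R :=
  fun j k u v => fine (covariance P (X 0 j u) (X h k v)).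

Definition Xi d (Omega : measurableType d) (R : realType)
    (P : probability Omega R) (a b : R) (p : nat)
    (X : int -> 'I_p -> R -> Omega -> R) (h : int) :
    ('I_p -> R -> R) -> 'I_p -> R -> R :=
  kernel_op a b (Sigma P X h).

Definition lambda0 d (Omega : measurableType d) (R : realType)
    (P : probability Omega R) (a b : R) (p : nat)
    (X : int -> 'I_p -> R -> Omega -> R) : \bar R :=
  \big[maxe/-oo%E]_(j < p)
    (\int[lebesgue_measure]_(u in `[a, b]) (Sigma P X 0 j j u u)%:E)%E.

Definition Sigma0_hat (Omega : Type) (R : realType) (p : nat)
    (X : int -> 'I_p -> R -> Omega -> R) (n : nat) (w : Omega) :
    'I_p -> 'I_p -> R -> R -> R :=
  fun j k u v =>
    n%:R^-1 * \sum_(1 <= t < n.+1) X (t%:Z) j u w * X (t%:Z) k v w.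

Definition Xi0_hat (Omega : Type) (R : realType) (a b : R) (p : nat)
    (X : int -> 'I_p -> R -> Omega -> R) (n : nat) (w : Omega) :
    ('I_p -> R -> R) -> 'I_p -> R -> R :=
  kernel_op a b (Sigma0_hat X n w).

Definition expi (R : realType) (x : R) : R[i] := (cos x +i* sin x)%C.

(* The symmetric partial sum, over |h| <= N, where h = i - N. *)
Definition spectral_partial_sum d (Omega : measurableType d) (R : realType)
    (P : probability Omega R) (a b : R) (p : nat)
    (X : int -> 'I_p -> R -> Omega -> R) (N : nat) (theta : R)
    (Phi : 'I_p -> R -> R) : 'I_p -> R -> R[i] :=
  fun j u =>
    ((2 * pi)^-1)%:C%C *
    \sum_(i < (2 * N).+1)
      let h := (i : nat)%:Z - N%:Z in
      (Xi P a b X h Phi j u)%:C%C * expi (- (h%:~R * theta)).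

(* F theta Phi is the sum, in the norm of the complexified H^p, of the series
   defining the spectral density operator; F is thereby determined up to a.e.
   equality on the functions of H^p and the frequencies in [-pi, pi].  The
   existence of such an F is the convergence of all these series. *)
Definition is_spectral_density d (Omega : measurableType d) (R : realType)
    (P : probability Omega R) (a b : R) (p : nat)
    (X : int -> 'I_p -> R -> Omega -> R)
    (F : R -> ('I_p -> R -> R) -> 'I_p -> R -> R[i]) : Prop :=
  forall theta, theta \in `[- pi, pi] -> forall Phi, Hp a b p Phi ->
    HpC a b p (F theta Phi) /\
    (fun N : nat => sqnormC a b (fun j u =>
       spectral_partial_sum P a b X N theta Phi j u - F theta Phi j u))
      @ \oo --> 0%E.

Definition H0p d (Omega : measurableType d) (R : realType)
    (P : probability Omega R) (a b : R) (p : nat)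
    (X : int -> 'I_p -> R -> Omega -> R) : set ('I_p -> R -> R) :=
  [set Phi | Hp a b p Phi /\ 0 < innerp a b Phi (Xi P a b X 0 Phi)].

(* <Phi, F theta Phi> is real, since Xi (- h) is the adjoint of Xi h; the
   projection Re only turns it into an element of R. *)
Definition rayleigh d (Omega : measurableType d) (R : realType)
    (P : probability Omega R) (a b : R) (p : nat)
    (X : int -> 'I_p -> R -> Omega -> R)
    (F : R -> ('I_p -> R -> R) -> 'I_p -> R -> R[i])
    (theta : R) (Phi : 'I_p -> R -> R) : R :=
  complex.Re (innerC a b Phi (F theta Phi)) /
    innerp a b Phi (Xi P a b X 0 Phi).

(* The essential supremum is with respect to Lebesgue measure on the
   frequencies of [-pi, pi]; the one over Phi is an ordinary supremum. *)
Definition stability_on d (Omega : measurableType d) (R : realType)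
    (P : probability Omega R) (a b : R) (p : nat)
    (X : int -> 'I_p -> R -> Omega -> R)
    (F : R -> ('I_p -> R -> R) -> 'I_p -> R -> R[i])
    (S : set ('I_p -> R -> R)) : \bar R :=
  ((2 * pi)%:E *
   ess_sup (mrestr lebesgue_measure (measurable_itv `[- pi, pi]%R))
     (fun theta : R => ereal_sup
        [set (rayleigh P a b X F theta Phi)%:E | Phi in S]))%E.

Definition stability d (Omega : measurableType d) (R : realType)
    (P : probability Omega R) (a b : R) (p : nat)
    (X : int -> 'I_p -> R -> Omega -> R)
    (F : R -> ('I_p -> R -> R) -> 'I_p -> R -> R[i]) : \bar R :=
  stability_on P a b X F (H0p P a b X).

Definition stability_k d (Omega : measurableType d) (R : realType)
    (P : probability Omega R) (a b : R) (p : nat)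
    (X : int -> 'I_p -> R -> Omega -> R)
    (F : R -> ('I_p -> R -> R) -> 'I_p -> R -> R[i]) (k : nat) : \bar R :=
  stability_on P a b X F
    (H0p P a b X `&` [set Phi | (norm0 a b Phi <= k)%N]).

Definition deviation d (Omega : measurableType d) (R : realType)
    (P : probability Omega R) (a b : R) (p : nat)
    (X : int -> 'I_p -> R -> Omega -> R) (n : nat)
    (Phi Psi : 'I_p -> R -> R) (w : Omega) : R :=
  innerp a b Phi
    (fun j u => Xi0_hat a b X n w Psi j u - Xi P a b X 0 Psi j u).

(* Main.v *)
(** Write Y_t for the integral of Phi against X_t. The Y_t form a centred stationary
    Gaussian sequence with autocovariance g(h) = <Phi, Xi_h Phi>, whose Fourier series
    is 2 pi <Phi, F_theta Phi>, essentially bounded by M_k g(0). A Toeplitz form whose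
    symbol is bounded by M almost everywhere is bounded by M times the squared norm, even if the
    series converges only pointwise: this is Riemann's theory of trigonometric series
    (integrate the series twice and compare second symmetric differences, with a convex
    correction at the exceptional null set). Hence the covariance matrix of
    (Y_1, ..., Y_n) has eigenvalues in [0, M_k g(0)], and after diagonalization
    Chernoff's bound for a weighted chi-square sum gives the first inequality. The second one
    follows by polarization, applying the same concentration to Phi1 + Phi2 and
    Phi1 - Phi2.

    The Y_t are L^2 limits of Riemann sums of the process. Only a one-sided bound on
    the exponential moment and the exact mean of the cosine are carried through that limit;
    they suffice for both tails. *)
Require Import Defs.
From HB Require Import structures.
From mathcomp Require Import all_boot all_order all_algebra.
From mathcomp Require Import complex.
From mathcomp Require Import all_classical all_reals all_analysis.
From mathcomp Require Import ess_sup_inf.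
From mathcomp Require Import measurable_realfun spectral.
From mathcomp Require Import ring lra zify.
Import Order.TTheory GRing.Theory Num.Theory.
Import numFieldNormedType.Exports.
Local Open Scope classical_set_scope.
Local Open Scope ring_scope.
Set Implicit Arguments.
Unset Strict Implicit.
Unset Printing Implicit Defensive.

(** Convergence of the spectral series at a fixed [Phi] yields a cosine series converging pointwise
    to a symbol [phi]. Second differences of the twice integrated series are the same series with
    absolutely summable weights [sinc2], and are bounded above at every frequency; averaging over
    finitely many roots of unity then replaces the integral.

    Joint Gaussianity enters through two facts on each linear combination: its exponential moment
    and the mean of its cosine. An auxiliary standard normal variable linearizes one square at a
    time, so that a diagonal variance form does the work of independence.

    The constant 1/16 is set by the choice of the Chernoff parameter [s]. Polarization leaves to
    each of its two forms the threshold [K * eta] for its own variance bound [K], hence the same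
    constant with twice the prefactor. *)

Section real_integrable.
Context d {T : measurableType d} {R : realType}.
Variables (mu : {measure set T -> \bar R}) (D : set T) (mD : measurable D).
Implicit Types (f g : T -> R).

Lemma integrableRD f g : mu.-integrable D (EFin \o f) -> mu.-integrable D (EFin \o g) ->
  mu.-integrable D (EFin \o (fun t => f t + g t)).
Proof. by move=> hf hg; exact: (integrableD mD hf hg). Qed.

Lemma integrableRB f g : mu.-integrable D (EFin \o f) -> mu.-integrable D (EFin \o g) ->
  mu.-integrable D (EFin \o (fun t => f t - g t)).
Proof. by move=> hf hg; exact: (integrableB mD hf hg). Qed.

Lemma integrableRZ k f : mu.-integrable D (EFin \o f) ->
  mu.-integrable D (EFin \o (fun t => k * f t)).
Proof. by move=> hf; exact: (integrableZl mD k hf). Qed.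

Lemma integrableR_sum (I : Type) (s : seq I) (P : pred I) (F : I -> T -> R) :
  (forall i, P i -> mu.-integrable D (EFin \o F i)) ->
  mu.-integrable D (EFin \o (fun t => \sum_(i <- s | P i) F i t)).
Proof.
move=> h; elim: s => [|i s IH].
  by under eq_fun do rewrite big_nil; exact: integrable0.
under eq_fun do rewrite big_cons.
by case: (boolP (P i)) => Pi //; apply: integrableRD => //; exact: h.
Qed.

Lemma Rintegral_sum (I : Type) (s : seq I) (P : pred I) (F : I -> T -> R) :
  (forall i, P i -> mu.-integrable D (EFin \o F i)) ->
  \int[mu]_(t in D) (\sum_(i <- s | P i) F i t) =
  \sum_(i <- s | P i) \int[mu]_(t in D) F i t.
Proof.
move=> h; elim: s => [|i s IH].
  rewrite big_nil; under eq_Rintegral do rewrite big_nil.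
  by rewrite /Rintegral integral0.
rewrite big_cons -IH; under eq_Rintegral do rewrite big_cons.
case: (boolP (P i)) => Pi //; rewrite RintegralD//; first exact: h.
exact: integrableR_sum.
Qed.

Lemma ge0_integrable_lty f : measurable_fun D f -> (forall x, D x -> 0 <= f x) ->
  (\int[mu]_(x in D) (f x)%:E < +oo)%E -> mu.-integrable D (EFin \o f).
Proof.
move=> mf f0 fy; apply/integrableP; split; first exact/measurable_EFinP.
rewrite (eq_integral (fun x => (f x)%:E))// => x /set_mem Dx.
by rewrite /= ger0_norm// f0.
Qed.

Lemma le_integrableR f g : measurable_fun D f -> (forall x, D x -> `|f x| <= g x) ->
  mu.-integrable D (EFin \o g) -> mu.-integrable D (EFin \o f).
Proof.
move=> mf fg; apply: le_integrable => //; first exact/measurable_EFinP.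
move=> x Dx /=; rewrite lee_fin; apply: le_trans (fg x Dx) _; exact: ler_norm.
Qed.

End real_integrable.

Lemma cvgn_le_near {R : realType} (u : nat -> R) (l b : R) :
  u @ \oo --> l -> (\forall n \near \oo, u n <= b) -> l <= b.
Proof.
move=> ul ub; rewrite -(cvg_lim _ ul)//.
by apply: limr_le => //; apply/cvg_ex; exists l.
Qed.

Lemma sqr_sum_le (R : realType) (I : Type) (r : seq I) (e : I -> R) :
  (\sum_(i <- r) e i) ^+ 2 <= (size r)%:R * \sum_(i <- r) e i ^+ 2.
Proof.
elim: r => [|i r IH]; first by rewrite !big_nil expr0n mul0r.
rewrite !big_cons/=; set S := \sum_(i <- r) e i in IH *; set Q := \sum_(i <- r) e i ^+ 2 in IH *.
have [r0|r0] := posnP (size r).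
  have : S = 0 by rewrite /S; case: (r) r0 => // _; rewrite big_nil.
  have Q0 : 0 <= Q by apply: sumr_ge0 => k _; exact: sqr_ge0.
  by move=> ->; rewrite r0 mul1r addr0 lerDl.
have k0 : 0 < (size r)%:R :> R by rewrite ltr0n.
rewrite -natr1; set k : R := (size r)%:R in IH k0 *.
(* Young's inequality weighted by the length [k]; with the induction hypothesis [S ^+ 2 <= k * Q] it
   bounds the cross term by [k * e i ^+ 2 + Q]. *)
have h1 : 2 * k * e i * S <= k ^+ 2 * e i ^+ 2 + S ^+ 2.
  by have := sqr_ge0 (k * e i - S); lra.
have h : 2 * e i * S <= k * e i ^+ 2 + Q.
  rewrite -(ler_pM2l k0).
  by move: h1 IH; rewrite !expr2; lra.
by rewrite sqrrD; move: IH h; rewrite -mulr_natr !expr2; lra.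
Qed.

Section level_sets.
Context d {T : measurableType d} {R : realType} (f : T -> R) (x : R).
Hypothesis mf : measurable_fun setT f.

Lemma measurable_set_ge : measurable [set w | x <= f w].
Proof.
rewrite [X in measurable X](_ : _ = setT `&` f @^-1` `[x, +oo[); first exact: mf.
by apply/seteqP; split => w /=; rewrite in_itv/= andbT; [move=> h; split|case].
Qed.

Lemma measurable_set_le : measurable [set w | f w <= x].
Proof.
rewrite [X in measurable X](_ : _ = setT `&` f @^-1` `]-oo, x]); first exact: mf.
by apply/seteqP; split => w /=; rewrite in_itv/=; [move=> h; split|case].
Qed.

Lemma measurable_set_gt : measurable [set w | x < f w].
Proof.
rewrite [X in measurable X](_ : _ = setT `&` f @^-1` `]x, +oo[); first exact: mf.
by apply/seteqP; split => w /=; rewrite in_itv/= andbT; [move=> h; split|case].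
Qed.

End level_sets.

(** * Square-integrable functions and the Cauchy-Schwarz inequality *)

Section sqr_integrable.
Context d {T : measurableType d} {R : realType} (mu : {measure set T -> \bar R}).

Lemma integrable_mul_of_sqr (f g : T -> R) : measurable_fun setT f -> measurable_fun setT g ->
  mu.-integrable setT (EFin \o (fun w => f w ^+ 2)) ->
  mu.-integrable setT (EFin \o (fun w => g w ^+ 2)) ->
  mu.-integrable setT (EFin \o (fun w => f w * g w)).
Proof.
move=> mf mg if2 ig2; apply: (@le_integrableR _ _ _ mu _ measurableT _ (fun w => f w ^+ 2 + g w ^+ 2)) => //.
- exact: measurable_funM.
- move=> w _; rewrite ler_norml; apply/andP.
  by have := sqr_ge0 (f w - g w); have := sqr_ge0 (f w + g w); split; nra.
- exact: integrableRD.
Qed.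

Lemma integrable_sqrD (f g : T -> R) (a b : R) : measurable_fun setT f -> measurable_fun setT g ->
  mu.-integrable setT (EFin \o (fun w => f w ^+ 2)) ->
  mu.-integrable setT (EFin \o (fun w => g w ^+ 2)) ->
  mu.-integrable setT (EFin \o (fun w => (a * f w + b * g w) ^+ 2)).
Proof.
move=> mf mg if2 ig2.
rewrite (_ : (fun w => _) = (fun w => (a ^+ 2 * f w ^+ 2 + b ^+ 2 * g w ^+ 2) + (2 * a * b) * (f w * g w))).
  apply: integrableRD => //; first by apply: integrableRD => //; exact: integrableRZ.
  by apply: integrableRZ => //; exact: integrable_mul_of_sqr.
by apply/funext => w; ring.
Qed.

Lemma integrable_sqr_sum (I : Type) (r : seq I) (c : I -> R) (f : I -> T -> R) :
  (forall i, measurable_fun setT (f i)) ->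
  (forall i, mu.-integrable setT (EFin \o (fun w => f i w ^+ 2))) ->
  mu.-integrable setT (EFin \o (fun w => (\sum_(i <- r) c i * f i w) ^+ 2)).
Proof.
move=> mf i2; elim: r => [|i r IH].
  by under eq_fun do rewrite big_nil expr0n; exact: integrable0.
under eq_fun do rewrite big_cons -[X in _ + X]mul1r.
apply: integrable_sqrD => //.
by apply: measurable_sum => k; exact: measurable_funM.
Qed.

(** The quadratic form [s ^+ 2 * A + t ^+ 2 * B - 2 * s * t * C] is nonnegative, being the integral
    of a square; it is evaluated at [s = B], [t = C]. *)
Lemma Rintegral_CauchySchwarz (f g : T -> R) : measurable_fun setT f -> measurable_fun setT g ->
  mu.-integrable setT (EFin \o (fun w => f w ^+ 2)) ->
  mu.-integrable setT (EFin \o (fun w => g w ^+ 2)) ->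
  (\int[mu]_w (f w * g w)) ^+ 2 <= (\int[mu]_w (f w ^+ 2)) * \int[mu]_w (g w ^+ 2).
Proof.
move=> mf mg if2 ig2; have ifg := integrable_mul_of_sqr mf mg if2 ig2.
set A := \int[mu]_w (f w ^+ 2); set B := \int[mu]_w (g w ^+ 2); set C := \int[mu]_w (f w * g w).
have h s t : 0 <= s ^+ 2 * A + t ^+ 2 * B - 2 * s * t * C.
  have -> : s ^+ 2 * A + t ^+ 2 * B - 2 * s * t * C = \int[mu]_w ((s * f w - t * g w) ^+ 2).
    rewrite (_ : (fun w => _) = (fun w => (s ^+ 2 * f w ^+ 2 + t ^+ 2 * g w ^+ 2) - (2 * s * t) *
      (f w * g w))).
      rewrite RintegralB//; last 2 first.
      - by apply: integrableRD => //; exact: integrableRZ.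
      - exact: integrableRZ.
      by rewrite RintegralD//; try exact: integrableRZ; rewrite !RintegralZl.
    by apply/funext => w; ring.
  by apply: Rintegral_ge0 => w _; exact: sqr_ge0.
have A0 : 0 <= A by apply: Rintegral_ge0 => w _; exact: sqr_ge0.
have B0 : 0 <= B by apply: Rintegral_ge0 => w _; exact: sqr_ge0.
have [B1|B1] := eqVneq B 0.
  have [C0|C0] := eqVneq C 0; first by rewrite C0 expr0n mulr_ge0.
  (* For [B = 0] the form is affine in [t]; this [t] would give it the value -1. *)
  have := h 1 ((A + 1) / (2 * C)); rewrite B1 !mulr0 expr1n addr0.
  by rewrite (_ : _ - _ = - 1) ?oppr_ge0 ?ler10//; field.
have {}B1 : 0 < B by rewrite lt_neqAle eq_sym B1.
have := h B C; rewrite (_ : _ - _ = B * (A * B - C ^+ 2)); last by ring.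
by rewrite pmulr_rge0// subr_ge0.
Qed.

End sqr_integrable.

(** * Fubini's theorem for real-valued integrals *)

Section Rfubini_section.
Context d1 d2 (T1 : measurableType d1) (T2 : measurableType d2) (R : realType)
  (m1 : {sigma_finite_measure set T1 -> \bar R})
  (m2 : {sigma_finite_measure set T2 -> \bar R}) (f : T1 * T2 -> R).
Hypothesis intf : (m1 \x m2)%E.-integrable setT (EFin \o f).

Lemma Rintegrable_fubini1 : m1.-integrable setT (EFin \o (fun x => \int[m2]_y f (x, y))).
Proof.
have h := integrable_fubini_F intf.
apply: (le_integrable measurableT _ _ h).
  by apply/measurable_EFinP; apply: measurableT_comp => //; exact: measurable_fubini_F intf.
by move=> x _ /=; rewrite /fubini_F /Rintegral/=; case: (\int[_]_y _)%E => //=; rewrite normr0 leey.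
Qed.

End Rfubini_section.

Lemma integrable_swap d1 d2 (T1 : measurableType d1) (T2 : measurableType d2) (R : realType)
  (m1 : {sigma_finite_measure set T1 -> \bar R})
  (m2 : {sigma_finite_measure set T2 -> \bar R}) (f : T1 * T2 -> R) :
  (m1 \x m2)%E.-integrable setT (EFin \o f) ->
  (m2 \x m1)%E.-integrable setT (EFin \o (fun z => f (z.2, z.1))).
Proof.
move=> intf; have mf : measurable_fun setT (EFin \o f) by have /integrableP[] := intf.
have ms : measurable_fun setT (fun z : T2 * T1 => (z.2, z.1)).
  by apply: measurable_fun_pair; [exact: measurable_snd|exact: measurable_fst].
apply/(integrable12ltyP m2 m1); first exact: measurableT_comp mf ms.
by move/(integrable21ltyP m1 m2 mf): intf.
Qed.

Section Rfubini.
Context d1 d2 (T1 : measurableType d1) (T2 : measurableType d2) (R : realType)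
  (m1 : {sigma_finite_measure set T1 -> \bar R})
  (m2 : {sigma_finite_measure set T2 -> \bar R}) (f : T1 * T2 -> R).
Hypothesis intf : (m1 \x m2)%E.-integrable setT (EFin \o f).

Lemma Rintegrable_fubini2 : m2.-integrable setT (EFin \o (fun y => \int[m1]_x f (x, y))).
Proof. exact: (Rintegrable_fubini1 (integrable_swap intf)). Qed.

(** The real inner integral is sure to agree with the extended one only on integrable sections;
    almost all sections are, so both outer integrals are unchanged and the extended-real theorem
    applies. *)
Lemma Rfubini : \int[m1]_x \int[m2]_y f (x, y) = \int[m2]_y \int[m1]_x f (x, y).
Proof.
rewrite /Rintegral; congr fine.
transitivity (\int[m1]_x \int[m2]_y ((f (x, y))%:E))%E.
  apply: ae_eq_integral => //.
  - by have /integrableP[] := Rintegrable_fubini1 intf.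
  - exact: (measurable_fubini_F intf).
  apply: filterS (ae_integrable1 intf) => x hx _.
  by rewrite fineK//; apply: integrable_fin_num.
transitivity (\int[m2]_y \int[m1]_x ((f (x, y))%:E))%E; first exact: (Fubini intf).
apply: ae_eq_integral => //.
- exact: (measurable_fubini_F (integrable_swap intf)).
- by have /integrableP[] := Rintegrable_fubini2.
apply: filterS (ae_integrable2 intf) => x hx _.
by rewrite fineK//; apply: integrable_fin_num.
Qed.

End Rfubini.

Lemma Rfubini_bounded d1 d2 (T1 : measurableType d1) (T2 : measurableType d2) (R : realType)
    (P : probability T1 R) (Q : probability T2 R) (f : T1 * T2 -> R) (B : R) :
  measurable_fun setT f -> (forall z, `|f z| <= B) ->
  \int[P]_x \int[Q]_y f (x, y) = \int[Q]_y \int[P]_x f (x, y).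
Proof.
move=> mf fB; apply: Rfubini.
apply: measurable_bounded_integrable => //.
  have h : (P \x Q)%E setT = 1%E.
    transitivity ((P \x Q)%E ([set: T1] `*` [set: T2])); first by rewrite setXTT.
    transitivity (P setT * Q setT)%E; first exact: product_measure1E.
    rewrite (_ : P setT = 1%E); last exact: probability_setT.
    by rewrite (_ : Q setT = 1%E) ?mule1//; exact: probability_setT.
  by apply: (le_lt_trans _ (ltry 1)); rewrite -h; exact: lexx.
by exists B; split; [exact: num_real|move=> t Bt y _; apply: le_trans (fB y) (ltW Bt)].
Qed.

(** * Toeplitz forms with essentially bounded symbol *)

Section sinc.
Context {R : realType}.
Implicit Types (d x : R) (n : nat).

(** Riemann's factor: the second symmetric difference of [- cos (n * x) / n ^+ 2] with step [2 * d],
    divided by [(2 * d) ^+ 2], is [sinc2 d n * cos (n * x)]. The value at 0 is the limit 1; the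
    quotient itself would give 0 there. *)
Definition sinc2 d n : R := if n == 0%N then 1 else (sin (n%:R * d) / (n%:R * d)) ^+ 2.

Lemma one_le_pihalf : (1 : R) <= pi / 2.
Proof. by have := @pi_ge2 R; lra. Qed.

Lemma sin_cos_ge0 x : 0 <= x <= 1 -> 0 <= sin x /\ 0 <= cos x.
Proof.
move=> /andP[x0 x1]; have h := one_le_pihalf; split.
  by apply: sin_ge0_pi; rewrite x0/=; have := @pi_ge2 R; lra.
by apply: cos_ge0_pihalf; apply/andP; split; lra.
Qed.

(** Discrete form of [x * cos x <= sin x], by induction with the addition formulas; [n * d <= 1]
    keeps all the sines and cosines nonnegative. It gives the monotonicity of [sinc2 d]. *)
Lemma sin_natmul_ge d n : 0 <= d -> n%:R * d <= 1 ->
  n%:R * sin d * cos (n%:R * d) <= sin (n%:R * d).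
Proof.
move=> d0; elim: n => [|n IH].
  by rewrite !mul0r sin0.
rewrite -natr1 => h.
have nd0 : 0 <= n%:R * d by rewrite mulr_ge0.
have nd1 : n%:R * d <= 1 by lra.
have d1 : d <= 1 by lra.
have [S0 C0] : 0 <= sin (n%:R * d) /\ 0 <= cos (n%:R * d) by apply: sin_cos_ge0; apply/andP.
have [s0 c0] : 0 <= sin d /\ 0 <= cos d by apply: sin_cos_ge0; apply/andP.
have {IH} := IH nd1.
rewrite [(n%:R + 1) * d]mulrDl mul1r sinD cosD.
have c1 := cos_le1 d.
move: S0 C0 s0 c0 c1.
set S := sin (n%:R * d); set C := cos (n%:R * d); set s := sin d; set c := cos d.
move=> S0 C0 s0 c0 c1 IH.
have n0 : 0 <= n%:R :> R by [].
have h1 : n%:R * s * C * c <= S * c by rewrite ler_wpM2r.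
have h2 : 0 <= n%:R * s * (S * s) by rewrite !mulr_ge0.
have h3 : 0 <= s * (S * s) by rewrite !mulr_ge0.
have h4 : 0 <= (1 - c) * (C * s) by rewrite !mulr_ge0// subr_ge0.
nra.
Qed.

Lemma sinc2_ge0 d n : 0 <= sinc2 d n.
Proof. by rewrite /sinc2; case: ifP => // _; rewrite sqr_ge0. Qed.

Lemma abs_sin_le_natmul (x : R) : 0 <= x -> `|sin x| <= x.
Proof.
move=> x0.
have [->|xn0] := eqVneq x 0; first by rewrite sin0 normr0.
have {}x0 : 0 < x by rewrite lt_neqAle eq_sym xn0.
have [c _] := @MVT R sin cos 0 x x0 (fun y _ => is_derive_sin y)
  (continuous_subspaceT (@continuous_sin R)).
rewrite sin0 !subr0 => ->; rewrite normrM (gtr0_norm x0).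
by rewrite ler_piMl ?(ltW x0)// cos_max.
Qed.

Lemma sinc2_le1 d n : 0 <= d -> sinc2 d n <= 1.
Proof.
move=> d0; rewrite /sinc2; case: ifP => // /negbT n0.
have [->|dn0] := eqVneq d 0; first by rewrite mulr0 invr0 mulr0 expr0n.
have nd : 0 < n%:R * d by rewrite mulr_gt0 ?ltr0n ?lt0n// lt_neqAle eq_sym dn0.
rewrite -[leRHS](expr1n _ 2) -ler_sqrt ?expr1n ?ltr01// sqrtr_sqr sqrtr1 normrM normfV.
by rewrite (gtr0_norm nd) ler_pdivrMr// mul1r abs_sin_le_natmul// ltW.
Qed.

Lemma sinc2_le d n : 0 < d -> (0 < n)%N -> sinc2 d n <= (n%:R * d) ^- 2.
Proof.
move=> d0 n0; rewrite /sinc2 eqn0Ngt n0/= exprMn exprVn.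
rewrite ler_piMl ?invr_ge0 ?sqr_ge0// -(expr1n _ 2) -real_normK ?num_real//.
Qed.

(** Without denominators this says [n * sin ((n + 1) * d) <= (n + 1) * sin (n * d)]: expand the left
    side and use [sin_natmul_ge] and [cos d <= 1]. *)
Lemma sinc2_decr d n : 0 < d -> n.+1%:R * d <= 1 -> sinc2 d n.+1 <= sinc2 d n.
Proof.
move=> d0 h; have [->|n0] := posnP n; first exact: (sinc2_le1 _ (ltW d0)).
rewrite /sinc2/= eqn0Ngt n0/=.
have hn : n%:R * d <= 1 by apply: le_trans h; rewrite ler_wpM2r ?ler_nat// ltW.
have np : 0 < n%:R :> R by rewrite ltr0n.
have [S0 C0] : 0 <= sin (n%:R * d) /\ 0 <= cos (n%:R * d).
  by apply: sin_cos_ge0; rewrite hn mulr_ge0// ltW.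
have [s1 _] : 0 <= sin (n.+1%:R * d) /\ 0 <= cos (n.+1%:R * d).
  by apply: sin_cos_ge0; rewrite h mulr_ge0// ltW.
have [s0 c0] : 0 <= sin d /\ 0 <= cos d.
  apply: sin_cos_ge0; rewrite ltW//=; apply: le_trans h.
  by rewrite ler_peMl ?(ltW d0)// ler1n.
rewrite lerXn2r// ?nnegrE ?divr_ge0// ?mulr_ge0// ?(ltW d0)//.
rewrite ler_pdivrMr ?mulr_gt0// mulrAC ler_pdivlMr ?mulr_gt0//.
rewrite [leLHS]mulrA [leRHS]mulrA ler_wpM2r// ?(ltW d0)//.
rewrite -natr1 [(n%:R + 1) * d]mulrDl mul1r sinD.
have := sin_natmul_ge (ltW d0) hn; have := cos_le1 d.
move: S0 C0 s0 c0 => {s1}.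
set S := sin (n%:R * d); set C := cos (n%:R * d); set s := sin d; set c := cos d.
move=> S0 C0 s0 c0 c1 IH.
have : 0 <= n%:R * S * (1 - c) by rewrite !mulr_ge0// subr_ge0.
by nra.
Qed.

(* A decreasing bound for the variation of [sinc2 d]: constant variation up to
   [n d <= 1], where sin x / x decreases, and the tail of [1/x^2 + 1/x] after. *)
Definition sinc2_pot d n : R :=
  if n%:R * d <= 1 then 3 + sinc2 d n else (n%:R * d) ^- 2 + (n%:R * d)^-1.

Lemma sinc2_pot_ge0 d n : 0 < d -> 0 <= sinc2_pot d n.
Proof.
move=> d0; rewrite /sinc2_pot; case: ifP => _.
  by rewrite addr_ge0// sinc2_ge0.
have h : 0 <= n%:R * d by rewrite mulr_ge0// ltW.
by rewrite addr_ge0// invr_ge0// exprn_ge0.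
Qed.

Lemma sin_sqB x y : sin x ^+ 2 - sin y ^+ 2 = sin (x - y) * sin (x + y).
Proof.
rewrite sinB sinD; have hx := cos2Dsin2 x; have hy := cos2Dsin2 y.
have -> : (sin x * cos y - cos x * sin y) * (sin x * cos y + cos x * sin y) =
  sin x ^+2 * cos y ^+ 2 - cos x ^+ 2 * sin y ^+ 2 by ring.
have -> : cos y ^+ 2 = 1 - sin y ^+ 2 by rewrite -hy; ring.
have -> : cos x ^+ 2 = 1 - sin x ^+ 2 by rewrite -hx; ring.
by ring.
Qed.

Lemma sinc2_step d n : 0 < d ->
  `|sinc2 d n - sinc2 d n.+1| <= sinc2_pot d n - sinc2_pot d n.+1.
Proof.
move=> d0; rewrite /sinc2_pot.
have mono : n%:R * d <= n.+1%:R * d by rewrite ler_wpM2r ?(ltW d0)// ler_nat.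
have [h1|h1] := leP (n.+1%:R * d) 1.
  rewrite (le_trans mono h1) ger0_norm; first by lra.
  by rewrite subr_ge0 sinc2_decr.
have a0 := sinc2_ge0 d n; have a1 := sinc2_le1 n (ltW d0).
have b0 := sinc2_ge0 d n.+1; have b1 := sinc2_le1 n.+1 (ltW d0).
have y0 : 0 < n.+1%:R * d by exact: lt_trans h1.
have [h2|h2] := leP (n%:R * d) 1.
  (* The step that crosses 1: the new potential is at most 2, so the potential drops by at least
     [1 + sinc2 d n]. This is why the constant in [sinc2_pot] is 3. *)
  have q1 : (n.+1%:R * d)^-1 <= 1 by rewrite invf_le1// ltW.
  have q2 : (n.+1%:R * d)^-2 <= 1 by rewrite -exprVn expr_le1// invr_ge0 ltW.
  move: q1 q2; set u := (_ ^- 2); set v := (_^-1) => q1 q2.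
  by rewrite ler_norml; apply/andP; split; lra.
have x0 : 0 < n%:R * d by exact: lt_trans h2.
have n0 : n != 0%N by apply/eqP => n0; rewrite n0 mul0r ltxx in x0.
rewrite /sinc2 (negbTE n0)/=.
set x := n%:R * d in h2 x0 mono *; set y := n.+1%:R * d in h1 y0 mono *.
have xy : y - x = d by rewrite /x /y -natr1; ring.
rewrite ![(_ / _) ^+ 2]exprMn !exprVn.
(* The first part is at most the decrease of the inverse square. For the second, [sin_sqB] bounds
   the difference of squares by [d], and [d * y ^- 2 <= d / (x * y) = x^-1 - y^-1]. *)
have -> : sin x ^+ 2 * x ^-2 - sin y ^+ 2 * y ^- 2 =
   sin x ^+ 2 * (x ^- 2 - y ^- 2) + (sin x ^+ 2 - sin y ^+ 2) * y ^- 2 by ring.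
have hxy : 0 <= x^-2 - y^-2.
  by rewrite subr_ge0 -!exprVn lerXn2r ?nnegrE ?invr_ge0 ?(ltW x0) ?(ltW y0)// lef_pV2.
apply: (le_trans (ler_normD _ _)).
rewrite opprD addrACA; apply: lerD.
  rewrite normrM (ger0_norm hxy); apply: ler_piMl => //; rewrite ger0_norm ?sqr_ge0//.
rewrite sin_sqB !normrM.
have -> : x^-1 - y^-1 = d * (x^-1 * y^-1).
  by rewrite -xy; field; rewrite gt_eqF// gt_eqF.
have h3 : `|sin (x - y)| <= d.
  by rewrite -opprB sinN normrN xy abs_sin_le_natmul// ltW.
rewrite -mulrA; apply: ler_pM => //.
have -> : `|y ^- 2| = y^-1 * y^-1.
  by rewrite -exprVn expr2 ger0_norm// mulr_ge0// invr_ge0 ltW.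
apply: le_trans (_ : 1 * (y^-1 * y^-1) <= _).
  by rewrite ler_wpM2r ?sin_max// mulr_ge0// invr_ge0 ltW.
by rewrite mul1r ler_wpM2r ?invr_ge0 ?(ltW y0)// lef_pV2.
Qed.

(** The bound must not depend on [d] or [N]: telescoping leaves at most [sinc2_pot d 0 = 3 + 1]. *)
Lemma sinc2_var d N : 0 < d -> \sum_(n < N) `|sinc2 d n - sinc2 d n.+1| <= 4.
Proof.
move=> d0; apply: (@le_trans _ _ (sinc2_pot d 0 - sinc2_pot d N)).
  elim: N => [|N IH]; first by rewrite big_ord0 subrr.
  rewrite big_ord_recr/=; have := sinc2_step N d0; lra.
have := sinc2_pot_ge0 N d0.
rewrite {2}/sinc2_pot mul0r ler01 /sinc2 eqxx; lra.
Qed.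

(** By the mean value theorem [sin x / x] is [cos c] with [c < x <= 1], hence at least [cos x], and
    [cos x ^+ 2 = 1 - sin x ^+ 2 >= 1 - x ^+ 2]. *)
Lemma sinc2_ge d n : 0 < d -> n%:R * d <= 1 -> 1 - (n%:R * d) ^+ 2 <= sinc2 d n.
Proof.
move=> d0 h; have [->|n0] := posnP n.
  by rewrite /sinc2 eqxx gerBl sqr_ge0.
rewrite /sinc2 eqn0Ngt n0/=; set x := n%:R * d in h *.
have x0 : 0 < x by rewrite mulr_gt0 ?ltr0n.
have [c] := @MVT R sin cos 0 x x0 (fun y _ => is_derive_sin y)
  (continuous_subspaceT (@continuous_sin R)).
rewrite in_itv/= sin0 !subr0 => /andP[c0 cx] ->.
rewrite mulfK ?gt_eqF//.
have [sx0 cx0] : 0 <= sin x /\ 0 <= cos x by apply: sin_cos_ge0; rewrite (ltW x0).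
have [sc0 cc0] : 0 <= sin c /\ 0 <= cos c by apply: sin_cos_ge0; apply/andP; split; lra.
have pi1 := @pi_ge2 R.
have hc : cos x <= cos c.
  by rewrite ltW// ltr_cos// in_itv/=; apply/andP; split; lra.
apply: (@le_trans _ _ (cos x ^+ 2)); last by rewrite lerXn2r.
rewrite cos2sin2.
 rewrite lerD2l lerN2.
rewrite lerXn2r// ?nnegrE ?(ltW x0)//.
by rewrite -(ger0_norm sx0) abs_sin_le_natmul// ltW.
Qed.

(** As long as [N * d <= 1] the weights decrease, so their variation is [1 - sinc2 d N], which for
    fixed [N] tends to 0 with [d]. *)
Lemma sinc2_var_small d N : 0 < d -> N%:R * d <= 1 ->
  \sum_(n < N) `|sinc2 d n - sinc2 d n.+1| <= (N%:R * d) ^+ 2.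
Proof.
move=> d0 h; apply: (@le_trans _ _ (1 - sinc2 d N)); last first.
  by have := sinc2_ge d0 h; lra.
have -> : 1 = sinc2 d 0 by rewrite /sinc2 eqxx.
elim: N h => [|N IH] h; first by rewrite big_ord0 subrr.
rewrite big_ord_recr/= ger0_norm ?subr_ge0 ?sinc2_decr//.
have : N%:R * d <= 1 by apply: le_trans h; rewrite ler_wpM2r ?ler_nat// ltW.
by move=> /IH; lra.
Qed.

(* Riemann: the weights [sinc2 d] sum every convergent series, as d -> 0. *)
Lemma riemann_summation (u : nat -> R) (l : R) : series u @ \oo --> l ->
  forall e, 0 < e -> exists2 d0, 0 < d0 & forall d, 0 < d < d0 ->
  \forall N \near \oo, `|series (fun h => sinc2 d h * u h) N - l| <= e.
Proof.
move=> ul e e0; pose T := series u.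
(* Summation by parts on the partial sums, recentred at their limit [l]. *)
have abel d N : series (fun h => sinc2 d h * u h) N - l =
    sinc2 d N * (T N - l) +
    \sum_(h < N) (sinc2 d h - sinc2 d h.+1) * (T h.+1 - l).
  elim: N => [|N IH].
    by rewrite big_ord0 /series /T /series/= !big_geq// /sinc2 eqxx; ring.
  rewrite big_ord_recr/= seriesSr.
  have -> : T N.+1 = T N + u N by rewrite /T seriesSr.
  move: IH => /(congr1 (fun x => x + sinc2 d N * u N)).
  have -> : series (fun h => sinc2 d h * u h) N - l + sinc2 d N * u N =
    series (fun h => sinc2 d h * u h) N + sinc2 d N * u N - l by ring.
  by move=> ->; ring.
(* Six shares of the error: the boundary term takes one, the head one, and the tail four, since the
   total variation of the weights is at most 4. *)
have e60 : 0 < e / 6 by lra.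
have [K K0 TK] : exists2 K, 0 < K & forall n, `|T n - l| <= K.
  have : bounded_fun T by apply: cvg_seq_bounded; apply/cvg_ex; exists l.
  move=> [M [_ HM]]; exists (Num.max (M + 1) 1 + `|l|); first by
    rewrite ltr_pwDl ?normr_ge0// lt_max ltr01 orbT.
  move=> n; apply: (le_trans (ler_normB _ _)); rewrite lerD2r.
  rewrite le_max; apply/orP; left.
  by apply: (HM (M + 1)) => //; rewrite ltrDl.
move/cvgrPdist_le : (ul) => /(_ _ e60)[H _ TH].
have [d0 d00 Hd] : exists2 d0 : R, 0 < d0 &
    forall d, 0 < d < d0 -> H%:R * d <= 1 /\ (H%:R * d) ^+ 2 * K <= e / 6.
  pose m := Num.min 1 (e / 6 / K).
  have m0 : 0 < m by rewrite lt_min ltr01 divr_gt0.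
  have H0 : 0 < H%:R + 1 :> R by rewrite ltr_wpDl.
  exists (m / (H%:R + 1)); first by rewrite divr_gt0.
  move=> d /andP[d0]; rewrite ltr_pdivlMr// => dm.
  have Hm : H%:R * d <= m by nra.
  have m1 : m <= 1 by rewrite ge_min lexx.
  split; first by lra.
  have hh : (H%:R * d)^+2 <= m.
    have : 0 <= H%:R * d by rewrite mulr_ge0// ltW.
    nra.
  rewrite -ler_pdivlMr//; apply: (le_trans hh).
  by rewrite /m ge_min lexx orbT.
exists d0 => // d dd0; have [d_gt0 _] := andP dd0; have [Hd1 HdK] := Hd d dd0.
near=> N; rewrite abel.
have HN : (H <= N)%N by near: N; exact: nbhs_infty_ge.
have TN n : (H <= n)%N -> `|T n - l| <= e / 6.
  by move=> Hn; rewrite distrC; exact: TH.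
apply: (le_trans (ler_normD _ _)).
have -> : e = e / 6 + (e / 6 + 4 * (e / 6)) by field.
apply: lerD.
  rewrite normrM (ger0_norm (sinc2_ge0 _ _)).
  rewrite -[leRHS]mul1r; apply: ler_pM => //; [exact: sinc2_ge0|exact: sinc2_le1 (ltW _)|exact: TN].
apply: (le_trans (ler_norm_sum _ _ _)).
rewrite -(big_mkord xpredT (fun i => `|(sinc2 d i - sinc2 d i.+1) * (T i.+1 - l)|)).
(* Before [H] the partial sums are only bounded, but the variation of the weights is at most
   [(H * d) ^+ 2]; from [H] on the partial sums are within [e / 6] of [l]. *)
rewrite (@big_cat_nat _ _ _ H)//=; apply: lerD.
  apply: le_trans HdK; rewrite big_mkord.
  apply: le_trans (_ : (\sum_(i < H) `|sinc2 d i - sinc2 d i.+1|) * K <= _).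
    rewrite mulr_suml; apply: ler_sum => i _; rewrite normrM ler_wpM2l//.
  by rewrite ler_wpM2r ?(ltW K0)// sinc2_var_small.
apply: le_trans (_ : (\sum_(i < N) `|sinc2 d i - sinc2 d i.+1|) * (e / 6) <= _); last first.
  by rewrite ler_wpM2r ?(ltW e60)// sinc2_var.
rewrite mulr_suml -(big_mkord xpredT (fun i => `|sinc2 d i - sinc2 d i.+1| * (e / 6))).
rewrite [leRHS](@big_cat_nat _ _ _ H)//= ler_wpDl//.
  by apply: sumr_ge0 => i _; rewrite mulr_ge0// ltW.
rewrite big_nat_cond [leRHS]big_nat_cond.
apply: ler_sum => i /andP[/andP[Hi _] _]; rewrite normrM ler_wpM2l// TN//.
by rewrite (leq_trans Hi).
Unshelve. all: by end_near.
Qed.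

End sinc.

(** * Schwarz derivatives and exceptional null sets *)

Section schwarz.
Context {R : realType}.
Local Notation leb := (@lebesgue_measure R).

Definition d2 (F : R -> R) (x d : R) := F (x + d) + F (x - d) - 2 * F x.

(* [nu] sums the restrictions of Lebesgue measure to open sets [U k] containing [E]
   of measure at most [2^-(k+1)]: near a point of [E], each [U k] adds [2 * d]. *)
Lemma null_finite_measure (E : set R) : leb.-negligible E ->
  exists nu : {measure set (measurableTypeR R) -> \bar R}, (nu setT < +oo)%E /\
    forall x, E x -> forall K : nat, exists2 r : R, 0 < r &
      forall d : R, 0 < d < r -> ((K%:R * (2 * d))%:E <= nu (ball x d))%E.
Proof.
move=> [N [mN N0 EN]].
have Ny : (leb N < +oo)%E by rewrite N0.
have /choice[U HU] : forall k : nat, exists U : set R,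
    [/\ open U, N `<=` U & (leb U <= (1 / (2 ^ k.+1)%:R)%:E)%E].
  move=> k; have e0 : 0 < 1 / (2 ^ k.+1)%:R :> R by rewrite divr_gt0// ltr0n expn_gt0.
  have [U [oU NU UN]] := lebesgue_regularity_outer mN Ny e0.
  exists U; split => //.
  have mU : measurable U by exact: open_measurable.
  have UE : U = (U `\` N) `|` N by rewrite setUC setDUK.
  apply: (@le_trans _ _ (leb (U `\` N) + leb N)%E).
    by rewrite {1}UE; apply: measureU2 => //; exact: measurableD.
  by rewrite N0 adde0 ltW.
have mU k : measurable (U k) by have [oU _ _] := HU k; exact: open_measurable.
pose nu : {measure set (measurableTypeR R) -> \bar R} := mseries (fun k => mrestr leb (mU k)) 0.
exists nu; split.
  apply: (@le_lt_trans _ _ 1%E); last by rewrite ltry.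
  apply: le_trans (epsilon_trick0 xpredT ler01).
  apply: lee_nneseries => // k _; rewrite /= /mrestr setTI.
  by have [_ _] := HU k.
move=> x Ex K.
have xU k : U k x by have [_ NU _] := HU k; exact/NU/EN.
(* Only the first [K] open sets are used, so a common radius exists. *)
have [r r0 hr] : exists2 r : R, 0 < r & forall k, (k < K)%N -> ball x r `<=` U k.
  elim: K => [|K [r r0 hr]]; first by exists 1.
  have [oU _ _] := HU K.
  have := open_nbhs_nbhs (conj oU (xU K)) => /nbhs_ballP[s /= s0 hs].
  exists (Num.min r s); first by rewrite lt_min r0.
  move=> k; rewrite ltnS leq_eqVlt => /predU1P[->|kK].
    by apply: subset_trans hs; apply: le_ball; rewrite ge_min lexx orbT.
  by apply: subset_trans (hr _ kK); apply: le_ball; rewrite ge_min lexx.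
exists r => // d /andP[d0 dr].
have sub k : (k < K)%N -> mrestr leb (mU k) (ball x d) = (2 * d)%:E.
  move=> kK; rewrite /mrestr setIidl.
    by rewrite lebesgue_measure_ball ?ltW// mulr2n mulrDl mul1r.
  by apply: subset_trans (hr k kK); apply: le_ball; exact: ltW.
rewrite /nu/= /mseries/=.
apply: le_trans (nneseries_lim_ge K _) => //.
rewrite (eq_big_nat _ _ (F2 := fun=> (2 * d)%:E)); last by move=> i /andP[_ iK]; exact: sub.
by rewrite sumEFin/= sumr_const_nat subn0 mulr_natl.
Qed.

Lemma abs_d2_ge0 (x y d : R) : 0 <= `|x + d - y| + `|x - d - y| - 2 * `|x - y|.
Proof. by case: (ger0P (x - y)); case: (ger0P (x + d - y)); case: (ger0P (x - d - y)) => ? ? ?; lra. Qed.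

(** For [y] within [d] of [x] the difference is the tent [2 * (d - |x - y|)]; on the inner half it
    is at least [d]. *)
Lemma abs_d2_ge (x y d : R) : - (d / 2) < x - y < d / 2 ->
  d <= `|x + d - y| + `|x - d - y| - 2 * `|x - y|.
Proof. move=> /andP[h1 h2]; case: (ger0P (x - y)); case: (ger0P (x + d - y)); case: (ger0P (x - d -
  y)) => ? ? ?; lra. Qed.

(* [H x] is the integral of [`|x - y|] against the measure above; subtracting [`|y|]
   makes the integrand bounded. *)
Lemma null_convex_function (E : set R) : leb.-negligible E ->
  exists H : R -> R, [/\ continuous H, (forall x d : R, 0 < d -> 0 <= d2 H x d) &
    forall x, E x -> forall K : R, exists2 r : R, 0 < r &
      forall d : R, 0 < d < r -> K * d ^+ 2 <= d2 H x d].
Proof.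
move=> /null_finite_measure[nu [nuy HE]].
pose h (x y : R) : R := `|x - y| - `|y|.
have hb x y : `|h x y| <= `|x|.
  by rewrite /h; case: (ger0P (x - y)); case: (ger0P x); case: (ger0P y) => ? ? ?; rewrite
    ler_norml; apply/andP; split; lra.
have hi x : nu.-integrable setT (EFin \o h x).
  apply: measurable_bounded_integrable => //.
    rewrite /h; apply: measurable_funB => //; apply: measurableT_comp => //.
    exact: measurable_funB.
  exists `|x|; split => // t xt y _; exact: le_trans (hb x y) (ltW xt).
have nu0 : (0 <= nu setT)%E by [].
have nuf : nu setT \is a fin_num by rewrite ge0_fin_numE.
have hc c : nu.-integrable setT (EFin \o (fun=> c)).
  by apply: measurable_bounded_integrable => //; exists `|c|; split => // t t1 y _; exact: ltW.
pose V := fine (nu setT).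
pose H x := \int[nu]_y h x y.
have Hlip x x' : `|H x - H x'| <= `|x - x'| * V.
  rewrite /H -RintegralB//; apply: (le_trans (le_normr_Rintegral _ _)) => //.
    exact: integrableRB.
  rewrite -(@Rintegral_cst _ _ _ nu)//; apply: le_Rintegral => //.
  - apply: (@integrable_norm _ _ _ nu _ (fun y => h x y - h x' y)) => //; exact: integrableRB.
  move=> y _; rewrite /h.
  have -> : `|x - y| - `|y| - (`|x' - y| - `|y|) = `|x - y| - `|x' - y| by ring.
  by apply: (le_trans (ler_dist_dist _ _)); rewrite opprB addrA subrK.
have d2H x d : d2 H x d = \int[nu]_y (`|x + d - y| + `|x - d - y| - 2 * `|x - y|).
  rewrite /d2 /H -RintegralZl// -RintegralD// -RintegralB//.
  - by apply: eq_Rintegral => y _; rewrite /h; ring.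
  - exact: integrableRD.
  - exact: integrableRZ.
have d2i x d : nu.-integrable setT (EFin \o (fun y => `|x + d - y| + `|x - d - y| - 2 * `|x - y|)).
  rewrite (_ : _ \o _ = EFin \o (fun y => h (x + d) y + h (x - d) y - 2 * h x y)); last first.
    by apply/funext => y /=; rewrite /h; congr EFin; ring.
  apply: integrableRB => //; [exact: integrableRD|exact: integrableRZ].
exists H; split.
- move=> x; apply/cvgrPdist_le => e e0.
  have V1 : 0 < V + 1 by rewrite ltr_wpDl// fine_ge0.
  near=> y; apply: (le_trans (Hlip _ _)).
  apply: (@le_trans _ _ (`|x - y| * (V + 1))); first by rewrite ler_wpM2l// lerDl.
  rewrite -ler_pdivlMr//; near: y.
  by apply: cvgr_dist_le => //; rewrite divr_gt0.
- by move=> x d d0; rewrite d2H; apply: Rintegral_ge0 => y _; exact: abs_d2_ge0.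
move=> x Ex K.
have [K' hK'] : exists K' : nat, K <= K'%:R.
  exists (Num.bound `|K|); apply: le_trans (ler_norm _) _; exact/ltW/archi_boundP.
have [r r0 hr] := HE x Ex K'.
exists r => // d /andP[d0 dr].
have mb : measurable (ball x (d / 2)) by exact: measurable_ball.
have hI : nu.-integrable setT (EFin \o \1_(ball x (d / 2))).
  apply: measurable_bounded_integrable => //; exists 1; split => // t t1 y _.
  by apply: le_trans (ltW t1); rewrite /= indicE; case: (_ \in _); rewrite ?normr1// normr0.
have dd : 0 < d / 2 < r by apply/andP; split; lra.
have := hr _ dd => hnu.
apply: (@le_trans _ _ (K'%:R * d * d)); first by rewrite -mulrA ler_wpM2r// mulr_ge0// ltW.
rewrite d2H.
(* Keep only the ball of radius [d / 2]: there the integrand is at least [d], and its measure is at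
   least [K' * (2 * (d / 2))]. *)
apply: (@le_trans _ _ (\int[nu]_y (d * \1_((ball x (d / 2))) y))).
  rewrite RintegralZl//.
  rewrite mulrC ler_wpM2l ?(ltW d0)//.
  rewrite /Rintegral integral_indic// setIT -lee_fin fineK.
    by apply: le_trans hnu; rewrite lee_fin [2 * _]mulrC divfK.
  by rewrite ge0_fin_numE//; apply: le_lt_trans nuy; apply: le_measure => //; rewrite inE.
apply: le_Rintegral => //.
  exact: integrableRZ.
move=> y _; rewrite indicE; case: (boolP (y \in _)) => [|_]; last by rewrite mulr0 abs_d2_ge0.
by rewrite mulr1 inE/= /ball/= ltr_norml => hy; exact: abs_d2_ge.
Unshelve. all: by end_near.
Qed.

(* Schwarz's maximum principle. The perturbation by [e * H] makes the second
   difference negative at the exceptional points as well, so a function exceeding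
   its chord cannot have an interior minimum. *)
Lemma schwarz_derivative_le (F phi : R -> R) (M : R) : continuous F ->
  (forall x e, 0 < e -> exists2 r : R, 0 < r &
     forall d, 0 < d < r -> `|d2 F x d - d ^+ 2 * phi x| <= e * d ^+ 2) ->
  leb.-negligible [set x | M < phi x] ->
  forall x d, 0 < d -> d2 F x d <= M * d ^+ 2.
Proof.
move=> cF Fphi /null_convex_function[H [cH H0 HK]] x0 d0 d0_gt0.
rewrite leNgt; apply/negP => hlt.
pose q := (d2 F x0 d0 - M * d0 ^+ 2).
have q0 : 0 < q by rewrite subr_gt0.
(* [k] and [e] are such that each of the corrections [k * d0 ^+ 2] and [e * d2 H x0 d0] takes at
   most a quarter of the excess [q]. *)
pose k := q / (4 * d0 ^+ 2).
have k0 : 0 < k by rewrite divr_gt0// mulr_gt0// exprn_gt0.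
pose e := q / (4 * (d2 H x0 d0 + 1)).
have D0 : 0 < d2 H x0 d0 + 1 by rewrite ltr_wpDl// H0.
have e0 : 0 < e by rewrite divr_gt0// mulr_gt0.
pose G x := F x - (M + k) / 2 * x ^+ 2 - e * H x.
have d2G x d : d2 G x d = d2 F x d - (M + k) * d ^+ 2 - e * d2 H x d.
  by rewrite /d2 /G; field.
have G0 : 0 < d2 G x0 d0.
  rewrite d2G.
  have -> : (M + k) * d0 ^+ 2 = M * d0 ^+2 + q / 4.
    by rewrite mulrDl /k; congr (_ + _); field; rewrite gt_eqF.
  have : e * d2 H x0 d0 <= q / 4.
    rewrite /e invfM mulrA mulrAC; rewrite ler_pdivrMr//.
    by rewrite ler_wpM2l ?lerDl// divr_ge0// ltW.
  by move: hlt q0; rewrite /q; lra.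
(* The slope of the chord of [G]: [g] vanishes at [x0] and takes the same positive value at both
   ends, so its minimum over the interval is attained inside. *)
pose s := (G (x0 + d0) - G (x0 - d0)) / (2 * d0).
pose g x := G x - G x0 - s * (x - x0).
have d2g x d : d2 g x d = d2 G x d by rewrite /d2 /g; ring.
have cg : continuous g.
  move=> x; rewrite /g /G.
  apply: cvgB; last by apply: cvgM; [exact: cvg_cst|apply: cvgB; [exact: cvg_id|exact: cvg_cst]].
  apply: cvgB; last exact: cvg_cst.
  apply: cvgB; last by apply: cvgM; [exact: cvg_cst|exact: cH].
  apply: cvgB; first exact: cF.
  by apply: cvgM; [exact: cvg_cst|exact: exprn_continuous].
have gx0 : g x0 = 0 by rewrite /g; ring.
have gp : g (x0 + d0) = d2 G x0 d0 / 2 by rewrite /g /d2 /s; field; rewrite gt_eqF.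
have gm : g (x0 - d0) = d2 G x0 d0 / 2 by rewrite /g /d2 /s; field; rewrite gt_eqF.
have lt1 : x0 - d0 <= x0 + d0 by lra.
have [c cI cmin] := EVT_min lt1 (continuous_subspaceT cg).
have gc0 : g c <= 0 by rewrite -gx0; apply: cmin; rewrite in_itv/=; apply/andP; split; lra.
have [c1 c2] : x0 - d0 < c /\ c < x0 + d0.
  move: cI; rewrite in_itv/= => /andP[h1 h2]; split; rewrite lt_neqAle ?h1 ?h2 andbT; apply/eqP => h.
    by move: gc0; rewrite -h gm; lra.
  by move: gc0; rewrite h gp; lra.
pose r0 := Num.min (c - (x0 - d0)) (x0 + d0 - c).
have r00 : 0 < r0 by rewrite lt_min !subr_gt0 c1 c2.
have gge d : 0 < d < r0 -> 0 <= d2 F c d - (M + k) * d ^+ 2 - e * d2 H c d.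
  move=> /andP[dp]; rewrite lt_min => /andP[h1 h2].
  rewrite -d2G -d2g /d2.
  have := cmin (c + d); rewrite in_itv/= => /(_ ltac:(apply/andP; split; lra)).
  have := cmin (c - d); rewrite in_itv/= => /(_ ltac:(apply/andP; split; lra)).
  lra.
have k20 : 0 < k / 2 by lra.
have [r1 r10 hr1] := Fphi c (k / 2) k20.
(* At the minimum [c] small second differences of [g] are nonnegative. If [phi c <= M], the term in
   [k] makes them negative; otherwise [c] is exceptional, and [HK] with constant [(phi c - M) / e]
   lets [e * d2 H c d] absorb the excess of [phi c] over [M]. *)
have [hM|hM] := leP (phi c) M.
  pose d := Num.min r0 r1 / 2.
  have dp : 0 < Num.min r0 r1 by rewrite lt_min r00.
  have dr : 0 < d by rewrite /d; lra.
  have drr : d < Num.min r0 r1 by rewrite /d; lra.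
  move: drr; rewrite lt_min => /andP[dr0 dr1].
  have := gge d; rewrite dr dr0 => /(_ isT).
  have := hr1 d; rewrite dr dr1 => /(_ isT); rewrite ler_norml => /andP[_].
  have := H0 c d dr.
  have d2p : 0 < d ^+ 2 by rewrite exprn_gt0.
  have : phi c * d ^+ 2 <= M * d ^+ 2 by rewrite ler_wpM2r// ltW.
  set u := d ^+ 2; move=> h1 h2 h3 h4.
  have : 0 <= e * d2 H c d by rewrite mulr_ge0// ltW.
  have := mulr_gt0 k0 d2p; rewrite -/u; lra.
have [r2 r20 hr2] := HK c hM ((phi c - M) / e).
pose d := Num.min r0 (Num.min r1 r2) / 2.
have dp : 0 < Num.min r0 (Num.min r1 r2) by rewrite lt_min r00 lt_min r10.
have dr : 0 < d by rewrite /d; lra.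
have drr : d < Num.min r0 (Num.min r1 r2) by rewrite /d; lra.
move: drr; rewrite lt_min => /andP[dr0]; rewrite lt_min => /andP[dr1 dr2].
have := gge d; rewrite dr dr0 => /(_ isT).
have := hr1 d; rewrite dr dr1 => /(_ isT); rewrite ler_norml => /andP[_].
have := hr2 d; rewrite dr dr2 => /(_ isT).
rewrite mulrAC ler_pdivrMr//.
have d2p : 0 < d ^+ 2 by rewrite exprn_gt0.
have := mulr_gt0 k0 d2p; set u := d ^+ 2; lra.
Qed.

End schwarz.

(** * Series dominated by inverse squares *)

Section unif.
Context {R : realType}.

Lemma sum_inv_sqr (m n : nat) : (0 < m)%N ->
  \sum_(m <= h < n) (h%:R ^- 2 : R) <= 2 / m%:R.
Proof.
move=> m0; have [nm|mn] := leqP n m; first by rewrite big_geq// divr_ge0.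
(* The bound that passes through the induction: each increment [2 / h - 2 / (h + 1)] is at least
   [h ^- 2]. *)
apply: (@le_trans _ _ (2 / m%:R - 2 / n%:R)); last by rewrite gerBl divr_ge0.
rewrite -(subnKC (ltnW mn)); elim: (n - m)%N => [|k IH].
  by rewrite addn0 big_geq// subrr.
rewrite addnS big_nat_recr ?leq_addr//=.
apply: (le_trans (lerD IH (lexx _))).
have : (0 < (m + k)%:R :> R) by rewrite ltr0n addn_gt0 m0.
have : (1 <= (m + k)%:R :> R) by rewrite ler1n addn_gt0 m0.
rewrite -[(m + k).+1%:R]natr1; move: (m + k)%:R => x x1 x0.
rewrite -addrA lerD2l -subr_ge0.
have -> : - (2 / (x + 1)) - (- (2 / x) + x ^- 2) = (x - 1) / (x ^+ 2 * (x + 1)).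
  by field; rewrite !gt_eqF//; lra.
by rewrite divr_ge0 ?subr_ge0// mulr_ge0 ?sqr_ge0//; lra.
Qed.

Lemma div_nat_lt (x e : R) : 0 <= x -> 0 < e -> exists K : nat, x / K.+1%:R < e.
Proof.
move=> x0 e0; exists (Num.bound (x / e)).
rewrite ltr_pdivrMr// mulrC -ltr_pdivrMr//.
apply: lt_trans (archi_boundP _) _; first by rewrite divr_ge0// ltW.
by rewrite ltr_nat.
Qed.

(** The rate depends on [w] through [C] alone; this uniformity gives the continuity of [riemann_fun]
    and the truncation error in [riemann_sum_le]. *)
Lemma inv_sqr_series_cvg (w : nat -> R) (C : R) : 0 <= C ->
  (forall h, (0 < h)%N -> `|w h| <= C * h%:R ^- 2) ->
  cvgn (series w) /\
  forall n, (0 < n)%N -> `|series w n - limn (series w)| <= C * (2 / n%:R).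
Proof.
move=> C0 hw.
have tail m n : (0 < m)%N -> (m <= n)%N -> `|series w n - series w m| <= C * (2 / m%:R).
  move=> m0 mn; rewrite sub_series_geq//; apply: (le_trans (ler_norm_sum _ _ _)).
  apply: (@le_trans _ _ (\sum_(m <= h < n) C * h%:R ^- 2)).
    rewrite big_nat_cond [leRHS]big_nat_cond; apply: ler_sum => i /andP[/andP[mi _] _].
    by apply: hw; exact: leq_trans mi.
  by rewrite -mulr_sumr ler_wpM2l// sum_inv_sqr.
have cv : cvgn (series w).
  apply/cauchy_cvgP/cauchy_seriesP => e e0.
  have ce : 0 < e / (C + 1) / 2 by rewrite !divr_gt0// ltr_wpDl.
  have [K hK] : exists K : nat, (2 / K.+1%:R) * (C + 1) < e.
    have [K hK] := @div_nat_lt (2 * (C + 1)) e ltac:(lra) e0.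
    by exists K; rewrite mulrAC.
  exists ([set m | (K < m)%N], [set m | (K < m)%N]).
    by split; exact: nbhs_infty_gt.
  move=> [m n] /= [Km Kn].
  have m0 : (0 < m)%N by exact: leq_trans Km.
  have [mn|nm] := leqP m n; last by rewrite big_geq ?normr0// ltnW.
  rewrite -sub_series_geq//; apply: le_lt_trans (tail _ _ m0 mn) _.
  apply: le_lt_trans hK; rewrite mulrC; apply: ler_pM => //.
    by rewrite ler_wpM2l// lef_pV2 ?posrE ?ltr0n// ler_nat.
  by rewrite lerDl.
split => // n n0.
have hl : (series w n - series w m) @[m --> \oo] --> series w n - limn (series w).
  by apply: cvgB => //; exact: cvg_cst.
apply: (@cvgn_le_near _ (fun m => `|series w n - series w m|)).
  by apply: cvg_norm.
by near=> m; rewrite distrC tail//; near: m; exact: nbhs_infty_ge.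
Unshelve. all: by end_near.
Qed.

End unif.

(** * Riemann's twice integrated trigonometric series *)

Section riemann_function.
Context {R : realType}.
Local Notation leb := (@lebesgue_measure R).
Variables (u : nat -> R) (C : R) (C0 : 0 <= C) (uC : forall h, `|u h| <= C).

Let v (x : R) h := u h * cos (h%:R * x) / h%:R ^+ 2.
Let w d x h := sinc2 d h * (u h * cos (h%:R * x)).

Let cos_bound h x : `|u h * cos (h%:R * x)| <= C.
Proof. by rewrite normrM -[leRHS]mulr1 ler_pM// cos_max. Qed.

Let v_bound x h : (0 < h)%N -> `|v x h| <= C * h%:R ^- 2.
Proof.
move=> h0; rewrite /v normrM ler_pM//.
by rewrite ger0_norm// invr_ge0 sqr_ge0.
Qed.

Let w_bound d x : 0 < d -> forall h, (0 < h)%N -> `|w d x h| <= (C / d ^+ 2) * h%:R ^- 2.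
Proof.
move=> d0 h h0; rewrite /w normrM mulrC -mulrA; apply: ler_pM => //.
rewrite ger0_norm ?sinc2_ge0//; apply: le_trans (sinc2_le d0 h0) _.
by rewrite exprMn invfM mulrC.
Qed.

(* The twice integrated series; [v x 0 = 0] because division by 0 gives 0. *)
Definition riemann_fun x := u 0 * (x ^+ 2 / 2) - limn (series (v x)).

Lemma riemann_fun_continuous : continuous riemann_fun.
Proof.
move=> x; apply: cvgB.
  apply: cvgM; first exact: cvg_cst.
  by apply: cvgM; [exact: exprn_continuous|exact: cvg_cst].
apply/cvgrPdist_le => e e0.
have [K hK] : exists K : nat, C * (2 / K.+1%:R) <= e / 3.
  have [K hK] := @div_nat_lt R (C * 2) (e / 3) (mulr_ge0 C0 (ler0n _ _)) (divr_gt0 e0 (ltr0Sn _ _)).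
  by exists K; rewrite mulrA ltW.
have vc : (fun y => series (v y) K.+1) @ x --> series (v x) K.+1.
  elim: K.+1 => [|h IH].
    by rewrite /series/=; under eq_cvg do rewrite big_geq//; rewrite big_geq//; exact: cvg_cst.
  rewrite seriesSr; under eq_cvg do rewrite seriesSr.
  apply: cvgD => //; apply: cvgM; last exact: cvg_cst.
  apply: cvgM; first exact: cvg_cst.
  apply: continuous_comp; last exact: continuous_cos.
  by apply: cvgM; [exact: cvg_cst|exact: cvg_id].
have e3 : 0 < e / 3 by lra.
near=> y.
have h1 : `|series (v x) K.+1 - series (v y) K.+1| <= e / 3.
  by near: y; move/cvgrPdist_le : vc => /(_ _ e3).
have [_ /(_ K.+1 isT) hx] := inv_sqr_series_cvg C0 (v_bound x).
have [_ /(_ K.+1 isT) hy] := inv_sqr_series_cvg C0 (v_bound y).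
have {}hx := le_trans hx hK; have {}hy := le_trans hy hK.
move: h1 hx hy; rewrite !ler_norml => /andP[? ?] /andP[? ?] /andP[? ?].
by apply/andP; split; lra.
Unshelve. all: by end_near.
Qed.

(** Termwise, [cos (n * (x + 2 * d)) + cos (n * (x - 2 * d)) - 2 * cos (n * x)] equals
    [- 4 * sin (n * d) ^+ 2 * cos (n * x)]; the term of index 0 is the second difference of
    [u 0 * (x ^+ 2 / 2)]. *)
Lemma d2_riemann_fun x d : 0 < d ->
  d2 riemann_fun x (2 * d) = (2 * d) ^+ 2 * limn (series (w d x)).
Proof.
move=> d0.
have C1 : 0 <= C / d ^+ 2 by rewrite divr_ge0// exprn_ge0// ltW.
have [cw _] := inv_sqr_series_cvg C1 (w_bound x d0).
have cv y : cvgn (series (v y)) by have [] := inv_sqr_series_cvg C0 (v_bound y).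
have key N : (2 * d) ^+ 2 * series (w d x) N.+1 = u 0 * (2 * d) ^+ 2
   - (series (v (x + 2 * d)) N.+1 + series (v (x - 2 * d)) N.+1 - 2 * series (v x) N.+1).
  elim: N => [|N IH].
    rewrite !seriesSr /series/= !big_geq// /w /v /sinc2 eqxx mul0r cos0 expr0n/= invr0.
    by ring.
  rewrite [series (w d x) _]seriesSr [series (v (x + _)) _]seriesSr
    [series (v (x - _)) _]seriesSr [series (v x) _]seriesSr mulrDr IH.
  suff -> : (2 * d) ^+ 2 * w d x N.+1 =
    - (v (x + 2 * d) N.+1 + v (x - 2 * d) N.+1 - 2 * v x N.+1) by ring.
  rewrite /w /v /sinc2/=; set n := N.+1%:R.
  have n0 : 0 < n :> R by rewrite /n ltr0n.
  have -> : n * (x + 2 * d) = n * x + (n * d + n * d) by ring.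
  have -> : n * (x - 2 * d) = n * x - (n * d + n * d) by ring.
  rewrite cosD cosB (cosD (n * d)) -!expr2 cos2sin2.
  by field; rewrite !gt_eqF.
have lim1 : ((2 * d) ^+ 2 * series (w d x) N.+1) @[N --> \oo] -->
    (2 * d) ^+ 2 * limn (series (w d x)).
  by apply: cvgM; [exact: cvg_cst|rewrite (cvg_shiftS (series (w d x)))].
have lim2 : ((2 * d) ^+ 2 * series (w d x) N.+1) @[N --> \oo] -->
   u 0 * (2 * d) ^+ 2 - (limn (series (v (x + 2 * d))) +
     limn (series (v (x - 2 * d))) - 2 * limn (series (v x))).
  under eq_cvg do rewrite key.
  apply: cvgB; first exact: cvg_cst.
  apply: cvgB; first apply: cvgD.
  - by rewrite (cvg_shiftS (series (v (x + 2 * d)))); exact: cv.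
  - by rewrite (cvg_shiftS (series (v (x - 2 * d)))); exact: cv.
  by apply: cvgM; [exact: cvg_cst|rewrite (cvg_shiftS (series (v x))); exact: cv].
rewrite (cvg_unique _ lim1 lim2)// /d2 /riemann_fun.
by field.
Qed.

Variables (phi : R -> R) (M : R).
Hypothesis uphi : forall x, series (fun h => u h * cos (h%:R * x)) @ \oo --> phi x.
Hypothesis phiM : leb.-negligible [set x | M < phi x].

(** By [riemann_summation] the second difference quotients of [riemann_fun] tend to [phi x] at every
    [x]. The maximum principle then bounds them by [M] for every step, not only in the limit, and
    truncating the series at [n] costs its tail. *)
Lemma riemann_sum_le d x n : 0 < d -> (0 < n)%N ->
  series (w d x) n <= M + (C / d ^+ 2) * (2 / n%:R).
Proof.
move=> d0 n0.
have C1 : 0 <= C / d ^+ 2 by rewrite divr_ge0// exprn_ge0// ltW.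
have [_ /(_ _ n0)] := inv_sqr_series_cvg C1 (w_bound x d0).
rewrite ler_norml => /andP[_] h.
suff : limn (series (w d x)) <= M by move: h; set q := (_ / d ^+ 2 * _); lra.
have d20 : 0 < 2 * d by lra.
have := @schwarz_derivative_le R riemann_fun phi M riemann_fun_continuous _ phiM x (2 * d) d20.
rewrite d2_riemann_fun// mulrC ler_pM2r ?exprn_gt0//; apply => {x d n d0 n0 C1 h d20}.
move=> x e e0.
have [r r0 hr] := riemann_summation (@uphi x) e0.
exists (2 * r); first by lra.
move=> d /andP[d0 dr]; have -> : d = 2 * (d / 2) by field.
have d20 : 0 < d / 2 by lra.
rewrite d2_riemann_fun// -mulrBr normrM ger0_norm ?sqr_ge0// mulrC ler_wpM2r ?sqr_ge0//.
have C1 : 0 <= C / (d / 2) ^+ 2 by rewrite divr_ge0// sqr_ge0.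
have [cw _] := inv_sqr_series_cvg C1 (w_bound x d20).
apply: (@cvgn_le_near _ (fun m => `|series (w (d / 2) x) m - phi x|)).
  by apply: cvg_norm; apply: cvgB => //; exact: cvg_cst.
by apply: hr; rewrite d20/=; lra.
Qed.

End riemann_function.

(** * Averages over roots of unity *)

Section grid.
Context {R : realType}.

(** [s - t + (t - s)] is the distance between [s] and [t]: one of the truncated subtractions is
    0. *)
Lemma distn_ltn (s t n : nat) : (s < n)%N -> (t < n)%N -> (s - t + (t - s) < n)%N.
Proof. lia. Qed.

(** Multiplication by [2 * sin a], where [a = k * pi / N], makes the sum telescope over a whole
    number of periods; [0 < k < N] ensures [sin a != 0]. *)
Lemma sum_cos_grid (k N : nat) : (0 < k < N)%N ->
  \sum_(j < N) cos (k%:R * (2 * pi * j%:R / N%:R)) = 0 :> R.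
Proof.
move=> /andP[k0 kN]; have N0 : (0 < N)%N by exact: ltn_trans kN.
have NR : 0 < N%:R :> R by rewrite ltr0n.
pose a : R := k%:R * pi / N%:R.
have a0 : 0 < a by rewrite divr_gt0// mulr_gt0 ?pi_gt0// ltr0n.
have api : a < pi by rewrite ltr_pdivrMr// mulrC ltr_pM2l ?pi_gt0// ltr_nat.
have sa : sin a != 0 by rewrite gt_eqF// sin_gt0_pi// a0.
have step (j : nat) : 2 * sin a * cos (k%:R * (2 * pi * j%:R / N%:R)) =
   sin ((2 * j.+1%:R - 1) * a) - sin ((2 * j%:R - 1) * a).
  have -> : k%:R * (2 * pi * j%:R / N%:R) = 2 * j%:R * a by rewrite /a; field; rewrite gt_eqF.
  have -> : (2 * j.+1%:R - 1) * a = 2 * j%:R * a + a by rewrite -[j.+1%:R]natr1; ring.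
  have -> : (2 * j%:R - 1) * a = 2 * j%:R * a - a by ring.
  by rewrite sinD sinB; ring.
apply: (mulfI (_ : 2 * sin a != 0)); first by rewrite mulf_neq0// pnatr_eq0.
rewrite mulr0 mulr_sumr; under eq_bigr do rewrite step.
rewrite -(big_mkord xpredT (fun j => sin ((2 * j.+1%:R - 1) * a) - sin ((2 * j%:R - 1) * a))).
rewrite telescope_sumr//.
have -> : (2 * N%:R - 1) * a = - a + pi *+ 2 *+ k.
  rewrite -mulrnA -[pi *+ _]mulr_natr natrM /a; field; by rewrite gt_eqF.
have -> : (2 * 0%:R - 1) * a = - a by ring.
suff -> : forall b : R, sin (b + pi *+ 2 *+ k) = sin b by rewrite subrr.
move=> b; elim: k {k0 kN a a0 api sa step} => [|k IH]; first by rewrite mulr0n addr0.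
by rewrite mulrSr addrA sinD2pi.
Qed.

Let dist (s t : nat) : nat := (s - t + (t - s))%N.

(* Averages the trigonometric sum against the squared modulus of the polynomial
   with coefficients [c] over the [2 * N]-th roots of unity. *)
Lemma trig_sum_le_toeplitz (N n : nat) (a : nat -> R) (B : R) (c : 'I_n -> R) :
  (n <= N)%N ->
  (forall x, series (fun h => (if h == 0%N then a 0%N else 2 * a h) * cos (h%:R * x)) N <= B) ->
  \sum_(s < n) \sum_(t < n) c s * c t * a (dist s t) <= B * \sum_(t < n) c t ^+ 2.
Proof.
move=> nN TB; have [n0|n0] := posnP n.
  move: c; rewrite n0 => c; rewrite !big_ord0 mulr0//.
have N0 : (0 < N)%N by exact: leq_trans nN.
(* With [2 * N] nodes every frequency [h + m] with [h, m < N] stays below the number of nodes, so no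
   aliasing occurs. *)
pose K := (2 * N)%N.
have K0 : 0 < K%:R :> R by rewrite ltr0n muln_gt0.
pose x (j : nat) : R := 2 * pi * j%:R / K%:R.
pose al h := if h == 0%N then a 0%N else 2 * a h.
pose T (y : R) := series (fun h => al h * cos (h%:R * y)) N.
(* The squared modulus of the polynomial; its nonnegativity lets the bound [T <= B] be averaged
   against it. *)
pose Q (y : R) := (\sum_(t < n) c t * cos (t%:R * y)) ^+ 2 + (\sum_(t < n) c t * sin (t%:R * y)) ^+ 2.
have QE y : Q y = \sum_(s < n) \sum_(t < n) c s * c t * cos ((dist s t)%:R * y).
  rewrite /Q !expr2 !mulr_suml -big_split/=; apply: eq_bigr => s _.
  rewrite !mulr_sumr -big_split/=; apply: eq_bigr => t _.
  have -> : cos ((dist s t)%:R * y) = cos (s%:R * y - t%:R * y).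
    rewrite -mulrBl /dist; have [st|ts] := leqP s t.
      by rewrite (eqP st) add0n natrB// -[in RHS]cosN -mulNr opprB.
    by move/ltnW : (ts) => /eqP ->; rewrite addn0 natrB// ltnW.
  by rewrite cosB; ring.
have Q0 y : 0 <= Q y by rewrite addr_ge0// sqr_ge0.
have avg (k : nat) : (k < K)%N -> \sum_(j < K) cos (k%:R * x j) = if k == 0%N then K%:R else 0.
  move=> kK; case: ifP => [/eqP ->|/negbT k0].
    under eq_bigr do rewrite mul0r cos0.
    by rewrite sumr_const card_ord.
  by apply: sum_cos_grid; rewrite lt0n k0.
have avg2 (h m : nat) : (h < N)%N -> (m < N)%N ->
    \sum_(j < K) al h * cos (h%:R * x j) * cos (m%:R * x j) = if h == m then K%:R * a h else 0.
  move=> hN mN.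
  have E (y : R) : al h * cos (h%:R * y) * cos (m%:R * y) =
     al h / 2 * cos ((h + m)%:R * y) + al h / 2 * cos ((dist h m)%:R * y).
    have -> : cos ((dist h m)%:R * y) = cos (h%:R * y - m%:R * y).
      rewrite -mulrBl /dist; have [st|ts] := leqP h m.
        by rewrite (eqP st) add0n natrB// -[in RHS]cosN -mulNr opprB.
      by move/ltnW : (ts) => /eqP ->; rewrite addn0 natrB// ltnW.
    by rewrite natrD mulrDl cosB cosD; field.
  under eq_bigr do rewrite E.
  rewrite big_split/= -!mulr_sumr !avg; last 2 first.
  - by rewrite /K /dist; lia.
  - by rewrite /K; lia.
  have -> : (dist h m == 0%N) = (h == m) by rewrite /dist; apply/eqP/eqP; lia.
  rewrite addn_eq0 /al; have [->|hm] := eqVneq h m.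
    by rewrite andbb; case: ifP => [/eqP -> |_]; field.
  have -> : (h == 0%N) && (m == 0%N) = false.
    by apply/negP => /andP[/eqP h0 /eqP m0]; rewrite h0 m0 eqxx in hm.
  by rewrite !mulr0 addr0.
have I1 : \sum_(j < K) T (x j) * Q (x j) <= \sum_(j < K) B * Q (x j).
  by apply: ler_sum => j _; apply: ler_wpM2r => //; exact: TB.
have I2 : \sum_(j < K) Q (x j) = K%:R * \sum_(t < n) c t ^+ 2.
  under eq_bigr do rewrite QE.
  rewrite exchange_big/= mulr_sumr; apply: eq_bigr => s _.
  rewrite exchange_big/= (bigD1 s)//= [X in _ + X]big1 => [|t ts].
    rewrite addr0 -mulr_sumr avg; last by rewrite /dist subnn /K muln_gt0.
    by rewrite /dist !subnn/= expr2 mulrC.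
  rewrite -mulr_sumr avg; last by apply: (leq_trans (distn_ltn (ltn_ord s) (ltn_ord t))); rewrite
    /K mul2n -addnn (leq_trans nN)// leq_addr.
  rewrite ifF ?mulr0//; apply/eqP => h; move/eqP: ts; apply; apply: val_inj => /=.
  by move: h; rewrite /dist; lia.
have I3 : \sum_(j < K) T (x j) * Q (x j) =
   K%:R * \sum_(s < n) \sum_(t < n) c s * c t * a (dist s t).
  under eq_bigr do rewrite QE mulr_sumr.
  rewrite exchange_big/= mulr_sumr; apply: eq_bigr => s _.
  under eq_bigr do rewrite mulr_sumr.
  rewrite exchange_big/= mulr_sumr; apply: eq_bigr => t _.
  rewrite (eq_bigr (fun j : 'I_K => \sum_(h < N) c s * c t * (al h * cos (h%:R * x j) * cos ((dist
    s t)%:R * x j)))); last first.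
    move=> j _; rewrite /T /series/= big_mkord mulr_suml; apply: eq_bigr => h _; ring.
  have dN : (dist s t < N)%N by apply: leq_trans nN; exact: distn_ltn.
  rewrite exchange_big/= (bigD1 (Ordinal dN))//= [X in _ + X]big1 => [|h hd].
    by rewrite -mulr_sumr avg2// eqxx addr0; ring.
  rewrite -mulr_sumr avg2// ifF ?mulr0//; apply/eqP => h0; move/eqP: hd; apply.
  exact: val_inj.
move: I1; rewrite I3 -mulr_sumr I2 mulrCA ler_pM2l//.
Qed.

End grid.

(** * Toeplitz forms under an almost everywhere bound *)

Section trig.
Context {R : realType}.
Local Notation leb := (@lebesgue_measure R).

(** At fixed [d] the weighted coefficients obey a bound valid at every [x], so the inequality on the
    roots of unity applies, and the truncation error vanishes as [N] grows. The number of entries is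
    fixed, so a small [d] restores the original coefficients up to [e]. *)
Lemma toeplitz_le_ae (g : nat -> R) (phi : R -> R) (M : R) :
  (forall x, series (fun h => (if h == 0%N then g 0%N else 2 * g h) * cos (h%:R * x)) @ \oo --> phi x) ->
  leb.-negligible [set x | M < phi x] ->
  forall n (c : 'I_n -> R),
  \sum_(s < n) \sum_(t < n) c s * c t * g (s - t + (t - s))%N <= M * \sum_(t < n) c t ^+ 2.
Proof.
move=> uphi phiM n c.
pose u h := if h == 0%N then g 0%N else 2 * g h.
have [C C0 uC] : exists2 C, 0 <= C & forall h, `|u h| <= C.
  (* Convergence at [x = 0] alone bounds the coefficients. *)
  have : bounded_fun (fun h => u h * cos (h%:R * 0)).
    by apply: cvg_series_bounded; apply/cvg_ex; exists (phi 0); exact: uphi.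
  move=> [m [_ Hm]]; exists (Num.max (m + 1) 0); first by rewrite le_max lexx orbT.
  move=> h; have := Hm (m + 1) ltac:(lra) h I; rewrite /= mulr0 cos0 mulr1 => hh.
  by rewrite le_max hh.
pose A (d : R) := \sum_(s < n) \sum_(t < n) c s * c t * (sinc2 d (s - t + (t - s))%N * g (s - t + (t - s))%N).
have Ad d : 0 < d -> A d <= M * \sum_(t < n) c t ^+ 2.
  move=> d0.
  apply/ler_addgt0Pr => e e0.
  pose S := \sum_(t < n) c t ^+ 2.
  have S0 : 0 <= S by apply: sumr_ge0 => i _; rewrite sqr_ge0.
  have L0 : 0 <= C / d ^+ 2 * 2 * S by rewrite !mulr_ge0// invr_ge0 sqr_ge0.
  have [K hK] := div_nat_lt L0 e0.
  pose N := maxn n K.+1.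
  have N0 : (0 < N)%N by rewrite leq_max orbT.
  have := @trig_sum_le_toeplitz R N n (fun h => sinc2 d h * g h) (M + (C / d ^+ 2) * (2 / N%:R)) c
    (leq_maxl _ _).
  have hN x : series (fun h => (if h == 0%N then sinc2 d 0 * g 0%N else 2 * (sinc2 d h * g h)) *
    cos (h%:R * x)) N
     <= M + (C / d ^+ 2) * (2 / N%:R).
    apply: le_trans (riemann_sum_le C0 uC uphi phiM x d0 N0).
    rewrite le_eqVlt; apply/orP; left; apply/eqP; congr series; apply/funext => h.
    by rewrite /u; case: ifP => [/eqP ->|_]; ring.
  move=> /(_ hN) /le_trans; apply.
  rewrite mulrDl lerD2l -/S; apply: le_trans (ltW hK).
  rewrite !mulrA mulrAC ler_wpM2l// lef_pV2 ?posrE ?ltr0n// ler_nat.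
  by rewrite leq_max leqnn orbT.
apply/ler_addgt0Pr => e e0.
pose L := \sum_(s < n) \sum_(t < n) `|c s * c t * g (s - t + (t - s))%N|.
have L0 : 0 <= L by apply: sumr_ge0 => i _; apply: sumr_ge0.
(* [W] dominates both [n] and [n ^+ 2 * L], so that [d = Num.min 1 e / W] gives [n * d <= 1] and
   [L * (n * d) ^+ 2 <= e], a bound for the total error of replacing the weights by 1. *)
pose W := (n%:R + 1) ^+ 2 * (L + 1).
have n1 : 1 <= n%:R + 1 :> R by rewrite lerDr.
have W1 : 1 <= W by rewrite -[1]mulr1 ler_pM// ?lerDr// exprn_ege1.
have W0 : 0 < W by exact: lt_le_trans W1.
have nW : n%:R <= W.
  have n2 : 0 <= n%:R + 1 :> R by rewrite addr_ge0.
  apply: (@le_trans _ _ (n%:R + 1)); first by rewrite lerDl.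
  apply: (@le_trans _ _ ((n%:R + 1) ^+ 2)); first by rewrite expr2 ler_peMl.
  by rewrite ler_peMr ?sqr_ge0// lerDr.
pose d := Num.min 1 e / W.
have m0 : 0 < Num.min 1 e by rewrite lt_min ltr01.
have d0 : 0 < d by rewrite divr_gt0.
have d1 : d <= 1 by rewrite ler_pdivrMr// mul1r; apply: le_trans W1; rewrite ge_min lexx.
have Wd : W * d <= e by rewrite /d mulrC divfK ?gt_eqF// ge_min lexx orbT.
have nd : n%:R * d <= 1.
  apply: (@le_trans _ _ (W * d)); first by rewrite ler_wpM2r// ltW.
  by rewrite /d mulrC divfK ?gt_eqF// ge_min lexx.
suff : \sum_(s < n) \sum_(t < n) c s * c t * g (s - t + (t - s))%N <= A d + e.
  by move=> /le_trans; apply; rewrite lerD2r Ad.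
rewrite -lerBlDl.
apply: (@le_trans _ _ (L * (n%:R * d) ^+ 2)); last first.
  apply: le_trans Wd; rewrite exprMn mulrA; apply: ler_pM => //.
  - by rewrite mulr_ge0// sqr_ge0.
  - by rewrite sqr_ge0.
  - rewrite mulrC; apply: ler_pM => //; rewrite ?sqr_ge0 ?lerDl//.
    by rewrite lerXn2r ?nnegrE//; lra.
  - by rewrite expr2 ler_piMl// ltW.
rewrite /A -sumrB mulr_suml; apply: ler_sum => s _.
rewrite -sumrB mulr_suml; apply: ler_sum => t _.
set k := (_ + _)%N; set ct := c s * c t.
have -> : ct * g k - ct * (sinc2 d k * g k) = ct * g k * (1 - sinc2 d k) by ring.
have kn : k%:R * d <= n%:R * d.
  by rewrite ler_wpM2r ?(ltW d0)// ler_nat ltnW// distn_ltn.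
have h1 := sinc2_ge d0 (le_trans kn nd).
apply: le_trans (ler_norm _) _; rewrite normrM ler_wpM2l// ger0_norm.
  apply: (@le_trans _ _ ((k%:R * d) ^+ 2)); first by lra.
  by rewrite lerXn2r// nnegrE mulr_ge0// ltW.
by rewrite subr_ge0 sinc2_le1// ltW.
Qed.

End trig.

(** * Reduction to the frequencies of one period *)

Section periodic.
Context {R : realType}.
Local Notation leb := (@lebesgue_measure R).

(** The shifted measure agrees with Lebesgue measure on half-open intervals, which determine it. *)
Lemma lebesgue_measure_shift (a : R) (A : set R) : measurable A ->
  leb ((fun x => x + a) @^-1` A) = leb A.
Proof.
move=> mA.
have mg : @measurable_fun _ _ (measurableTypeR R) (measurableTypeR R) setT (fun x => x + a).
  exact: measurable_funD.
rewrite [RHS](@lebesgue_measure_unique R (pushforward leb (fun x : measurableTypeR R => (x + a :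
  measurableTypeR R)) : {measure set _ -> \bar R}))//.
move=> X [[u v] /= _ <-].
rewrite /pushforward /=.
have -> : (fun x => x + a) @^-1` `]u, v] = `]u - a, v - a]%classic.
  by apply/seteqP; split => x /=; rewrite !in_itv/= => /andP[h1 h2]; apply/andP; split; lra.
rewrite !lebesgue_measure_itv/= !lte_fin ltrD2r; case: ifP => // _.
by rewrite -!EFinB; congr EFin; ring.
Qed.

Lemma negligible_shift (a : R) (E : set R) : leb.-negligible E ->
  leb.-negligible [set x | E (x + a)].
Proof.
move=> [N [mN N0 EN]]; exists ((fun x => x + a) @^-1` N); split.
- rewrite -[X in measurable X]setTI; have mg : measurable_fun setT (fun x : R => x + a).
    exact: measurable_funD.
  exact: mg.
- by rewrite lebesgue_measure_shift.
- by move=> x /= /EN.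
Qed.

Lemma cosD2piMn (x : R) (k : nat) : cos (x + 2 * pi * k%:R) = cos x.
Proof.
elim: k => [|k IH]; first by rewrite mulr0 addr0.
rewrite -[k.+1%:R]natr1 mulrDr mulr1 addrA mulr_natl cosD2pi -mulr_natl.
exact: IH.
Qed.

(** [phi] is meaningful on [[-pi, pi]] only. The limit [psi] of the series extends it periodically,
    and the exceptional set of [psi] lies in countably many translates of that of [phi]. *)
Lemma toeplitz_le_ae_pi (g : nat -> R) (phi : R -> R) (M : R) :
  (forall x, x \in `[- pi, pi] ->
     series (fun h => (if h == 0%N then g 0%N else 2 * g h) * cos (h%:R * x)) @ \oo --> phi x) ->
  leb.-negligible (`[- pi, pi]%classic `&` [set x | M < phi x]) ->
  forall n (c : 'I_n -> R),
  \sum_(s < n) \sum_(t < n) c s * c t * g (s - t + (t - s))%N <= M * \sum_(t < n) c t ^+ 2.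
Proof.
move=> gphi neg n c.
pose u x h := (if h == 0%N then g 0%N else 2 * g h) * cos (h%:R * x).
have pi0 := @pi_gt0 R.
have per (x : R) (k : nat) : u (x + 2 * pi * k%:R) = u x.
  apply/funext => h; rewrite /u; congr (_ * _).
  by rewrite mulrDr mulrCA -natrM cosD2piMn.
(* Two alternatives, because the number of periods is a floor and may have either sign. *)
have red (x : R) : exists k : nat, x - 2 * pi * k%:R \in `[- pi, pi] \/ x + 2 * pi * k%:R \in `[- pi, pi].
  have /andP := floor_itv ((x + pi) / (2 * pi)).
  case: (Num.floor _) => k [h1 h2].
    exists k; left; move: h1 h2; rewrite intrD -pmulrn ler_pdivlMr ?ltr_pdivrMr ?mulr_gt0//.
    by rewrite in_itv/= => h1 h2; apply/andP; split; lra.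
  exists k.+1; right; move: h1 h2; rewrite intrD NegzE mulrNz -pmulrn ler_pdivlMr ?ltr_pdivrMr ?mulr_gt0//.
  by rewrite in_itv/= => h1 h2; apply/andP; split; lra.
pose psi x := limn (series (u x)).
have psiE (x : R) (k : nat) : psi (x + 2 * pi * k%:R) = psi x by rewrite /psi per.
have phiE x : x \in `[- pi, pi] -> psi x = phi x.
  by move=> /gphi h; apply/cvg_lim.
apply: (@toeplitz_le_ae R g psi M).
  move=> x; rewrite -/(u x); have [k [h|h]] := red x.
    by have := gphi _ h; rewrite -/(u _) -phiE// -(subrK (2 * pi * k%:R) x) per psiE addrK.
  by have := gphi _ h; rewrite -/(u _) -phiE// per psiE.
pose E := `[- pi, pi]%classic `&` [set x | M < phi x].
have hneg : leb.-negligible (\bigcup_(k : nat)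
   ([set x | E (x + (- (2 * pi * k%:R)))] `|` [set x | E (x + 2 * pi * k%:R)])).
  by apply: negligible_bigcup => k; apply: negligibleU; exact: negligible_shift.
apply: negligibleS hneg => x /= Mx; have [k [h|h]] := red x; exists k => //; [left|right]; split => //=.
  by rewrite -phiE// -(psiE _ k) subrK.
by rewrite -phiE// psiE.
Qed.

End periodic.

(** * Centred Gaussian variables *)

Section elementary.
Context {R : realType}.
Implicit Types x y : R.

Lemma cos_ge1B x : 1 - x ^+ 2 / 2 <= cos x.
Proof.
have -> : x = x / 2 + x / 2 by field.
rewrite cosD -!expr2 cos2sin2; set y := x / 2.
have -> : y + y = 2 * y by ring.
have h : sin y ^+ 2 <= y ^+ 2.
  rewrite -(real_normK (num_real (sin y))) -(real_normK (num_real y)).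
  rewrite lerXn2r ?nnegrE//; have [y0|y0] := leP 0 y.
    by rewrite (ger0_norm y0) abs_sin_le_natmul.
  rewrite -normrN -sinN -(normrN y) [leRHS]ger0_norm ?oppr_ge0 ?(ltW y0)//.
  by rewrite abs_sin_le_natmul// oppr_ge0 ltW.
lra.
Qed.

(** Square the inequality [2 * y <= expR y - expR (- y)] at [y = x / 2]. It follows from the mean
    value theorem, since the derivative [expR c + expR (- c)] is at least 2. *)
Lemma expRDN_ge x : 2 + x ^+ 2 <= expR x + expR (- x).
Proof.
wlog x0 : x / 0 <= x.
  move=> h; have [/h//|/ltW x0] := leP 0 x.
  by have := h (- x); rewrite oppr_ge0 x0 sqrrN opprK addrC [leRHS]addrC => /(_ isT); rewrite addrC.
pose y := x / 2; have y0 : 0 <= y by rewrite /y divr_ge0.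
have h : 2 * y <= expR y - expR (- y).
  have [->|yn0] := eqVneq y 0; first by rewrite oppr0 mulr0 subrr.
  have {}y0 : 0 < y by rewrite lt_neqAle eq_sym yn0.
  have dd (z : R) : is_derive z (1 : R) (fun z => expR z - expR (- z)) (expR z + expR (- z)).
    by apply: is_derive_eq; rewrite /= /GRing.scale/=; ring.
  have [|c _] := @MVT R (fun z => expR z - expR (- z)) (fun z => expR z + expR (- z)) 0 y y0 (fun z
    _ => dd z).
    apply: continuous_subspaceT => z; have [h _] := dd z.
    by apply: differentiable_continuous; apply/derivable1_diffP.
  move=> E; have {E} -> : expR y - expR (- y) = (expR c + expR (- c)) * y.
    by rewrite -[y in RHS]subr0 -E oppr0 subrr subr0.
  apply: ler_wpM2r; first exact: ltW.
  have := expR_gt0 c; rewrite expRN; move: (expR c) => e e0.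
  rewrite -subr_ge0; have -> : e + e^-1 - 2 = (e - 1) ^+ 2 / e by field; rewrite gt_eqF.
  by rewrite divr_ge0 ?sqr_ge0// ltW.
have -> : x = y + y by rewrite /y; field.
rewrite opprD !expRD.
have e1 : expR y * expR (- y) = 1 by rewrite -expRD subrr expR0.
have : (2 * y) ^+ 2 <= (expR y - expR (- y)) ^+ 2.
  by rewrite lerXn2r// nnegrE ?mulr_ge0//; apply: le_trans h; rewrite mulr_ge0.
by move: e1; set a := expR y; set b := expR (- y); nra.
Qed.

Lemma sqr_le_expRDN x : x ^+ 2 <= expR x + expR (- x).
Proof. by have := expRDN_ge x; lra. Qed.

Lemma abs_le_expRDN x : `|x| <= expR x + expR (- x).
Proof.
apply: le_trans (expRDN_ge x); rewrite -(real_normK (num_real x)).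
by have := sqr_ge0 (`|x| - 1); nra.
Qed.

Lemma expR_le_quad y : 0 <= y <= 1 / 2 -> expR y <= 1 + y + 2 * y ^+ 2.
Proof.
move=> /andP[y0 y1]; have h := expR_ge1Dx (- y).
have e0 := expR_gt0 y.
have : expR y * (1 + - y) <= 1.
  by rewrite -[leRHS](expRxMexpNx_1 y) ler_wpM2l// ltW.
have : 0 <= y ^+ 2 * (1 - 2 * y) by rewrite mulr_ge0 ?sqr_ge0//; lra.
have y2 : 0 < 1 - y by lra.
move=> h1 h2; rewrite -(ler_pM2r y2); apply: (le_trans h2).
nra.
Qed.

Lemma expRN_le_quad y : 0 <= y -> expR (- y) <= 1 - y + y ^+ 2.
Proof.
move=> y0; have h := expR_ge1Dx y.
have e0 := expR_gt0 (- y).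
have h2 : expR (- y) * (1 + y) <= 1.
  by rewrite -[leRHS](expRxMexpNx_1 (- y)) opprK ler_wpM2l// ltW.
have y2 : 0 < 1 + y by lra.
rewrite -(ler_pM2r y2); apply: (le_trans h2).
have : 0 <= y ^+ 3 by rewrite exprn_ge0.
nra.
Qed.

(** Supplies the small argument at which second-order expansions identify the parameters of a
    Gaussian law. *)
Lemma small_pos (A B e : R) : 0 <= A -> 0 <= B -> 0 < e ->
  exists2 t, 0 < t & A * t ^+ 2 <= 1 / 2 /\ B * t ^+ 2 <= e /\ B * t <= e.
Proof.
move=> A0 B0 e0; pose W := 2 * (A + B + 1).
have W0 : 0 < W by rewrite /W; lra.
have m0 : 0 < Num.min 1 e by rewrite lt_min ltr01.
exists (Num.min 1 e / W); first by rewrite divr_gt0.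
set t := _ / W.
have t0 : 0 < t by rewrite divr_gt0.
have tW : W * t = Num.min 1 e by rewrite /t mulrC divfK// gt_eqF.
have m1 : Num.min 1 e <= 1 by rewrite ge_min lexx.
have me : Num.min 1 e <= e by rewrite ge_min lexx orbT.
have t1 : t <= 1 by rewrite /t ler_pdivrMr// mul1r (le_trans m1)// /W; lra.
have tt : t ^+ 2 <= t by rewrite expr2 ler_piMl// ltW.
have h : 2 * (A * t) + 2 * (B * t) + 2 * t = Num.min 1 e by rewrite -tW /W; ring.
have At : A * t ^+ 2 <= A * t by rewrite ler_wpM2l.
have Bt : B * t ^+ 2 <= B * t by rewrite ler_wpM2l.
have A1 : 0 <= A * t by rewrite mulr_ge0// ltW.
have B1 : 0 <= B * t by rewrite mulr_ge0// ltW.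
by split; [lra|split; lra].
Qed.

End elementary.

(** * Densities and integrals of the normal law *)

Section density.
Import HBNNSimple.
Context d {T : measurableType d} {R : realType}.
Variables (mu nu : {measure set T -> \bar R}) (g : T -> R).
Hypotheses (mg : measurable_fun setT g) (g0 : forall x, 0 <= g x).
Hypothesis nuE : forall A, measurable A -> nu A = (\int[mu]_(x in A) (g x)%:E)%E.

(** Both sides commute with the monotone limit of simple functions, and on the level sets of a
    simple function the identity is [nuE]. *)
Lemma ge0_integral_density (f : T -> \bar R) : measurable_fun setT f ->
  (forall x, (0 <= f x)%E) ->
  (\int[nu]_x f x = \int[mu]_x (f x * (g x)%:E))%E.
Proof.
move=> mf f0.
pose h := nnsfun_approx measurableT mf.
have mEg : measurable_fun setT (fun x => (g x)%:E) by exact/measurable_EFinP.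
have fE x : f x = limn (fun n => (h n x)%:E).
  by apply/esym/cvg_lim => //; apply: cvg_nnsfun_approx.
have nd x : nondecreasing_seq (fun n => (h n x)%:E).
  by move=> m n mn; rewrite lee_fin; exact/lefP/nd_nnsfun_approx.
transitivity (limn (fun n => \int[nu]_x (h n x)%:E)%E).
  rewrite -monotone_convergence//.
  - by apply: eq_integral => x _; exact: fE.
  - by move=> n; exact/measurable_EFinP.
  - by move=> n x _; rewrite lee_fin.
transitivity (limn (fun n => \int[mu]_x ((h n x)%:E * (g x)%:E))%E); last first.
  rewrite -monotone_convergence//.
  - apply: eq_integral => x _; rewrite fE; apply/cvg_lim => //.
    apply: cvgeZr => //.
    have /cvg_ex[l hl] : cvgn (fun n => (h n x)%:E) by apply: ereal_nondecreasing_is_cvgn; exact: nd.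
    by rewrite (cvg_lim _ hl).
  - by move=> n; apply: emeasurable_funM => //; exact/measurable_EFinP.
  - by move=> n x _; rewrite mule_ge0// lee_fin.
  - by move=> x _ m n mn; rewrite lee_wpmul2r ?lee_fin//; exact: (nd x m n mn).
congr (limn _); apply/funext => n.
rewrite integralT_nnsfun sintegralE.
have hE x : ((h n x)%:E * (g x)%:E)%E = (\sum_(k \in range (h n))
    (k%:E * ((\1_(h n @^-1` [set k]) x)%:E * (g x)%:E)))%E.
  rewrite fimfunE -fsumEFin// ge0_mule_fsuml.
    by apply: eq_fsbigr => k _; rewrite EFinM muleA.
  by move=> k; exact: nnfun_muleindic_ge0.
under [RHS]eq_integral do rewrite hE.
have m1 (k : R) : measurable_fun setT (fun x => ((\1_(h n @^-1` [set k]) x)%:E * (g x)%:E)%E).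
  by apply: emeasurable_funM => //; exact/measurable_EFinP.
rewrite ge0_integral_fsum//; last 2 first.
- by move=> k; exact: measurable_funeM.
- move=> k x _; rewrite muleA mule_ge0 ?lee_fin//; exact: nnfun_muleindic_ge0.
apply: eq_fsbigr => k; rewrite inE => -[y _ <-].
rewrite ge0_integralZl ?lee_fin//; last by move=> x _; rewrite mule_ge0// lee_fin.
congr (_ * _)%E; rewrite nuE; last exact: measurable_funPTI.
rewrite integral_mkcond; apply: eq_integral => x _.
by rewrite patchE indicE; case: ifP; rewrite ?mul1e ?mul0e.
Qed.
End density.

Section normal_integrals.
Context {R : realType}.
Local Notation leb := (@lebesgue_measure R).
Implicit Types (m s t : R).

Lemma normal_pdf_neq0 m s x : s != 0 ->
  normal_pdf m s x = normal_peak s * normal_fun m s x.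
Proof. by move=> s0; rewrite normal_pdfE. Qed.

(** Completing the square: exponential tilting by [t] shifts the mean by [t * s ^+ 2]. *)
Lemma normal_fun_expR m s t x : s != 0 ->
  expR (t * x) * normal_pdf m s x =
  expR (t * m + s ^+ 2 * t ^+ 2 / 2) * normal_pdf (m + t * s ^+ 2) s x.
Proof.
move=> s0; rewrite !normal_pdf_neq0// /normal_fun.
rewrite mulrCA [RHS]mulrCA; congr (_ * _); rewrite -!expRD; congr expR.
by rewrite -[s ^+ 2 *+ 2]mulr_natr; field.
Qed.

Lemma integral_normal_prob m s (f : R -> \bar R) : measurable_fun setT f ->
  (forall x, (0 <= f x)%E) ->
  (\int[normal_prob m s]_x f x = \int[leb]_x (f x * (normal_pdf m s x)%:E))%E.
Proof.
move=> mf f0; apply: (@ge0_integral_density _ (measurableTypeR R)) => //.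
- exact: measurable_normal_pdf.
- by move=> x; exact: normal_pdf_ge0.
Qed.

Lemma integral_normal_expR m s t : s != 0 ->
  (\int[normal_prob m s]_x (expR (t * x))%:E =
   (expR (t * m + s ^+ 2 * t ^+ 2 / 2))%:E)%E.
Proof.
move=> s0; rewrite integral_normal_prob//; last first.
  apply/measurable_EFinP; apply: measurableT_comp => //.
under eq_integral do rewrite -EFinM normal_fun_expR// EFinM.
rewrite ge0_integralZl ?lee_fin ?expR_ge0//.
- by rewrite integral_normal_pdf mule1.
- by apply/measurable_EFinP; exact: measurable_normal_pdf.
- by move=> x _; rewrite lee_fin normal_pdf_ge0.
Qed.

Lemma integral_normal_expR_sqr t : t < 1 / 2 ->
  (\int[normal_prob 0 1]_x (expR (t * x ^+ 2))%:E = ((Num.sqrt (1 - 2 * t))^-1)%:E)%E.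
Proof.
move=> t2; have t0 : 0 < 1 - 2 * t by lra.
(* Multiplying the standard density by [expR (t * x ^+ 2)] gives [s] times the centred normal
   density with this standard deviation. *)
pose s := (Num.sqrt (1 - 2 * t))^-1.
have s0 : s != 0 by rewrite invr_neq0// gt_eqF// sqrtr_gt0.
have s2 : s ^+ 2 = (1 - 2 * t)^-1 by rewrite exprVn sqr_sqrtr// ltW.
rewrite integral_normal_prob//; last first.
  apply/measurable_EFinP; apply: measurableT_comp => //.
  by apply: measurable_funM => //; exact: measurable_funX.
have E x : expR (t * x ^+ 2) * normal_pdf 0 1 x = s * normal_pdf 0 s x.
  rewrite !normal_pdf_neq0// /normal_fun !subr0 mulrCA [RHS]mulrA; congr (_ * _); last first.
    rewrite -expRD; congr expR; rewrite s2 expr1n !mulr2n.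
    by field; rewrite gt_eqF.
  rewrite /normal_peak s2 expr1n mul1r -[pi *+ 2]mulr_natr -[_ * pi *+ 2]mulr_natr.
  have pi20 : 0 <= pi * 2 :> R by rewrite mulr_ge0// pi_ge0.
  have -> : (1 - 2 * t)^-1 * pi * 2 = s ^+ 2 * (pi * 2) by rewrite s2 mulrA.
  rewrite [Num.sqrt (s ^+ 2 * _)]sqrtrM ?sqr_ge0// sqrtr_sqr ger0_norm ?invr_ge0// invfM mulrA
    divff// mul1r//.
under eq_integral do rewrite -EFinM E EFinM.
rewrite ge0_integralZl ?lee_fin ?invr_ge0//.
- by rewrite integral_normal_pdf mule1.
- by apply/measurable_EFinP; exact: measurable_normal_pdf.
- by move=> x _; rewrite lee_fin normal_pdf_ge0.
Qed.

End normal_integrals.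

(** * The characteristic function of a centred normal law *)

Section normal_cos.
Context {R : realType}.
Local Notation leb := (@lebesgue_measure R).
Variables (s : R) (s0 : s != 0).
Let p (x : R) := normal_pdf 0 s x.

Let p_ge0 x : 0 <= p x. Proof. exact: normal_pdf_ge0. Qed.

Let mp : measurable_fun setT p. Proof. exact: measurable_normal_pdf. Qed.

Let ip : leb.-integrable setT (EFin \o p).
Proof. exact: integrable_normal_pdf. Qed.

Let iexp t : leb.-integrable setT (EFin \o (fun x => expR (t * x) * p x)).
Proof.
rewrite (_ : (fun x => _) = (fun x => expR (t * 0 + s ^+ 2 * t ^+ 2 / 2) *
    normal_pdf (0 + t * s ^+ 2) s x)).
  by apply: integrableRZ => //; exact: integrable_normal_pdf.
by apply/funext => x; exact: normal_fun_expR.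
Qed.

Let iabs : leb.-integrable setT (EFin \o (fun x => `|x| * p x)).
Proof.
apply: (@le_integrableR _ (measurableTypeR R) R leb setT measurableT _ (fun x => expR (1 * x) * p x
  + expR ((-1) * x) * p x)) => //.
- by apply: measurable_funM => //; exact: measurableT_comp.
- move=> x _; rewrite normrM normr_id (ger0_norm (p_ge0 x)) -mulrDl ler_wpM2r//.
  by rewrite mul1r mulN1r abs_le_expRDN.
- by apply: integrableRD => //; exact: iexp.
Qed.

Let C t := \int[leb]_x (cos (t * x) * p x).

Let mcos t : measurable_fun setT (fun x : R => cos (t * x)).
Proof.
apply: measurableT_comp; last exact: measurable_funM.
by apply: continuous_measurable_fun; exact: continuous_cos.
Qed.

Let msin t : measurable_fun setT (fun x : R => sin (t * x)).
Proof.
apply: measurableT_comp; last exact: measurable_funM.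
by apply: continuous_measurable_fun; exact: continuous_sin.
Qed.

Let icos t : leb.-integrable setT (EFin \o (fun x => cos (t * x) * p x)).
Proof.
apply: (@le_integrableR _ (measurableTypeR R) R leb setT measurableT _ p) => //; first by apply:
  measurable_funM; [exact: mcos|exact: mp].
by move=> x _; rewrite normrM (ger0_norm (p_ge0 x)) ler_piMl// cos_max.
Qed.

Let ixsin t : leb.-integrable setT (EFin \o (fun x => x * sin (t * x) * p x)).
Proof.
apply: (@le_integrableR _ (measurableTypeR R) R leb setT measurableT _ (fun x => `|x| * p x)) => //.
  by apply: measurable_funM; [apply: measurable_funM => //; exact: msin|exact: mp].
by move=> x _; rewrite !normrM (ger0_norm (p_ge0 x)) ler_wpM2r// ler_piMr// sin_max.
Qed.

Let dcos (x t : R) : is_derive t (1 : R) (fun t : R => cos (t * x) * p x) (- (x * sin (t * x) * p x)).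
Proof.
apply: is_derive_eq.
by rewrite /= !scaler0 !scaler1 ?add0r ?addr0 /GRing.scale/=; ring.
Qed.

Let derC (t : R) : is_derive t (1 : R) C (- \int[leb]_x (x * sin (t * x) * p x)).
Proof.
have hI : `]t - 1, t + 1[%classic t by rewrite /= in_itv/=; apply/andP; split; lra.
have dE : partial1of2 (fun t x : R => cos (t * x) * p x) = (fun t x : R => - (x * sin (t * x) * p x)).
  by apply/funext => u; apply/funext => x; rewrite partial1of2E; have [_ ->] := dcos x u.
have ub (u x : R) : `]t - 1, t + 1[%classic u -> setT x ->
    `|partial1of2 (fun t x : R => cos (t * x) * p x) u x| <= `|x| * p x.
  by move=> _ _; rewrite dE normrN !normrM (ger0_norm (p_ge0 x)) ler_wpM2r// ler_piMr// sin_max.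
have der (u x : R) : `]t - 1, t + 1[%classic u -> setT x -> derivable (fun t : R => cos (t * x) * p x) u 1.
  by move=> _ _; have [] := dcos x u.
have G0 x : 0 <= `|x| * p x by rewrite mulr_ge0.
have intf (u : R) : `]t - 1, t + 1[%classic u -> leb.-integrable setT (EFin \o (fun x => cos (u * x) * p x)).
  by move=> _; exact: icos.
have := @derivable_under_integral R _ _ leb (fun t x : R => cos (t * x) * p x) setT measurableT t
  (t - 1) (t + 1) hI intf der (fun x => `|x| * p x) G0 iabs ub.
move=> dC; split => //.
rewrite -derive1E (@differentiation_under_integral R _ _ leb (fun t x : R => cos (t * x) * p x)
  setT measurableT t (t - 1) (t + 1) hI intf der (fun x => `|x| * p x) G0 iabs ub).
under eq_Rintegral do rewrite dE -mulN1r.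
by rewrite RintegralZl// mulN1r.
Qed.

Let pE : p = (fun x => normal_peak s * expR (- (2 * s ^+ 2)^-1 * x ^+ 2)).
Proof.
apply/funext => x; rewrite /p normal_pdf_neq0// /normal_fun subr0; congr (_ * expR _).
by rewrite -[_ *+ 2]mulr_natl !mulNr mulrC.
Qed.

Let dp (x : R) : is_derive x (1 : R) p (- x / s ^+ 2 * p x).
Proof.
rewrite pE; apply: is_derive_eq.
by rewrite /= /GRing.scale/=; field.
Qed.

(** The derivative of [sin (t * x) * p x] in [x]; its zero integral is the integration by parts that
    links [C] to its derivative. *)
Let D t x := t * (cos (t * x) * p x) - s ^- 2 * (x * sin (t * x) * p x).

Let dsin (t x : R) : is_derive x (1 : R) (fun x : R => sin (t * x) * p x) (D t x).
Proof.
have dpx := dp x; apply: is_derive_eq.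
by rewrite /= /GRing.scale/= /D; field.
Qed.

Let iD t : leb.-integrable setT (EFin \o D t).
Proof.
apply: (@integrableRB _ (measurableTypeR R)) => //.
  by apply: integrableRZ => //; exact: icos.
by apply: integrableRZ => //; exact: ixsin.
Qed.

Let cont_of_der (f f' : R -> R) : (forall x : R, is_derive x (1 : R) f (f' x)) -> continuous f.
Proof.
move=> h x; have [d _] := h x.
by apply: differentiable_continuous; apply/derivable1_diffP.
Qed.

Let cD t : continuous (D t).
Proof.
have cp : continuous p by exact: cont_of_der dp.
have cm : continuous (fun x : R => t * x).
  by move=> x; apply: cvgM; [exact: cvg_cst|exact: cvg_id].
move=> x; apply: cvgB.
  apply: cvgM; first exact: cvg_cst.
  apply: cvgM; last exact: cp.
  by apply: continuous_comp; [exact: cm|exact: continuous_cos].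
apply: cvgM; first exact: cvg_cst.
apply: cvgM; last exact: cp.
apply: cvgM; first exact: cvg_id.
by apply: continuous_comp; [exact: cm|exact: continuous_sin].
Qed.

Let int_itv t (n : nat) : (0 < n)%N ->
  (\int[leb]_(x in `[(- n%:R)%R, n%:R%R]) (D t x)%:E =
   (sin (t * n%:R) * p n%:R - sin (t * - n%:R) * p (- n%:R))%:E)%E.
Proof.
move=> n0; have n1 : 0 < n%:R :> R by rewrite ltr0n.
rewrite (@continuous_FTC2 R (D t) (fun x => sin (t * x) * p x))//.
- by lra.
- by apply: continuous_subspaceT; exact: cD.
- have cg : continuous (fun x : R => sin (t * x) * p x) by exact: (cont_of_der (dsin t)).
  split.
  + by move=> x _; have [] := dsin t x.
  + by apply: cvg_at_right_filter; exact: cg.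
  + by apply: cvg_at_left_filter; exact: cg.
- by move=> x _; rewrite derive1E; have [_ ->] := dsin t x.
Qed.

(** [1 + y <= expR y] already gives decay of order [1 / n], enough for the boundary terms of the
    integration by parts. *)
Let p_decay (n : nat) : p n.+1%:R <= normal_peak s * (2 * s ^+ 2) / n.+1%:R.
Proof.
have n0 : 0 < n.+1%:R :> R by rewrite ltr0n.
have s2 : 0 < 2 * s ^+ 2 by rewrite mulr_gt0// exprn_even_gt0.
rewrite pE -mulrA ler_wpM2l ?normal_peak_ge0// mulNr expRN.
have h := expR_ge1Dx ((2 * s ^+ 2)^-1 * n.+1%:R ^+ 2).
have q : n.+1%:R / (2 * s ^+ 2) <= expR ((2 * s ^+ 2)^-1 * n.+1%:R ^+ 2).
  apply: le_trans h; rewrite addrC; apply: le_trans (_ : (2 * s ^+ 2)^-1 * n.+1%:R ^+ 2 <= _); last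
    by rewrite lerDl.
  rewrite mulrC ler_wpM2l ?invr_ge0 ?(ltW s2)//.
  by rewrite expr2 ler_peMl// ler1n.
by rewrite -invf_div lef_pV2 ?posrE ?expR_gt0// divr_gt0.
Qed.

Let int0 t : \int[leb]_x D t x = 0.
Proof.
pose f_ (n : nat) (x : R) : \bar R := ((D t \_ `[(- n.+1%:R), n.+1%:R]) x)%:E.
have mD : measurable_fun setT (fun x => (D t x)%:E).
  by have /integrableP[] := iD t.
have [] := @dominated_convergence _ (measurableTypeR R) R leb setT measurableT f_ (fun x => (D t
  x)%:E) (fun x => `|(D t x)%:E|%E).
- move=> n; rewrite /f_; apply/measurable_EFinP.
  apply/(measurable_restrictT _ _).1 => //.
  by apply: measurable_funTS; apply: continuous_measurable_fun; exact: cD.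
- exact: mD.
- apply: aeW => x _; apply: cvg_near_cst; near=> n.
  rewrite /f_ patchE mem_set//= in_itv/= -ler_norml.
  apply: le_trans (_ : n%:R <= _); last by rewrite ler_nat.
  near: n; exact: nbhs_infty_ger.
- by apply: integrable_abse; exact: iD.
- apply: aeW => x n _; rewrite /f_ patchE; case: ifP => // _.
  by rewrite abse0 abse_ge0.
move=> _ _ lim1.
have lim2 : (\int[leb]_x f_ n x)%E @[n --> \oo] --> 0%E.
  have fE n : (\int[leb]_x f_ n x)%E = (sin (t * n.+1%:R) * p n.+1%:R - sin (t * - n.+1%:R) * p (-
    n.+1%:R))%:E.
    by rewrite -int_itv// [RHS]integral_mkcond; apply: eq_integral => x _; rewrite /f_ restrict_EFin.
  under eq_cvg do rewrite fE.
  apply: cvg_EFin; first by apply: nearW.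
  apply/cvgr0Pnorm_le => e e0; near=> n.
  rewrite /= mulrN sinN mulNr opprK.
  have -> : p (- n.+1%:R) = p n.+1%:R by rewrite pE sqrrN.
  apply: le_trans (ler_normD _ _) _.
  have q : `|sin (t * n.+1%:R) * p n.+1%:R| <= 1 * (normal_peak s * (2 * s ^+ 2) / n.+1%:R).
    by rewrite normrM ler_pM// ?sin_max// (ger0_norm (p_ge0 _)) p_decay.
  apply: le_trans (lerD q q) _.
  rewrite !mul1r -mulrDl ler_pdivrMr// [leRHS]mulrC -ler_pdivrMr//.
  apply: le_trans (_ : n%:R <= _); last by rewrite ler_nat.
  near: n; exact: nbhs_infty_ger.
rewrite /Rintegral.
by rewrite (cvg_unique _ lim1 lim2).
Unshelve. all: by end_near.
Qed.

(** [C] satisfies [C' = - s ^+ 2 * t * C], by differentiation under the integral sign and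
    integration by parts; hence [C u * expR (s ^+ 2 / 2 * u ^+ 2)] is constant, and it is 1 at 0. *)
Lemma Rintegral_normal_cos t :
  \int[leb]_x (cos (t * x) * normal_pdf 0 s x) = expR (- (s ^+ 2 * t ^+ 2 / 2)).
Proof.
rewrite -/(C t).
have s2 : s ^+ 2 != 0 by rewrite expf_neq0.
have ibp u : \int[leb]_x (x * sin (u * x) * p x) = s ^+ 2 * u * C u.
  have := int0 u; rewrite /D RintegralB//; last 2 first.
  - by apply: integrableRZ => //; exact: icos.
  - by apply: integrableRZ => //; exact: ixsin.
  rewrite !RintegralZl//; try exact: icos; try exact: ixsin.
  rewrite -/(C u) => /eqP; rewrite subr_eq0 => /eqP h.
  by rewrite -mulrA h mulVKf.
have dE (u : R) : is_derive u (1 : R) (fun u => C u * expR (s ^+ 2 / 2 * u ^+ 2)) 0.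
  have := derC u; rewrite ibp => dC.
  by apply: is_derive_eq; rewrite /= /GRing.scale/=; field.
have := is_derive_0_is_cst t 0 dE.
have -> : C 0 = 1.
  rewrite /C; under eq_Rintegral do rewrite mul0r cos0 mul1r.
  by rewrite /Rintegral integral_normal_pdf.
rewrite expr0n mulr0 expR0 mulr1 => h.
rewrite expRN; apply: (mulIf (lt0r_neq0 (expR_gt0 (s ^+ 2 * t ^+ 2 / 2)))).
by rewrite mulVf ?lt0r_neq0 ?expR_gt0// [s ^+ 2 * _ / _]mulrAC h.
Qed.

(** The added 1 makes the integrand nonnegative, as [gaussian_rv_transfer] requires for passing from
    the law to the random variable. *)
Lemma integral_normal_1Dcos t :
  (\int[normal_prob 0 s]_x (1 + cos (t * x))%:E = (1 + expR (- (s ^+ 2 * t ^+ 2 / 2)))%:E)%E.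
Proof.
have mc : measurable_fun setT (fun x : R => cos (t * x)).
  apply: measurableT_comp; last exact: measurable_funM.
  by apply: continuous_measurable_fun; exact: continuous_cos.
have c0 (x : R) : 0 <= 1 + cos (t * x) by have := cos_geN1 (t * x); lra.
rewrite integral_normal_prob//; last first.
  by apply/measurable_EFinP; exact: measurable_funD.
have ipdf := @integrable_normal_pdf R 0 s.
have icpdf : leb.-integrable setT (EFin \o (fun x => cos (t * x) * normal_pdf 0 s x)).
  apply: (@le_integrableR _ (measurableTypeR R) R leb setT measurableT _ (normal_pdf 0 s)) => //.
    by apply: measurable_funM; [exact: mc|exact: measurable_normal_pdf].
  move=> x _; rewrite normrM (ger0_norm (normal_pdf_ge0 _ _ _)).
  by rewrite ler_piMl ?normal_pdf_ge0// cos_max.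
transitivity (\int[leb]_x ((normal_pdf 0 s x)%:E + (cos (t * x) * normal_pdf 0 s x)%:E))%E.
  by apply: eq_integral => x _; rewrite -EFinM -EFinD mulrDl mul1r.
rewrite integralD//= integral_normal_pdf EFinD; congr (_ + _)%E.
by rewrite -(Rintegral_normal_cos) /Rintegral fineK//; exact: integrable_fin_num.
Qed.

End normal_cos.

(** * Moments of Gaussian random variables *)

Section gaussian_rv.
Context d {Omega : measurableType d} {R : realType} (P : probability Omega R).
Local Notation leb := (@lebesgue_measure R).

(* The bound on the exponential moment is one-sided: this is what survives in [L^2]
   limits without a uniform integrability argument. *)
Definition centered_gaussian (L : Omega -> R) : Prop :=
  [/\ measurable_fun setT L, P.-integrable setT (EFin \o (fun w => L w ^+ 2)),
     (\int[P]_w (expR (L w))%:E <= (expR ((\int[P]_w (L w ^+ 2)) / 2))%:E)%E &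
     \int[P]_w cos (L w) = expR (- ((\int[P]_w (L w ^+ 2)) / 2))].

Lemma Pfin (c : R) : P.-integrable setT (EFin \o (fun=> c)).
Proof.
apply: measurable_bounded_integrable => //; first by rewrite (_ : _ setT = 1%E) ?ltry//; exact:
  probability_setT.
by exists `|c|; split => // t t1 y _; exact: ltW.
Qed.

Lemma Rintegral_prob_cst (c : R) : \int[P]_w c = c.
Proof. by rewrite Rintegral_cst// (_ : _ setT = 1%E) ?mulr1//; exact: probability_setT. Qed.

Lemma Pbounded (f : Omega -> R) (B : R) : measurable_fun setT f ->
  (forall w, `|f w| <= B) -> P.-integrable setT (EFin \o f).
Proof. by move=> mf fB; apply: (@le_integrableR _ _ _ P _ measurableT _ (fun=> B)) => //; exact: Pfin. Qed.

Lemma gaussian_rv_transfer (L : Omega -> R) : gaussian_rv P L ->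
  exists m s, forall f : R -> \bar R, measurable_fun setT f -> (forall x, (0 <= f x)%E) ->
    (\int[P]_w f (L w) = if (s == 0)%R then f m else \int[normal_prob m s]_x f x)%E.
Proof.
move=> [mL [m [s law]]]; exists m, s => f mf f0.
have := @ge0_integral_pushforward _ _ Omega (measurableTypeR R) R L mL P setT f measurableT mf (fun
  y _ => f0 y).
rewrite preimage_setT => <-.
case: ifPn => s0; rewrite ?s0 in law.
  rewrite (eq_measure_integral (\d_(m : measurableTypeR R))).
    by rewrite integral_dirac// diracT mul1e.
  by move=> A mA _; exact: law.
apply: eq_measure_integral => A mA _.
by have := law A mA; rewrite (negbTE s0).
Qed.

(** The law comes with parameters [m] and [s], a priori unrelated to the moments of [L]. The moment
    generating function and the mean of the cosine, expanded for small [t], force [m = 0] and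
    variance [s ^+ 2]; then [t = 1] gives the two claims. *)
Lemma gaussian_rv_centered (L : Omega -> R) : gaussian_rv P L -> ('E_P[L] = 0)%E ->
  centered_gaussian L.
Proof.
move=> gL EL; have [mL _] := gL.
have [m [s tr]] := gaussian_rv_transfer gL.
have mexp t : measurable_fun setT (fun x : R => expR (t * x)).
  by apply: measurableT_comp => //; exact: measurable_funM.
have mgf t : (\int[P]_w (expR (t * L w))%:E = (expR (t * m + s ^+ 2 * t ^+ 2 / 2))%:E)%E.
  rewrite (tr (fun x => (expR (t * x))%:E)); last 2 first.
  - exact/measurable_EFinP.
  - by move=> x; rewrite lee_fin expR_ge0.
  case: ifPn => [/eqP ->|s0]; first by rewrite expr0n/= mul0r mul0r addr0.
  exact: integral_normal_expR.
have mexpL t : measurable_fun setT (fun w => expR (t * L w)).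
  by apply: measurableT_comp => //; exact: measurable_funM.
have iexp t : P.-integrable setT (EFin \o (fun w => expR (t * L w))).
  by apply: ge0_integrable_lty => //; rewrite mgf ltry.
have icosh : P.-integrable setT (EFin \o (fun w => expR (1 * L w) + expR (-1 * L w))).
  by apply: integrableRD.
have iL : P.-integrable setT (EFin \o L).
  apply: le_integrableR icosh => // w _.
  by rewrite mul1r mulN1r abs_le_expRDN.
have iL2 : P.-integrable setT (EFin \o (fun w => L w ^+ 2)).
  apply: le_integrableR icosh => //; first exact: measurable_funX.
  by move=> w _; rewrite mul1r mulN1r ger0_norm ?sqr_ge0// sqr_le_expRDN.
have E0 : \int[P]_w L w = 0 by rewrite /Rintegral; move: EL; rewrite unlock => ->.
have Rmgf t : \int[P]_w expR (t * L w) = expR (t * m + s ^+ 2 * t ^+ 2 / 2).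
  by rewrite /Rintegral mgf.
have pos t : 0 <= t * m + s ^+ 2 * t ^+ 2 / 2.
  have : \int[P]_w (1 + t * L w) <= \int[P]_w expR (t * L w).
    apply: le_Rintegral => //.
    + by apply: integrableRD => //; [exact: Pfin|exact: integrableRZ].
    + by move=> w _; exact: expR_ge1Dx.
  rewrite Rmgf RintegralD//; last 2 first.
  - exact: Pfin.
  - exact: integrableRZ.
  rewrite RintegralZl// E0 mulr0 addr0 Rintegral_prob_cst.
  by rewrite -[X in X <= _]expR0 ler_expR.
(* [pos] gives [t * m + s ^+ 2 * t ^+ 2 / 2 >= 0] for all [t]; small [t] of either sign leaves no
   room for a nonzero [m]. *)
have m0 : m = 0.
  have key (sg : R) : sg ^+ 2 = 1 -> 0 <= sg * m.
    move=> sg1; apply/ler_addgt0Pr => e e0.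
    have [t t0 [_ [_ hB]]] := @small_pos R 0 (s ^+ 2 / 2) e (lexx _) (divr_ge0 (sqr_ge0 _) (ler0n _ 2)) e0.
    have := pos (sg * t); rewrite exprMn sg1 mul1r => h.
    rewrite -(ler_pM2l t0) mulr0; apply: (le_trans h).
    have : t * (s ^+ 2 / 2 * t) <= t * e by rewrite ler_wpM2l// ltW.
    nra.
  have k1 := key 1 (expr1n _ 2).
  have k2 : 0 <= -1 * m by apply: key; rewrite sqrrN expr1n.
  by apply/eqP; rewrite eq_le; apply/andP; split; lra.
have Rcos t : \int[P]_w cos (t * L w) = expR (- (s ^+ 2 * t ^+ 2 / 2)).
  have mc : measurable_fun setT (fun x : R => cos (t * x)).
    apply: measurableT_comp; last exact: measurable_funM.
    by apply: continuous_measurable_fun; exact: continuous_cos.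
  have c0 (x : R) : 0 <= 1 + cos (t * x) by have := cos_geN1 (t * x); lra.
  have icos : P.-integrable setT (EFin \o (fun w => cos (t * L w))).
    apply: (@Pbounded _ 1) => //; first by apply: measurableT_comp mc mL.
    by move=> w; exact: cos_max.
  have h : (\int[P]_w (1 + cos (t * L w))%:E = (1 + expR (- (s ^+ 2 * t ^+ 2 / 2)))%:E)%E.
    rewrite (tr (fun x => (1 + cos (t * x))%:E)); last 2 first.
    - by apply/measurable_EFinP; exact: measurable_funD.
    - by move=> x; rewrite lee_fin.
    case: ifPn => [/eqP ->|s0]; first by rewrite m0 mulr0 cos0 expr0n/= mul0r mul0r oppr0 expR0.
    by rewrite m0; exact: integral_normal_1Dcos.
  have : \int[P]_w (1 + cos (t * L w)) = 1 + expR (- (s ^+ 2 * t ^+ 2 / 2)).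
    by rewrite /Rintegral h.
  rewrite RintegralD//; last exact: Pfin.
  by rewrite Rintegral_prob_cst => /addrI.
(* Upper bound: integrate [2 + t ^+ 2 * x ^+ 2 <= expR (t * x) + expR (- t * x)]. Lower bound:
   integrate [1 - t ^+ 2 * x ^+ 2 / 2 <= cos (t * x)]. Both inequalities are exact to second order
   in [t]. *)
have V : \int[P]_w (L w ^+ 2) = s ^+ 2.
  set V := (LHS); have s20 := sqr_ge0 s.
  have s40 : 0 <= s ^+ 2 * s ^+ 2 by rewrite mulr_ge0.
  apply/eqP; rewrite eq_le; apply/andP; split; apply/ler_addgt0Pr => e e0.
    have [t t0 [h1 [h2 _]]] := @small_pos R (s ^+ 2 / 2) (s ^+ 2 * s ^+ 2) e (divr_ge0 s20 (ler0n _
      2)) s40 e0.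
    have : \int[P]_w (2 + t ^+ 2 * L w ^+ 2) <= \int[P]_w (expR (t * L w) + expR (- t * L w)).
      apply: le_Rintegral => //.
      + by apply: integrableRD => //; [exact: Pfin|exact: integrableRZ].
      + exact: integrableRD.
      + by move=> w _; rewrite -exprMn mulNr; exact: expRDN_ge.
    rewrite [X in _ <= X]RintegralD// !Rmgf RintegralD//; try exact: Pfin; try exact: integrableRZ.
    rewrite RintegralZl// Rintegral_prob_cst m0 !mulr0 !add0r sqrrN -/V.
    have := @expR_le_quad R (s ^+ 2 * t ^+ 2 / 2).
    have t2 : 0 < t ^+ 2 by rewrite exprn_gt0.
    have y0 : 0 <= s ^+ 2 * t ^+ 2 / 2 by rewrite divr_ge0// mulr_ge0// ltW.
    have y1 : s ^+ 2 * t ^+ 2 / 2 <= 1 / 2 by lra.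
    rewrite y0 y1 => /(_ isT) h3 h4.
    rewrite -(ler_pM2l t2); move: h2 h3 h4 t2; set u := t ^+ 2; set E := expR _; nra.
  have [t t0 [_ [h2 _]]] := @small_pos R 0 (s ^+ 2 * s ^+ 2) e (lexx _) s40 e0.
  have : \int[P]_w (1 - (t ^+ 2 / 2) * L w ^+ 2) <= \int[P]_w (cos (t * L w)).
    apply: le_Rintegral => //.
    + by apply: integrableRB => //; [exact: Pfin|exact: integrableRZ].
    + apply: (@Pbounded _ 1) => //; last by move=> w; exact: cos_max.
      apply: measurableT_comp; last exact: measurable_funM.
      by apply: continuous_measurable_fun; exact: continuous_cos.
    + by move=> w _; have := cos_ge1B (t * L w); rewrite exprMn mulrAC.
  rewrite RintegralB//; try exact: Pfin; try exact: integrableRZ.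
  rewrite RintegralZl// Rintegral_prob_cst Rcos -/V.
  have t2 : 0 < t ^+ 2 by rewrite exprn_gt0.
  have := @expRN_le_quad R (s ^+ 2 * t ^+ 2 / 2) (divr_ge0 (mulr_ge0 s20 (ltW t2)) (ler0n _ 2)).
  move=> h3 h4.
  rewrite -(ler_pM2l t2); move: h2 h3 h4 t2; set u := t ^+ 2; set E := expR _; nra.
split => //; rewrite V.
- have := mgf 1; rewrite m0 mulr0 add0r expr1n mulr1.
  by under eq_integral do rewrite mul1r; move=> ->.
- by have := Rcos 1; rewrite expr1n mulr1 => <-; apply: eq_Rintegral => w _; rewrite mul1r.
Qed.

End gaussian_rv.

(** Below the level [B] the slope of the exponential is at most [B]. The truncation is a bounded
    Lipschitz function, so its mean passes to [L^2] limits. *)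
Lemma min_expR_lipschitz {R : realType} (B x y : R) : 0 < B ->
  `|Num.min (expR x) B - Num.min (expR y) B| <= B * `|x - y|.
Proof.
move=> B0; wlog xy : x y / x <= y.
  move=> h; have [/h//|/ltW/h] := leP x y.
  by rewrite distrC [`|y - x|]distrC.
have exy : expR x <= expR y by rewrite ler_expR.
have e1 : 1 - expR (x - y) <= y - x by have := expR_ge1Dx (x - y); lra.
rewrite [`|x - y|]distrC (ger0_norm (_ : 0 <= y - x)) ?subr_ge0//.
have mono : Num.min (expR x) B <= Num.min (expR y) B.
  by rewrite le_min ge_min exy/= ge_min lexx orbT.
rewrite distrC ger0_norm ?subr_ge0//.
have ex : expR x = expR y * expR (x - y) by rewrite -expRD addrC subrK.
have yx0 : 0 <= y - x by rewrite subr_ge0.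
have [Bx|xB] := leP B (expR x).
  by rewrite !min_r// ?(le_trans Bx exy)// subrr mulr_ge0// ltW.
have [yB|By] := leP (expR y) B.
  rewrite ex -{1}[expR y]mulr1 -mulrBr; apply: ler_pM => //; rewrite ?expR_ge0//.
  by rewrite subr_ge0 -expR0 ler_expR; lra.
apply: (@le_trans _ _ (B - B * expR (x - y))).
  by rewrite lerD2l lerN2 ex ler_wpM2r ?expR_ge0// ltW.
by rewrite -{1}[B]mulr1 -mulrBr ler_wpM2l// ltW.
Qed.

Lemma abs_sin_le {R : realType} (b : R) : `|sin b| <= `|b|.
Proof.
case: (ger0P b) => b0; first exact: abs_sin_le_natmul.
by rewrite -normrN -sinN abs_sin_le_natmul// oppr_ge0 ltW.
Qed.

Lemma cos_lipschitz {R : realType} (x y : R) : `|cos x - cos y| <= `|x - y|.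
Proof.
have key (a b : R) : `|cos (a + b) - cos (a - b)| <= `|a + b - (a - b)|.
  have -> : cos (a + b) - cos (a - b) = - (2 * (sin a * sin b)) by rewrite cosD cosB; ring.
  have -> : a + b - (a - b) = 2 * b by ring.
  rewrite normrN !normrM ler_wpM2l// -[leRHS]mul1r ler_pM ?sin_max//.
  exact: abs_sin_le.
have := key ((x + y) / 2) ((x - y) / 2).
have -> : (x + y) / 2 + (x - y) / 2 = x by field.
by have -> : (x + y) / 2 - (x - y) / 2 = y by field.
Qed.

(** * Mean-square limits of Gaussian variables *)

Section closure.
Context d {Omega : measurableType d} {R : realType} (P : probability Omega R).

Lemma integrable_abs_of_sqr (f : Omega -> R) : measurable_fun setT f ->
  P.-integrable setT (EFin \o (fun w => f w ^+ 2)) -> P.-integrable setT (EFin \o f).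
Proof.
move=> mf if2; apply: (@le_integrableR _ _ _ P _ measurableT _ (fun w => 1 + f w ^+ 2)) => //.
  move=> w _; rewrite -[f w ^+ 2]real_normK ?num_real//.
  by have := sqr_ge0 (`|f w| - 1); nra.
by apply: integrableRD => //; exact: Pfin.
Qed.

(** Means of bounded Lipschitz functions converge along [L_], and so do the variances. This settles
    the cosine; the exponential is truncated at [n + 1], the bound is passed to the limit in [k],
    and monotone convergence removes the truncation. *)
Lemma centered_gaussian_lim (L_ : nat -> Omega -> R) (L : Omega -> R) :
  (forall k, centered_gaussian P (L_ k)) -> measurable_fun setT L ->
  P.-integrable setT (EFin \o (fun w => L w ^+ 2)) ->
  (fun k => \int[P]_w ((L w - L_ k w) ^+ 2)) @ \oo --> (0 : R) ->
  centered_gaussian P L.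
Proof.
move=> gL mL iL2 e_0.
pose e k := \int[P]_w ((L w - L_ k w) ^+ 2).
have e0 k : 0 <= e k by apply: Rintegral_ge0 => w _; rewrite sqr_ge0.
have mLk k : measurable_fun setT (L_ k) by have [] := gL k.
have iLk2 k : P.-integrable setT (EFin \o (fun w => L_ k w ^+ 2)) by have [] := gL k.
have mD k : measurable_fun setT (fun w => L w - L_ k w) by exact: measurable_funB.
have iD2 k : P.-integrable setT (EFin \o (fun w => (L w - L_ k w) ^+ 2)).
  rewrite (_ : (fun w => _) = (fun w => (1 * L w + (-1) * L_ k w) ^+ 2)); last first.
    by apply/funext => w; rewrite mul1r mulN1r.
  exact: integrable_sqrD.
have iD k : P.-integrable setT (EFin \o (fun w => L w - L_ k w)) by exact: integrable_abs_of_sqr.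
have iaD k : P.-integrable setT (EFin \o (fun w => `|L w - L_ k w|)) by exact: integrable_norm (iD k).
have near_e (x : R) : 0 < x -> \forall k \near \oo, e k <= x.
  move=> x0; move/cvgrPdist_le : e_0 => /(_ _ x0).
  by apply: filterS => k; rewrite sub0r normrN; apply: le_trans; exact: ler_norm.
pose V := \int[P]_w (L w ^+ 2).
pose V_ k := \int[P]_w (L_ k w ^+ 2).
have V0 : 0 <= V by apply: Rintegral_ge0 => w _; rewrite sqr_ge0.
have L1 k (r : R) : 0 < r -> \int[P]_w `|L w - L_ k w| <= r / 2 + e k / (2 * r).
  move=> r0.
  apply: (@le_trans _ _ (\int[P]_w (r / 2 + (2 * r)^-1 * (L w - L_ k w) ^+ 2))).
    apply: le_Rintegral => //.
      by apply: integrableRD => //; [exact: Pfin|exact: integrableRZ].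
    move=> w _; rewrite -[(L w - L_ k w) ^+ 2]real_normK ?num_real//; set y := `|_|.
    rewrite -subr_ge0; have -> : r / 2 + (2 * r)^-1 * y ^+ 2 - y = (y - r) ^+ 2 / (2 * r).
      by field; rewrite gt_eqF.
    by rewrite divr_ge0 ?sqr_ge0// mulr_ge0// ltW.
  rewrite RintegralD//; try exact: Pfin; try exact: integrableRZ.
  by rewrite Rintegral_prob_cst RintegralZl// [_^-1 * _]mulrC.
(* From [|x ^+ 2 - y ^+ 2| <= r * x ^+ 2 + (r^-1 + 1) * (x - y) ^+ 2], a form of Young's inequality
   in which only the limit variable keeps a square of its own. *)
have VV k (r : R) : 0 < r -> `|V - V_ k| <= r * V + (r^-1 + 1) * e k.
  move=> r0; rewrite /V /V_ -RintegralB//.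
  apply: le_trans (le_normr_Rintegral _ _) _ => //; first exact: integrableRB.
  rewrite -!RintegralZl// -RintegralD//; try exact: integrableRZ.
  apply: le_Rintegral => //.
  - by apply: (@integrable_norm _ _ _ P _ (fun w => L w ^+ 2 - L_ k w ^+ 2)); exact: integrableRB.
  - by apply: integrableRD => //; exact: integrableRZ.
  move=> w _; set x := L w; set y := L_ k w.
  have h : 0 <= (r * x - (x - y)) ^+ 2 / r by rewrite divr_ge0 ?sqr_ge0// ltW.
  have h' : 0 <= (r * x + (x - y)) ^+ 2 / r by rewrite divr_ge0 ?sqr_ge0// ltW.
  have E1 : (r * x - (x - y)) ^+ 2 / r = r * x ^+ 2 - 2 * x * (x - y) + r^-1 * (x - y) ^+ 2.
    by field; rewrite gt_eqF.
  have E2 : (r * x + (x - y)) ^+ 2 / r = r * x ^+ 2 + 2 * x * (x - y) + r^-1 * (x - y) ^+ 2.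
    by field; rewrite gt_eqF.
  have := sqr_ge0 (x - y).
  rewrite E1 in h; rewrite E2 in h'; rewrite ler_norml => h3.
  move: h h'; set q := r^-1 * (x - y) ^+ 2; set q2 := r * x ^+ 2 => h h'.
  have -> : (r^-1 + 1) * (x - y) ^+ 2 = q + (x - y) ^+ 2 by rewrite mulrDl mul1r.
  by apply/andP; split; nra.
have Vlim : V_ @ \oo --> V.
  apply/cvgrPdist_le => ep ep0.
  pose r := ep / (2 * (V + 1)).
  have r0 : 0 < r by rewrite divr_gt0// mulr_gt0// ltr_wpDl.
  have ri0 : 0 < r^-1 + 1 by rewrite addr_gt0// invr_gt0.
  near=> k; apply: le_trans (VV k r r0) _.
  have h1 : r * V <= ep / 2.
    rewrite /r invfM mulrA mulrAC ler_pdivrMr ?ltr_wpDl//.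
    by rewrite ler_wpM2l ?lerDl// divr_ge0// ltW.
  have h2 : (r^-1 + 1) * e k <= ep / 2.
    rewrite mulrC -ler_pdivlMr//; near: k; apply: near_e.
    by rewrite !divr_gt0.
  lra.
have L1lim : (fun k => \int[P]_w `|L w - L_ k w|) @ \oo --> (0 : R).
  apply/cvgrPdist_le => ep ep0; near=> k.
  rewrite sub0r normrN ger0_norm; last by apply: Rintegral_ge0.
  apply: le_trans (L1 k ep ep0) _.
  have : e k / (2 * ep) <= ep / 2.
    rewrite ler_pdivrMr ?mulr_gt0//; near: k; apply: near_e.
    by rewrite mulr_gt0 ?divr_gt0// mulr_gt0.
  lra.
have lip (f : R -> R) (B : R) : 0 <= B -> measurable_fun setT f ->
    (forall x y, `|f x - f y| <= B * `|x - y|) ->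
    (forall g : Omega -> R, measurable_fun setT g -> P.-integrable setT (EFin \o (f \o g))) ->
    (fun k => \int[P]_w f (L_ k w)) @ \oo --> \int[P]_w f (L w).
  move=> B0 mf fl fi; apply/cvgrPdist_le => ep ep0.
  have ib : 0 < ep / (B + 1) by rewrite divr_gt0// ltr_wpDl.
  move/cvgrPdist_le : L1lim => /(_ _ ib); apply: filterS => k.
  rewrite sub0r normrN ger0_norm; last by apply: Rintegral_ge0.
  rewrite ler_pdivlMr ?ltr_wpDl// => h.
  have i1 := fi _ mL; have i2 := fi _ (mLk k).
  rewrite -RintegralB//; apply: le_trans (le_normr_Rintegral _ _) _ => //; first exact: integrableRB i1 i2.
  apply: (@le_trans _ _ (\int[P]_w (B * `|L w - L_ k w|))).
    apply: le_Rintegral => //.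
    - by apply: (@integrable_norm _ _ _ P _ (fun w => f (L w) - f (L_ k w))); exact: integrableRB.
    - exact: integrableRZ.
  rewrite RintegralZl//; apply: le_trans h; rewrite mulrC ler_wpM2l ?lerDl//.
  exact: Rintegral_ge0.
have expcont : (fun k => expR (V_ k / 2)) @ \oo --> expR (V / 2).
  by apply: continuous_cvg; [exact: continuous_expR|apply: cvgM => //; exact: cvg_cst].
split => //.
- have hB (n : nat) : (\int[P]_w (Num.min (expR (L w)) n.+1%:R)%:E <= (expR (V / 2))%:E)%E.
    have n0 : 0 < n.+1%:R :> R by [].
    have mm : measurable_fun setT (fun x : R => Num.min (expR x) n.+1%:R) by exact: measurable_minr.
    have im (g : Omega -> R) : measurable_fun setT g ->
        P.-integrable setT (EFin \o (fun w => Num.min (expR (g w)) n.+1%:R)).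
      move=> mg; apply: (@Pbounded _ _ _ P _ n.+1%:R); first exact: (measurableT_comp mm mg).
      by move=> w; rewrite ger0_norm ?ge_min ?lexx ?orbT// le_min expR_ge0/=.
    have hl := lip _ _ (ltW n0) mm (fun x y => min_expR_lipschitz x y n0) im.
    rewrite -[leLHS]fineK; last by apply: integrable_fin_num => //; exact: im.
    rewrite lee_fin; apply: ler_cvg_to hl expcont _.
    near=> k; have [_ _ hk _] := gL k.
    rewrite -lee_fin fineK; last by apply: integrable_fin_num => //; exact: im.
    apply: le_trans hk; apply: ge0_le_integral => //.
    + by have /integrableP[] := im _ (mLk k).
    + by apply/measurable_EFinP; apply: measurableT_comp.
    + by move=> w _; rewrite lee_fin ge_min lexx.
  pose g n w := (Num.min (expR (L w)) n.+1%:R)%:E.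
  have mg n : measurable_fun setT (g n).
    by apply/measurable_EFinP; apply: measurable_minr => //; exact: measurableT_comp.
  have g0 n w : setT w -> (0 <= g n w)%E by rewrite lee_fin le_min expR_ge0/=.
  have ndg w : setT w -> {homo g^~ w : n m / (n <= m)%N >-> (n <= m)%E}.
    by move=> _ m n mn; rewrite lee_fin le_min ge_min lexx/= ge_min ler_nat ltnS mn orbT.
  have gE w : (expR (L w))%:E = limn (g^~ w).
    apply/esym/cvg_lim => //; apply: cvg_near_cst; near=> n.
    rewrite /g min_l//; apply: le_trans (_ : n%:R <= _); last by rewrite ler_nat.
    by near: n; exact: nbhs_infty_ger.
  under eq_integral do rewrite gE.
  rewrite monotone_convergence//; apply: lime_le.
    apply: ereal_nondecreasing_is_cvgn => m n mn; apply: ge0_le_integral => // w ?; [exact: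
      g0|exact: (ndg w)].
  by apply: nearW => n; exact: hB.
- have mc : measurable_fun setT (@cos R) by apply: continuous_measurable_fun; exact: continuous_cos.
  have cl (x y : R) : `|cos x - cos y| <= 1 * `|x - y|.
    by rewrite mul1r cos_lipschitz.
  have ic (g : Omega -> R) : measurable_fun setT g -> P.-integrable setT (EFin \o (cos \o g)).
    move=> mg; apply: (@Pbounded _ _ _ P _ 1); first exact: (measurableT_comp mc mg).
    by move=> w; exact: cos_max.
  have hl := lip cos 1 ler01 mc cl ic.
  have hr : (fun k => \int[P]_w cos (L_ k w)) @ \oo --> expR (- (V / 2)).
    have E k : \int[P]_w cos (L_ k w) = expR (- (V_ k / 2)) by have [] := gL k.
    under eq_cvg do rewrite E.
    apply: continuous_cvg; first exact: continuous_expR.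
    by apply: cvgN; apply: cvgM => //; exact: cvg_cst.
  exact: (cvg_unique _ hl hr).
Unshelve. all: by end_near.
Qed.

End closure.

(** * Squared norms of Gaussian vectors *)

Section real_spectral.
Context {R : realType}.

Definition rvdot n (u w : 'rV[R]_n) : R := (u *m w^T) 0 0.

Lemma rvdotE n (u w : 'rV[R]_n) : rvdot u w = \sum_k u 0 k * w 0 k.
Proof. by rewrite /rvdot mxE; apply: eq_bigr => k _; rewrite mxE. Qed.

Lemma rvdotC n (u w : 'rV[R]_n) : rvdot u w = rvdot w u.
Proof. by rewrite !rvdotE; apply: eq_bigr => k _; rewrite mulrC. Qed.

Lemma rvdotDl n (a b : R) (u v w : 'rV[R]_n) :
  rvdot (a *: u + b *: v) w = a * rvdot u w + b * rvdot v w.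
Proof.
rewrite !rvdotE !mulr_sumr -big_split/=; apply: eq_bigr => k _.
by rewrite !mxE; ring.
Qed.

Lemma rvdot_ge0 n (u : 'rV[R]_n) : 0 <= rvdot u u.
Proof. by rewrite rvdotE; apply: sumr_ge0 => k _; rewrite -expr2 sqr_ge0. Qed.

Lemma rvdot0 n (u : 'rV[R]_n) : rvdot u u = 0 -> u = 0.
Proof.
rewrite rvdotE => /eqP; rewrite psumr_eq0; last by move=> k _; rewrite -expr2 sqr_ge0.
move=> /allP h; apply/rowP => j; have := h j (mem_index_enum _).
by rewrite mulf_eq0 orbb mxE => /eqP.
Qed.

(** Take a complex eigenvector [x + i y] with eigenvalue [al + i be]. Symmetry of [A] gives
    [be * (|x|^2 + |y|^2) = 0], so the eigenvalue is real and whichever of [x], [y] is nonzero is an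
    eigenvector. *)
Lemma real_sym_eigenvector n (A : 'M[R]_n.+1) : A^T = A ->
  exists (al : R) (v : 'rV[R]_n.+1), v != 0 /\ v *m A = al *: v.
Proof.
move=> sA; pose Ac := map_mx (real_complex R) A.
have [a /eigenvalueP[v vA v0]] := @eigenvalue_closed _ _ Ac (ltn0Sn n).
pose x : 'rV[R]_n.+1 := \row_j complex.Re (v 0 j).
pose y : 'rV[R]_n.+1 := \row_j complex.Im (v 0 j).
have cE j : v 0 j = (x 0 j +i* y 0 j)%C by rewrite !mxE; case: (v 0 j).
have sumE (f g : 'I_n.+1 -> R) : \sum_k (f k +i* g k)%C = ((\sum_k f k) +i* (\sum_k g k))%C.
  elim/big_rec3: _ => // k b c e _ ->; by [].
have E j : ((x *m A) 0 j +i* (y *m A) 0 j)%C = a * (x 0 j +i* y 0 j)%C.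
  have /rowP/(_ j) := vA; rewrite [RHS]mxE cE => <-.
  rewrite !mxE -sumE; apply: eq_bigr => k _.
  by rewrite [Ac _ _]mxE cE; rewrite /GRing.mul/= /real_complex_def /= ?mulr0 ?subr0 ?add0r; congr
    (_ +i* _)%C; ring.
case: a vA E => al be vA E.
have xA : x *m A = al *: x - be *: y.
  apply/rowP => j; have := E j; rewrite [X in _ = X]/GRing.mul/= => -[-> _].
  by rewrite !mxE.
have yA : y *m A = al *: y + be *: x.
  apply/rowP => j; have := E j; rewrite [X in _ = X]/GRing.mul/= => -[_ ->].
  by rewrite !mxE.
have be0 : be = 0.
  have : rvdot (x *m A) y = rvdot (y *m A) x.
    by rewrite [RHS]rvdotC /rvdot trmx_mul sA mulmxA.
  have -> : x *m A = al *: x + (- be) *: y by rewrite xA scaleNr.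
  rewrite yA !rvdotDl (rvdotC y x) => h.
  have {}h : be * (rvdot x x + rvdot y y) = 0 by move: h; set p := rvdot x y; lra.
  apply/eqP; move/eqP: h; rewrite mulf_eq0 => /orP[//|].
  rewrite paddr_eq0 ?rvdot_ge0// => /andP[/eqP/rvdot0 x0 /eqP/rvdot0 y0].
  case/negP: v0; apply/eqP/rowP => j; rewrite cE x0 y0 !mxE//.
rewrite be0 scale0r subr0 in xA; rewrite be0 scale0r addr0 in yA.
have [x0|x0] := eqVneq x 0; last by exists al, x.
exists al, y; split => //; apply/eqP => y0.
by case/negP: v0; apply/eqP/rowP => j; rewrite cE x0 y0 !mxE.
Qed.

(* A Householder reflection. *)
Lemma orthogonal_with_row n (v : 'rV[R]_n.+1) : v *m v^T = 1%:M ->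
  exists Q : 'M[R]_n.+1, Q *m Q^T = 1%:M /\ row 0 Q = v.
Proof.
move=> v1; pose e : 'rV[R]_n.+1 := delta_mx 0 0.
have [ve|ve] := eqVneq v e.
  exists 1%:M; rewrite trmx1 mulmx1; split => //.
  by rewrite ve row1.
pose w := v - e; pose q := (w *m w^T) 0 0.
have wq : w *m w^T = q%:M by rewrite [LHS]mx11_scalar.
have e1 : e *m e^T = 1%:M.
  by apply/matrixP => i j; rewrite !ord1 !mxE (bigD1 0)//= big1 ?addr0 ?mxE ?eqxx ?mulr1// => k k0;
    rewrite !mxE (negbTE k0) andbF mul0r.
have ev : e *m v^T = (v 0 0)%:M.
  by apply/matrixP => i j; rewrite !ord1 !mxE (bigD1 0)//= big1 ?addr0 ?mxE ?eqxx ?mul1r ?mulr1n//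
    => k k0; rewrite !mxE (negbTE k0) andbF mul0r.
have vE : v *m e^T = (v 0 0)%:M by rewrite -[LHS]trmxK trmx_mul trmxK ev tr_scalar_mx.
have qE : q = 2 - 2 * v 0 0.
  rewrite /q /w linearB/= mulmxBl !mulmxBr v1 e1 ev vE !mxE eqxx !mulr1n; ring.
have q0 : q != 0.
  by apply/eqP => /rvdot0/eqP; rewrite subr_eq0 (negbTE ve).
pose H := 1%:M - (2 / q) *: (w^T *m w).
have HT : H^T = H by rewrite /H linearB/= trmx1 linearZ/= trmx_mul trmxK.
exists H; split.
  pose N := w^T *m w.
  have NN : N *m N = q *: N.
    by rewrite /N mulmxA -[w^T *m w *m w^T]mulmxA wq mul_mx_scalar -scalemxAl.
  rewrite HT /H -/N mulmxBl !mulmxBr mul1mx mulmx1 mul1mx -scalemxAl -scalemxAr NN !scalerA.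
  have -> : 2 / q * (2 / q) * q = 2 / q + 2 / q by field.
  by rewrite scalerDl opprB addrK subrK.
rewrite rowE -/e /H mulmxBr mulmx1 -scalemxAr mulmxA.
have -> : e *m w^T = (v 0 0 - 1)%:M.
  by rewrite /w linearB/= mulmxBr ev e1 -raddfB.
rewrite mul_scalar_mx scalerA.
have -> : 2 / q * (v 0 0 - 1) = -1.
  by move/eqP: q0 => q0; rewrite qE; field; rewrite -qE; apply/eqP.
by rewrite scaleN1r opprK /w addrC subrK.
Qed.

Lemma block_diag_mx n (b : R) (d : 'rV[R]_n) (M : 'M[R]_1) : M = b%:M ->
  block_mx M 0 0 (diag_mx d) = diag_mx (row_mx (@const_mx R 1 1 b) d : 'rV[R]_(1 + n)).
Proof.
move=> ->; apply/matrixP => i j; rewrite -(splitK i) -(splitK j).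
case: (fintype.split i) => i'; case: (fintype.split j) => j' /=;
  rewrite ?(block_mxEul, block_mxEur, block_mxEdl, block_mxEdr).
- by rewrite [LHS]mxE [RHS]mxE row_mxEl mxE !ord1 !eqxx.
- by rewrite [LHS]mxE [RHS]mxE eq_lrshift mulr0n.
- by rewrite [LHS]mxE [RHS]mxE eq_rlshift mulr0n.
- by rewrite [LHS]mxE [RHS]mxE row_mxEr eq_rshift.
Qed.

(** Deflation: in an orthonormal basis starting with a unit eigenvector the matrix is block
    diagonal, symmetry clearing the first column as well as the first row; the induction hypothesis
    treats the remaining block. *)
Lemma real_spectral n (A : 'M[R]_n) : A^T = A ->
  exists (U : 'M[R]_n) (d : 'rV[R]_n), U *m U^T = 1%:M /\ U *m A *m U^T = diag_mx d.
Proof.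
elim: n A => [|n IH] A sA.
  by exists 1%:M, 0; split; apply/matrixP => -[].
have [al [v [v0 vA]]] := real_sym_eigenvector sA.
pose q := (v *m v^T) 0 0.
have q0 : 0 < q.
  rewrite lt_neqAle rvdot_ge0 andbT eq_sym; apply/eqP => /rvdot0/eqP.
  by rewrite (negbTE v0).
pose v1 := (Num.sqrt q)^-1 *: v.
have v11 : v1 *m v1^T = 1%:M.
  rewrite /v1 linearZ/= -scalemxAl -scalemxAr scalerA -invfM -expr2 sqr_sqrtr ?(ltW q0)//.
  by rewrite [v *m _]mx11_scalar -/q scale_scalar_mx mulVf// gt_eqF.
have v1A : v1 *m A = al *: v1 by rewrite /v1 -scalemxAl vA !scalerA mulrC.
have [Q [QQ rQ]] := orthogonal_with_row v11.
have QQ' : Q^T *m Q = 1%:M by exact: mulmx1C.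
have [B hB] : exists B : 'M[R]_(1 + n), B = Q *m A *m Q^T by eexists.
have sB : B^T = B by rewrite hB !trmx_mul trmxK sA mulmxA.
have rB : row 0 B = al *: delta_mx 0 0.
  rewrite hB -mulmxA row_mul rQ mulmxA v1A -scalemxAl -rQ -row_mul QQ row1//.
have Bur : ursubmx B = 0.
  apply/matrixP => i j; rewrite !ord1 !mxE.
  have /rowP/(_ (rshift 1 j)) := rB; rewrite !mxE/= mulr0 => <-.
  congr (B _ _); exact: val_inj.
have Bdl : dlsubmx B = 0 by rewrite -[LHS]trmxK -[dlsubmx B]/(dlsubmx B) trmx_dlsub sB Bur trmx0.
have Bblock : B = block_mx (ulsubmx B) 0 0 (drsubmx B) by rewrite -[LHS]submxK Bur Bdl.
have sBd : (drsubmx B)^T = drsubmx B by rewrite trmx_drsub sB.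
have [U [d [UU Ud]]] := IH _ sBd.
have [b hb] : exists b, b = B 0 0 by exists (B 0 0).
pose V : 'M[R]_(1 + n) := block_mx 1%:M 0 0 U.
have VV : V *m V^T = 1%:M.
  by rewrite /V tr_block_mx !trmx0 trmx1 mulmx_block !mulmx0 !mul0mx !addr0 !add0r mul1mx UU -scalar_mx_block.
exists (V *m Q : 'M[R]_n.+1), (row_mx (@const_mx R 1 1 b) d : 'rV[R]_(1 + n)); split.
  by rewrite trmx_mul mulmxA -[V *m Q *m Q^T]mulmxA QQ mulmx1 VV.
have -> : V *m Q *m A *m (V *m Q)^T = V *m B *m V^T.
  by rewrite trmx_mul hB !mulmxA.
rewrite Bblock /V tr_block_mx !trmx0 trmx1 !mulmx_block !mulmx0 !mul0mx !addr0 !add0r mul1mx mulmx1 Ud.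
rewrite !mul0mx; apply: block_diag_mx.
by apply/matrixP => i j; rewrite !ord1 !mxE eqxx mulr1n hb; congr (B _ _); exact: val_inj.
Qed.

End real_spectral.

(** * Chernoff bounds for weighted chi-square sums *)

Section real_ineq.
Context {R : realType}.

(** A second-order bound for [- ln (1 - x) / 2]. After squaring, [1 + y <= expR y] reduces it to the
    polynomial inequality [(1 + y) ^+ 2 * (1 - x) >= 1], true on [[0, 1 / 4]]. *)
Lemma invsqrt_1B_le_expR (x : R) : 0 <= x <= 1 / 4 ->
  (Num.sqrt (1 - x))^-1 <= expR (x / 2 + x ^+ 2 / 2).
Proof.
move=> /andP[x0 x1]; have p : 0 < 1 - x by lra.
rewrite -sqrtrV; last exact: ltW.
rewrite -(@ger0_norm _ (expR _)) ?expR_ge0// -sqrtr_sqr ler_wsqrtr//.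
rewrite -[leLHS]mul1r ler_pdivrMr//.
set y := x / 2 + x ^+ 2 / 2.
have h : (1 + y) ^+ 2 <= expR y ^+ 2.
  have y0 : 0 <= y by rewrite /y addr_ge0// divr_ge0// sqr_ge0.
  by rewrite lerXn2r ?nnegrE ?expR_ge0 ?expR_ge1Dx// addr_ge0.
have : (1 + y) ^+ 2 * (1 - x) <= expR y ^+ 2 * (1 - x) by rewrite ler_wpM2r// ltW.
apply: le_trans.
have h1 : 0 <= x ^+ 2 * ((1 + x) ^+ 2 * (1 - x) - 4 * x).
  rewrite mulr_ge0 ?sqr_ge0//.
  have : 0 <= x * (1 - x - x ^+ 2).
    rewrite mulr_ge0//; have : x * x <= 1 / 4 * 1 by rewrite ler_pM//; lra.
    by rewrite expr2; lra.
  rewrite !expr2; nra.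
rewrite -subr_ge0; have -> : (1 + y) ^+ 2 * (1 - x) - 1 =
   x ^+ 2 * ((1 + x) ^+ 2 * (1 - x) - 4 * x) / 4 by rewrite /y; field.
by rewrite divr_ge0.
Qed.

(** After squaring, use [1 + z <= expR z] at [z = - x + x ^+ 2] and
    [(1 - x + x ^+ 2) * (1 + x) = 1 + x ^+ 3]. *)
Lemma invsqrt_1D_le_expR (x : R) : 0 <= x ->
  (Num.sqrt (1 + x))^-1 <= expR (- x / 2 + x ^+ 2 / 2).
Proof.
move=> x0; have p : 0 < 1 + x by lra.
rewrite -sqrtrV; last exact: ltW.
rewrite -(@ger0_norm _ (expR _)) ?expR_ge0// -sqrtr_sqr ler_wsqrtr// -expRM_natl.
have -> : 2%:R * (- x / 2 + x ^+ 2 / 2) = - x + x ^+ 2 by field.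
rewrite -[leLHS]mul1r ler_pdivrMr//.
have h := expR_ge1Dx (- x + x ^+ 2).
have : (1 + (- x + x ^+ 2)) * (1 + x) <= expR (- x + x ^+ 2) * (1 + x).
  by rewrite ler_wpM2r// ltW.
have : 0 <= x ^+ 3 by rewrite exprn_ge0.
set E := expR _; nra.
Qed.

End real_ineq.

Lemma Rintegral_normal_prob_cos (R : realType) (s t : R) : s != 0 ->
  \int[normal_prob 0 s]_x cos (t * x) = expR (- (s ^+ 2 * t ^+ 2 / 2)).
Proof.
move=> s0; have : \int[normal_prob 0 s]_x (1 + cos (t * x)) = 1 + expR (- (s ^+ 2 * t ^+ 2 / 2)).
  by rewrite /Rintegral integral_normal_1Dcos.
rewrite RintegralD//.
- by rewrite Rintegral_prob_cst => /addrI.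
- exact: Pfin.
apply: (@Pbounded _ _ _ (normal_prob 0 s) _ 1); last by move=> w; exact: cos_max.
apply: measurableT_comp; last exact: measurable_funM.
by apply: continuous_measurable_fun; exact: continuous_cos.
Qed.

Section laplace_chi2.
Context d {Omega : measurableType d} {R : realType} (P : probability Omega R).
Variables (n : nat) (Z : 'I_n -> Omega -> R) (D : 'I_n -> R).
Hypothesis D0 : forall i, 0 <= D i.
Let L (c : 'I_n -> R) w := \sum_i c i * Z i w.
Hypothesis gZ : forall c, centered_gaussian P (L c).
Hypothesis vZ : forall c, \int[P]_w (L c w ^+ 2) = \sum_i D i * c i ^+ 2.
Let S (r : seq 'I_n) w := \sum_(i <- r) Z i w ^+ 2.
Let N01 := normal_prob (0 : R) 1.

Let mL c : measurable_fun setT (L c). Proof. by have [] := gZ c. Qed.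

(** Adding [g] to the coefficient of index [j] is how a linearized square of [Z j] is absorbed into
    the linear form. *)
Let shift (c : 'I_n -> R) j (g : R) : 'I_n -> R := fun i => c i + g *+ (i == j).

Let L_shift c j g w : L (shift c j g) w = L c w + g * Z j w.
Proof.
rewrite /L /shift; under eq_bigr do rewrite mulrDl.
rewrite big_split/=; congr (_ + _).
rewrite (bigD1 j)//= eqxx mulr1n big1 ?addr0// => i /negbTE ->.
by rewrite mulr0n mul0r.
Qed.

Let V_shift c j g : c j = 0 ->
  \sum_i D i * shift c j g i ^+ 2 = \sum_i D i * c i ^+ 2 + D j * g ^+ 2.
Proof.
move=> cj; rewrite /shift (bigD1 j)//= [in RHS](bigD1 j)//= cj eqxx mulr1n expr0n mulr0 !add0r.
rewrite addrC; congr (_ + _); apply: eq_bigr => i /negbTE ->.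
by rewrite mulr0n addr0.
Qed.

Let mZ i : measurable_fun setT (Z i).
Proof.
have : measurable_fun setT (L (shift (fun=> 0) i 1)) by [].
apply: eq_measurable_fun => w _; rewrite L_shift mul1r /L big1 ?add0r// => k _.
by rewrite mul0r.
Qed.

Let mS r : measurable_fun setT (S r).
Proof. by apply: measurable_sum => i; exact: measurable_funX. Qed.

(* [expR (s * z ^+ 2)] is the mean of [expR (Num.sqrt (2 * s) * z * g)] over a standard
   normal [g], which linearizes the squares one coordinate at a time. *)
Lemma expR_chi2_le (s : R) (r : seq 'I_n) c : 0 <= s ->
  (forall i, 2 * s * D i < 1) -> uniq r -> (forall i, i \in r -> c i = 0) ->
  (\int[P]_w (expR (L c w + s * S r w))%:E <=
   (expR ((\sum_i D i * c i ^+ 2) / 2) * \prod_(i <- r) (Num.sqrt (1 - 2 * s * D i))^-1)%:E)%E.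
Proof.
move=> s0 sD; elim: r c => [|j r IH] c.
  move=> _ _; rewrite big_nil mulr1; have [_ _ h _] := gZ c.
  rewrite -vZ (eq_integral (fun w => (expR (L c w))%:E)) => [//|w _].
  by rewrite /S big_nil mulr0 addr0.
rewrite cons_uniq => /andP[jr ur] c0.
have cj : c j = 0 by rewrite c0// mem_head.
set q := Num.sqrt (2 * s).
have qq : q ^+ 2 = 2 * s by rewrite sqr_sqrtr// mulr_ge0.
have mf : measurable_fun setT (fun z : Omega * measurableTypeR R =>
    (expR (L (shift c j (q * z.2)) z.1 + s * S r z.1))%:E).
  apply/measurable_EFinP; apply: measurableT_comp => //.
  under eq_fun do rewrite L_shift.
  apply: measurable_funD.
    apply: measurable_funD; first exact: measurableT_comp (mL c) measurable_fst.
    apply: measurable_funM; last exact: measurableT_comp (mZ j) measurable_fst.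
    by apply: measurable_funM => //; exact: measurable_snd.
  by apply: measurable_funM => //; exact: measurableT_comp (mS r) measurable_fst.
have -> : (\int[P]_w (expR (L c w + s * S (j :: r) w))%:E =
    \int[P]_w \int[N01]_g (expR (L (shift c j (q * g)) w + s * S r w))%:E)%E.
  apply: eq_integral => w _.
  transitivity (\int[N01]_g ((expR (L c w + s * S r w))%:E * (expR (q * Z j w * g))%:E))%E.
    rewrite ge0_integralZl_EFin ?expR_ge0//; last first.
      by apply/measurable_EFinP; apply: measurableT_comp => //; exact: measurable_funM.
    rewrite integral_normal_expR ?oner_eq0// -EFinM -expRD /S big_cons.
    by congr (expR _)%:E; rewrite mulr0 expr1n mul1r exprMn qq; field.
  apply: eq_integral => g _; rewrite -EFinM -expRD L_shift.
  by congr (expR _)%:E; ring.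
(* With [g] outermost, the induction hypothesis applies to the coefficients shifted by [q * g] at
   [j]; this multiplies the bound by [expR (s * D j * g ^+ 2)], whose Gaussian mean is the next
   factor of the product. *)
rewrite (@fubini_tonelli _ _ _ _ _ P N01 _ mf)/=; last first.
  by move=> z; rewrite lee_fin expR_ge0.
pose B := expR ((\sum_i D i * c i ^+ 2) / 2) * \prod_(i <- r) (Num.sqrt (1 - 2 * s * D i))^-1.
have B0 : 0 <= B.
  by rewrite mulr_ge0 ?expR_ge0// prodr_ge0// => i _; rewrite invr_ge0 sqrtr_ge0.
apply: (@le_trans _ _ (\int[N01]_g (B%:E * (expR (s * D j * g ^+ 2))%:E))%E).
  apply: ge0_le_integral => //.
  - by move=> g _; apply: integral_ge0 => w _; rewrite lee_fin expR_ge0.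
  - have := @measurable_fun_fubini_tonelli_G _ _ _ _ _ P _ mf.
    by apply => z; rewrite lee_fin expR_ge0.
  - apply/measurable_EFinP; apply: measurable_funM => //; apply: measurableT_comp => //.
    by apply: measurable_funM => //; exact: measurable_funX.
  move=> g _; apply: le_trans (IH _ ur _) _.
    move=> i ir; rewrite /shift c0 ?inE ?ir ?orbT// add0r.
    by case: eqP => // ij; rewrite -ij ir in jr.
  rewrite -EFinM lee_fin V_shift// /B [leRHS]mulrAC -expRD exprMn qq.
  by rewrite le_eqVlt; apply/orP; left; apply/eqP; congr (expR _ * _); field.
rewrite ge0_integralZl_EFin//; last first.
  apply/measurable_EFinP; apply: measurableT_comp => //.
  by apply: measurable_funM => //; exact: measurable_funX.
rewrite integral_normal_expR_sqr; last by have := sD j; lra.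
by rewrite big_cons -EFinM lee_fin /B (mulrA 2) mulrAC mulrA.
Qed.

(* Likewise [expR (- (s * z ^+ 2))] is the mean of [cos (Num.sqrt (2 * s) * z * g)]. *)
Lemma expRN_chi2 (s : R) (r : seq 'I_n) c : 0 <= s ->
  uniq r -> (forall i, i \in r -> c i = 0) ->
  \int[P]_w (cos (L c w) * expR (- (s * S r w))) =
   expR (- ((\sum_i D i * c i ^+ 2) / 2)) * \prod_(i <- r) (Num.sqrt (1 + 2 * s * D i))^-1.
Proof.
move=> s0; elim: r c => [|j r IH] c.
  move=> _ _; rewrite big_nil mulr1; have [_ _ _ h] := gZ c.
  rewrite -vZ -h; apply: eq_Rintegral => w _.
  by rewrite /S big_nil mulr0 oppr0 expR0 mulr1.
rewrite cons_uniq => /andP[jr ur] c0.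
have cj : c j = 0 by rewrite c0// mem_head.
set q := Num.sqrt (2 * s).
have qq : q ^+ 2 = 2 * s by rewrite sqr_sqrtr// mulr_ge0.
have mcos : measurable_fun setT (@cos R).
  by apply: continuous_measurable_fun; exact: continuous_cos.
have S0 w : 0 <= S r w by apply: sumr_ge0 => i _; exact: sqr_ge0.
have eS w : `|expR (- (s * S r w))| <= 1.
  rewrite ger0_norm ?expR_ge0// -expR0 ler_expR oppr_le0 mulr_ge0//.
have mE : measurable_fun setT (fun w => expR (- (s * S r w))).
  by apply: measurableT_comp => //; apply: measurableT_comp => //; exact: measurable_funM.
pose f (z : Omega * measurableTypeR R) :=
  cos (L c z.1) * expR (- (s * S r z.1)) * cos (q * Z j z.1 * z.2).
have mf : measurable_fun setT f.
  apply: measurable_funM.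
    apply: measurable_funM; last exact: (measurableT_comp mE measurable_fst).
    by apply: measurableT_comp mcos _; exact: measurableT_comp (mL c) measurable_fst.
  apply: measurableT_comp mcos _; apply: measurable_funM; last exact: measurable_snd.
  by apply: measurable_funM => //; exact: measurableT_comp (mZ j) measurable_fst.
have fB z : `|f z| <= 1.
  rewrite /f !normrM -[leRHS]mulr1; apply: ler_pM => //; last exact: cos_max.
  by rewrite -[leRHS]mulr1; apply: ler_pM => //; exact: cos_max.
transitivity (\int[P]_w \int[N01]_g f (w, g)).
  apply: eq_Rintegral => w _; rewrite /f/= RintegralZl//; last first.
    apply: (@Pbounded _ _ _ N01 _ 1); last by move=> g; exact: cos_max.
    by apply: measurableT_comp mcos _; exact: measurable_funM.
  rewrite Rintegral_normal_prob_cos ?oner_eq0//.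
  rewrite -mulrA -expRD /S big_cons; congr (_ * expR _).
  by rewrite expr1n mul1r exprMn qq; field.
rewrite (Rfubini_bounded P N01 mf fB).
pose B := expR (- ((\sum_i D i * c i ^+ 2) / 2)) * \prod_(i <- r) (Num.sqrt (1 + 2 * s * D i))^-1.
have cosP g : \int[P]_w (cos (L (shift c j g) w) * expR (- (s * S r w))) =
    B * expR (- (D j * g ^+ 2 / 2)).
  rewrite IH//; last first.
    move=> i ir; rewrite /shift c0 ?inE ?ir ?orbT// add0r.
    by case: eqP => // ij; rewrite -ij ir in jr.
  by rewrite V_shift// /B [RHS]mulrAC -expRD; congr (expR _ * _); field.
have icos g : P.-integrable setT (EFin \o (fun w => cos (L (shift c j g) w) * expR (- (s * S r w)))).
  apply: (@Pbounded _ _ _ P _ 1).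
    by apply: measurable_funM => //; exact: measurableT_comp.
  by move=> w; rewrite normrM -[leRHS]mulr1; apply: ler_pM => //; exact: cos_max.
transitivity (\int[N01]_g (B * expR (- s * D j * g ^+ 2))).
  apply: eq_Rintegral => g _.
  (* Product-to-sum formula; the shifts by [q * g] and by its opposite have the same mean, as the
     variance is even in the shift. *)
  transitivity (\int[P]_w (2^-1 * (cos (L (shift c j (q * g)) w) * expR (- (s * S r w)) +
      cos (L (shift c j (- (q * g))) w) * expR (- (s * S r w))))).
    apply: eq_Rintegral => w _; rewrite /f/= !L_shift cosD.
    rewrite mulNr cosB (_ : q * Z j w * g = q * g * Z j w); last by ring.
    by field.
  rewrite RintegralZl//; last exact: integrableRD.
  rewrite RintegralD// !cosP sqrrN exprMn qq.
  rewrite (_ : - (D j * (2 * s * g ^+ 2) / 2) = - s * D j * g ^+ 2); last by field.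
  by field.
have t0 : - s * D j < 1 / 2 by rewrite mulNr; apply: (@le_lt_trans _ _ 0); [rewrite oppr_le0 mulr_ge0|].
have mexp : measurable_fun setT (fun g : R => expR (- s * D j * g ^+ 2)).
  apply: measurableT_comp => //.
  by apply: measurable_funM => //; exact: measurable_funX.
rewrite RintegralZl//; last first.
  apply: (@Pbounded _ _ _ N01 _ 1) => // g.
  rewrite ger0_norm ?expR_ge0// -expR0 ler_expR !mulNr oppr_le0.
  by rewrite mulr_ge0 ?sqr_ge0// mulr_ge0.
rewrite /Rintegral integral_normal_expR_sqr//= /B big_cons -mulrA; congr (_ * _).
by rewrite [RHS]mulrC mulNr mulrN opprK mulrA.
Qed.

Let Sn w := \sum_i Z i w ^+ 2.

Let L00 w : L (fun=> 0) w = 0.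
Proof. by rewrite /L big1// => i _; rewrite mul0r. Qed.

Let V00 : \sum_i D i * (0 : R) ^+ 2 = 0.
Proof. by rewrite big1// => i _; rewrite expr0n mulr0. Qed.

Lemma chernoff (f : Omega -> R) (B a : R) : measurable_fun setT f ->
  (\int[P]_w (expR (f w))%:E <= B%:E)%E ->
  (P [set w | (a <= f w)%R] <= (B * expR (- a))%:E)%E.
Proof.
move=> mf fB.
have mE : measurable_fun setT (fun w => (expR (f w))%:E).
  by apply/measurable_EFinP; exact: measurableT_comp.
have := @le_integral_abse _ _ _ P setT measurableT _ (expR a) mE (expR_gt0 _).
rewrite setTI.
have -> : [set x | ((expR a)%:E <= `|(expR (f x))%:E|)%E] = [set w | a <= f w].
  by apply/seteqP; split => w /=; rewrite ger0_norm ?expR_ge0// lee_fin ler_expR.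
move=> h; rewrite expRN.
rewrite -(@lee_pmul2l _ (expR a)%:E) ?lte_fin ?expR_gt0//.
rewrite [leRHS](_ : _ = B%:E).
  apply: (le_trans h); apply: le_trans fB; apply: ge0_le_integral => //.
  - exact: measurableT_comp.
  - by move=> w _; rewrite /= ger0_norm ?expR_ge0.
by rewrite -EFinM mulrC mulfVK// gt_eqF ?expR_gt0.
Qed.

Variables (K eta : R).
Hypotheses (n0 : (0 < n)%N) (K0 : 0 < K) (eta0 : 0 < eta) (DK : forall i, D i <= K).

Let m := Num.min eta 1.
(** This choice keeps [2 * s * D i <= 1 / 4], the range of [invsqrt_1B_le_expR]. Per observation the
    error [2 * (s * K) ^+ 2 = m ^+ 2 / 32 <= m * eta / 32] is set against the gain [m * eta / 8],
    leaving more than [m * eta / 16]. *)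
Let s := m / (8 * K).
Let m0 : 0 < m. Proof. by rewrite lt_min eta0 ltr01. Qed.
Let m1 : m <= 1. Proof. by rewrite ge_min lexx orbT. Qed.
Let meta : m <= eta. Proof. by rewrite ge_min lexx. Qed.
Let mE : m * eta = Num.min (eta ^+ 2) eta.
Proof.
rewrite /m; have [h|h] := leP eta 1.
  by rewrite min_l ?expr2// ger_pMl.
by rewrite mul1r min_r// expr2 ler_pMl// ltW.
Qed.
Let s0 : 0 < s. Proof. by rewrite divr_gt0// mulr_gt0. Qed.
Let sK : s * K = m / 8.
Proof. by rewrite /s; field; rewrite gt_eqF. Qed.
Let sD i : 0 <= 2 * s * D i <= 1 / 4.
Proof.
have h : s * D i <= s * K by rewrite ler_pM2l.
rewrite sK in h; have h1 := m1; have h0 : 0 <= s * D i by rewrite mulr_ge0// ltW.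
by apply/andP; split; lra.
Qed.

Let expR_sum (f : 'I_n -> R) : \prod_i expR (f i) = expR (\sum_i f i).
Proof. by rewrite (big_morph expR (@expRD R) (@expR0 R)). Qed.

Let sD2 i : (2 * s * D i) ^+ 2 / 2 <= 2 * (s * K) ^+ 2.
Proof.
have : (s * D i) ^+ 2 <= (s * K) ^+ 2.
  rewrite lerXn2r ?nnegrE ?ler_pM2l//; first by rewrite mulr_ge0// ltW.
  by rewrite mulr_ge0// ltW.
by rewrite -[2 * s * D i]mulrA exprMn; lra.
Qed.

Let expo_le : n%:R * (2 * (s * K) ^+ 2) - s * (n%:R * (K * eta)) <=
  - (16^-1 * n%:R * Num.min (eta ^+ 2) eta).
Proof.
rewrite -mE (_ : s * (n%:R * (K * eta)) = n%:R * (m * eta / 8)); last first.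
  by transitivity (n%:R * (s * K) * eta); [ring|rewrite sK; field].
rewrite sK -mulrBr [leRHS](_ : _ = n%:R * (- (16^-1 * (m * eta)))); last by ring.
rewrite ler_wpM2l//.
have : m * m <= m * eta by rewrite ler_pM2l.
have : 0 <= m * m by rewrite mulr_ge0 ?ltW.
rewrite expr2; lra.
Qed.

Lemma chi2_upper_tail :
  (P [set w | (\sum_i D i + n%:R * (K * eta) <= Sn w)%R] <=
   (expR (- (16^-1 * n%:R * Num.min (eta ^+ 2) eta)))%:E)%E.
Proof.
have h := @expR_chi2_le s (index_enum 'I_n) (fun=> 0) (ltW s0) _ (index_enum_uniq _) (fun _ _ => erefl).
have {}h : (\int[P]_w (expR (s * Sn w))%:E <= (expR (s * (\sum_i D i) + n%:R * (2 * (s * K) ^+ 2)))%:E)%E.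
  apply: le_trans (le_trans (h _) _).
  - by rewrite le_eqVlt; apply/orP; left; apply/eqP; apply: eq_integral => w _; rewrite L00 add0r.
  - by move=> i; have := sD i; lra.
  rewrite lee_fin V00 mul0r expR0 mul1r.
  apply: (@le_trans _ _ (\prod_i expR (s * D i + 2 * (s * K) ^+ 2))).
    apply: ler_prod => i _; rewrite invr_ge0 sqrtr_ge0/=.
    apply: le_trans (invsqrt_1B_le_expR (sD i)) _; rewrite ler_expR.
    by have := sD2 i; lra.
  rewrite expR_sum big_split/= -mulr_sumr sumr_const card_ord.
  by rewrite -[_ *+ n]mulr_natl.
have mS' : measurable_fun setT (fun w => s * Sn w) by apply: measurable_funM => //; exact: mS.
have := @chernoff _ _ (s * (\sum_i D i + n%:R * (K * eta))) mS' h.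
rewrite -expRD.
have -> : [set w | s * (\sum_i D i + n%:R * (K * eta)) <= s * Sn w] =
   [set w | \sum_i D i + n%:R * (K * eta) <= Sn w].
  by apply/seteqP; split => w /=; rewrite ler_pM2l.
move=> /le_trans; apply; rewrite lee_fin ler_expR.
by apply: le_trans expo_le; rewrite mulrDr; lra.
Qed.

Lemma chi2_lower_tail :
  (P [set w | (Sn w <= \sum_i D i - n%:R * (K * eta))%R] <=
   (expR (- (16^-1 * n%:R * Num.min (eta ^+ 2) eta)))%:E)%E.
Proof.
have h := @expRN_chi2 s (index_enum 'I_n) (fun=> 0) (ltW s0) (index_enum_uniq _) (fun _ _ => erefl).
have mS' : measurable_fun setT (fun w => - (s * Sn w)).
  by apply: measurableT_comp => //; apply: measurable_funM => //; exact: mS.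
have {}h : (\int[P]_w (expR (- (s * Sn w)))%:E <= (expR (- (s * (\sum_i D i)) + n%:R * (2 * (s * K)
  ^+ 2)))%:E)%E.
  have fin : P.-integrable setT (EFin \o (fun w => expR (- (s * Sn w)))).
    apply: (@Pbounded _ _ _ P _ 1); first exact: measurableT_comp.
    move=> w; rewrite ger0_norm ?expR_ge0// -expR0 ler_expR oppr_le0 mulr_ge0//; first exact: ltW.
    by apply: sumr_ge0 => i _; exact: sqr_ge0.
  have -> : (\int[P]_w (expR (- (s * Sn w)))%:E)%E = (\int[P]_w (expR (- (s * Sn w))))%:E.
    by rewrite /Rintegral fineK//; exact: integrable_fin_num.
  rewrite lee_fin.
  rewrite (_ : \int[P]_w _ = \int[P]_w (cos (L (fun=> 0) w) * expR (- (s * S (index_enum 'I_n)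
    w)))); last first.
    by apply: eq_Rintegral => w _; rewrite L00 cos0 mul1r.
  rewrite h V00 mul0r oppr0 expR0 mul1r.
  apply: (@le_trans _ _ (\prod_i expR (- (s * D i) + 2 * (s * K) ^+ 2))).
    apply: ler_prod => i _; rewrite invr_ge0 sqrtr_ge0/=.
    have /andP[p _] := sD i.
    apply: le_trans (invsqrt_1D_le_expR p) _; rewrite ler_expR.
    by have := sD2 i; lra.
  rewrite expR_sum big_split/= sumrN -mulr_sumr sumr_const card_ord.
  by rewrite -[_ *+ n]mulr_natl.
have := @chernoff _ _ (- (s * (\sum_i D i - n%:R * (K * eta)))) mS' h.
rewrite -expRD.
have -> : [set w | - (s * (\sum_i D i - n%:R * (K * eta))) <= - (s * Sn w)] =
   [set w | Sn w <= \sum_i D i - n%:R * (K * eta)].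
  by apply/seteqP; split => w /=; rewrite lerN2 ler_pM2l.
move=> /le_trans; apply; rewrite lee_fin ler_expR.
by apply: le_trans expo_le; rewrite mulrBr; lra.
Qed.

Lemma chi2_concentration :
  (P [set w | (K * eta < `|n%:R^-1 * Sn w - n%:R^-1 * \sum_i D i|)%R] <=
   (2 * expR (- (16^-1 * n%:R * Num.min (eta ^+ 2) eta)))%:E)%E.
Proof.
have nR : 0 < n%:R :> R by rewrite ltr0n.
have mSn : measurable_fun setT Sn := mS _.
apply: (@le_trans _ _ (P ([set w | (\sum_i D i + n%:R * (K * eta) <= Sn w)%R] `|`
    [set w | (Sn w <= \sum_i D i - n%:R * (K * eta))%R]))).
  apply: le_measure; rewrite ?inE.
  - apply: measurable_set_gt; apply: measurableT_comp => //.
    by apply: measurable_funB => //; exact: measurable_funM.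
  - by apply: measurableU; [exact: measurable_set_ge|exact: measurable_set_le].
  move=> w /=; rewrite -mulrBr normrM ger0_norm ?invr_ge0//.
  rewrite [n%:R^-1 * _]mulrC ltr_pdivlMr// [K * eta * _]mulrC.
  case: (ger0P (Sn w - \sum_i D i)) => h1 h2; [left|right]; lra.
apply: le_trans (measureU2 _ _ _) _.
- exact: measurable_set_ge.
- exact: measurable_set_le.
by rewrite mulr2n mulrDl mul1r EFinD leeD ?chi2_upper_tail ?chi2_lower_tail.
Qed.

End laplace_chi2.

(** * Diagonalization of the covariance matrix *)

Section gaussian_vector.
Context d {Omega : measurableType d} {R : realType} (P : probability Omega R).
Variables (n : nat) (W : 'I_n -> Omega -> R) (K : R).
Hypotheses (n0 : (0 < n)%N) (K0 : 0 < K).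
Hypothesis gW : forall c : 'I_n -> R, centered_gaussian P (fun w => \sum_i c i * W i w).
Hypothesis vW : forall c : 'I_n -> R,
  \int[P]_w ((\sum_i c i * W i w) ^+ 2) <= K * \sum_i c i ^+ 2.

Let delta_sum (i : 'I_n) (f : 'I_n -> R) : \sum_j (j == i)%:R * f j = f i.
Proof.
rewrite (bigD1 i)//= eqxx mul1r big1 ?addr0// => j /negbTE ->.
by rewrite mul0r.
Qed.

Let gWi i : centered_gaussian P (W i).
Proof.
by have := gW (fun j => (j == i)%:R); under eq_fun do rewrite (delta_sum i (W ^~ _)).
Qed.

Let mW i : measurable_fun setT (W i). Proof. by have [] := gWi i. Qed.

Let iWW i j : P.-integrable setT (EFin \o (fun w => W i w * W j w)).
Proof.
have [_ hi _ _] := gWi i; have [_ hj _ _] := gWi j.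
exact: integrable_mul_of_sqr.
Qed.

Let G : 'M[R]_n := \matrix_(i, j) \int[P]_w (W i w * W j w).

Let GE (c : 'rV[R]_n) : \int[P]_w ((\sum_i c 0 i * W i w) ^+ 2) = (c *m G *m c^T) 0 0.
Proof.
transitivity (\int[P]_w (\sum_i \sum_j (c 0 i * c 0 j) * (W i w * W j w))).
  apply: eq_Rintegral => w _; rewrite expr2 mulr_suml; apply: eq_bigr => i _.
  by rewrite mulr_sumr; apply: eq_bigr => j _; ring.
rewrite Rintegral_sum//; last first.
  by move=> i _; apply: integrableR_sum => // j _; exact: integrableRZ.
rewrite mxE; under [RHS]eq_bigr do rewrite mxE mulr_suml.
rewrite exchange_big/=; apply: eq_bigr => i _.
rewrite Rintegral_sum//; last by move=> j _; exact: integrableRZ.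
apply: eq_bigr => j _; rewrite RintegralZl// !mxE.
by rewrite mulrAC.
Qed.

(** Rotating [W] by the orthogonal [U] that diagonalizes its covariance preserves the squared norm
    and its mean, and makes the variance form of [Z] diagonal, as [chi2_concentration] expects. *)
Lemma gaussian_vector_concentration (eta : R) : 0 < eta ->
  (P [set w | (K * eta < `|n%:R^-1 * (\sum_i W i w ^+ 2) -
      n%:R^-1 * \sum_i \int[P]_w (W i w ^+ 2)|)%R] <=
   (2 * expR (- (16^-1 * n%:R * Num.min (eta ^+ 2) eta)))%:E)%E.
Proof.
move=> eta0.
have sG : G^T = G.
  by apply/matrixP => i j; rewrite !mxE; apply: eq_Rintegral => w _; rewrite mulrC.
have [U [D [UU UD]]] := real_spectral sG.
have UU' : U^T *m U = 1%:M by exact: mulmx1C.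
pose Z i w := \sum_j U i j * W j w.
have ZE (c : 'I_n -> R) w : \sum_i c i * Z i w = \sum_j ((\row_i c i) *m U) 0 j * W j w.
  under eq_bigr do rewrite mulr_sumr.
  rewrite exchange_big/=; apply: eq_bigr => j _; rewrite mxE mulr_suml.
  by apply: eq_bigr => i _; rewrite mxE mulrA.
have gZ (c : 'I_n -> R) : centered_gaussian P (fun w => \sum_i c i * Z i w).
  by under eq_fun do rewrite ZE; exact: gW.
have vZ (c : 'I_n -> R) : \int[P]_w ((\sum_i c i * Z i w) ^+ 2) = \sum_i D 0 i * c i ^+ 2.
  under eq_Rintegral do rewrite ZE.
  rewrite GE trmx_mul !mulmxA -[_ *m U *m G]mulmxA -[_ *m (U *m G) *m _]mulmxA UD.
  rewrite mul_mx_diag mxE; apply: eq_bigr => i _; rewrite !mxE; ring.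
have vZi i : \int[P]_w (Z i w ^+ 2) = D 0 i.
  have := vZ (fun j => (j == i)%:R); under eq_Rintegral do rewrite (delta_sum i (Z ^~ _)).
  move=> ->; under eq_bigr do rewrite -natrX -mulnn mulnb andbb mulrC.
  exact: delta_sum.
have D0 i : 0 <= D 0 i by rewrite -vZi; apply: Rintegral_ge0 => w _; exact: sqr_ge0.
(* A row of [U] is a unit vector, so [vW] bounds the variance of [Z i] by [K]. *)
have DK i : D 0 i <= K.
  rewrite -vZi; apply: le_trans (vW _) _.
  have /matrixP/(_ i i) := UU; rewrite !mxE eqxx => h.
  rewrite (_ : \sum_j _ = 1) ?mulr1// -[RHS]h; apply: eq_bigr => j _.
  by rewrite !mxE expr2.
have SZ w : \sum_i Z i w ^+ 2 = \sum_i W i w ^+ 2.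
  pose x : 'rV[R]_n := \row_j W j w.
  transitivity (((x *m U^T) *m (x *m U^T)^T) 0 0).
    rewrite mxE; apply: eq_bigr => i _; rewrite expr2 [_^T _ _]mxE.
    suff -> : (x *m U^T) 0 i = Z i w by [].
    by rewrite mxE; apply: eq_bigr => j _; rewrite !mxE mulrC.
  rewrite trmx_mul trmxK mulmxA -[x *m U^T *m U]mulmxA UU' mulmx1.
  by rewrite mxE; apply: eq_bigr => i _; rewrite !mxE expr2.
have SD : \sum_i D 0 i = \sum_i \int[P]_w (W i w ^+ 2).
  under eq_bigr do rewrite -vZi.
  have iZ i : P.-integrable setT (EFin \o (fun w => Z i w ^+ 2)).
    have [_ h _ _] := gZ (fun j => (j == i)%:R); move: h.
    by under eq_fun do rewrite (delta_sum i (Z ^~ _)).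
  have iW i : P.-integrable setT (EFin \o (fun w => W i w ^+ 2)) by have [] := gWi i.
  rewrite -Rintegral_sum// -Rintegral_sum//.
  by apply: eq_Rintegral => w _; exact: SZ.
have := @chi2_concentration _ _ _ P n Z (D 0) D0 gZ vZ K eta n0 K0 eta0 DK.
by under eq_set do rewrite SZ SD.
Qed.

End gaussian_vector.

(** * Integrals of the curves *)

Lemma ae_eq_Rintegral d (T : measurableType d) (R : realType) (mu : {measure set T -> \bar R})
    (f g : T -> R) : measurable_fun setT f -> measurable_fun setT g ->
  {ae mu, forall x, f x = g x} -> \int[mu]_x f x = \int[mu]_x g x.
Proof.
move=> mf mg fg; rewrite /Rintegral; congr fine; apply: ae_eq_integral => //.
- exact/measurable_EFinP.
- exact/measurable_EFinP.
- by apply: filterS fg => x -> _.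
Qed.

(** * Integrals of random fields against deterministic functions *)

Section random_field.
Context d1 d2 {Omega : measurableType d1} {T : measurableType d2} {R : realType}.
Variables (P : probability Omega R) (mu : {sigma_finite_measure set T -> \bar R}).

(** Square integrability is required at every [u], not only at almost every one, because moments of
    [x (w, u)] against other variables are used pointwise in [u]. *)
Definition L2field (x : Omega * T -> R) : Prop :=
  [/\ measurable_fun setT x,
      (forall u, P.-integrable setT (EFin \o (fun w => x (w, u) ^+ 2))) &
      (P \x mu)%E.-integrable setT (EFin \o (fun z => x z ^+ 2))].

Definition sqr_integrable (g : T -> R) : Prop :=
  measurable_fun setT g /\ mu.-integrable setT (EFin \o (fun u => g u ^+ 2)).

Definition functional (g : T -> R) (x : Omega * T -> R) (w : Omega) : R :=
  \int[mu]_u (g u * x (w, u)).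

Lemma integrable_tensor (h : Omega -> R) (g : T -> R) :
  P.-integrable setT (EFin \o h) -> mu.-integrable setT (EFin \o g) ->
  (P \x mu)%E.-integrable setT (EFin \o (fun z : Omega * T => h z.1 * g z.2)).
Proof.
move=> ih ig.
have mh : measurable_fun setT h by apply/measurable_EFinP; have /integrableP[] := ih.
have mg : measurable_fun setT g by apply/measurable_EFinP; have /integrableP[] := ig.
apply/integrable12ltyP.
  apply/measurable_EFinP; apply: measurable_funM.
    exact: measurableT_comp mh measurable_fst.
  exact: measurableT_comp mg measurable_snd.
have gfin : (\int[mu]_y `|(g y)%:E| = (\int[mu]_y `|g y|)%:E)%E.
  rewrite /Rintegral fineK//; apply: integrable_fin_num => //.
  exact: (integrable_norm ig).
have E x : (\int[mu]_y `|(h x * g y)%:E| = ((\int[mu]_y `|g y|) * `|h x|)%:E)%E.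
  under eq_integral do rewrite EFinM abseM.
  rewrite ge0_integralZl//; first by rewrite gfin mulrC EFinM.
  by apply: measurableT_comp => //; exact/measurable_EFinP.
under eq_integral do rewrite E EFinM.
rewrite ge0_integralZl_EFin//; last 2 first.
- by apply/measurable_EFinP; exact: measurableT_comp.
- by apply: Rintegral_ge0.
by rewrite lte_mul_pinfty//; [rewrite lee_fin Rintegral_ge0|have /integrableP[] := ih].
Qed.

Section fixed_field.
Variables (x : Omega * T -> R).
Hypothesis Lx : L2field x.

Let mx : measurable_fun setT x. Proof. by case: Lx. Qed.
Let ix2 : (P \x mu)%E.-integrable setT (EFin \o (fun z => x z ^+ 2)). Proof. by case: Lx. Qed.

Let mxw w : measurable_fun setT (fun u => x (w, u)).
Proof. exact: measurableT_comp mx (pair1_measurable w). Qed.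

Let mxu u : measurable_fun setT (fun w => x (w, u)).
Proof. exact: measurableT_comp mx (pair2_measurable u). Qed.

Lemma field_ae_sqr_integrable :
  {ae P, forall w, mu.-integrable setT (EFin \o (fun u => x (w, u) ^+ 2))}.
Proof. exact: (ae_integrable1 ix2). Qed.

Lemma integrable_functional_mul (g : T -> R) (H : Omega -> R) :
  sqr_integrable g -> measurable_fun setT H ->
  P.-integrable setT (EFin \o (fun w => H w ^+ 2)) ->
  (P \x mu)%E.-integrable setT (EFin \o (fun z => g z.2 * (x z * H z.1))).
Proof.
move=> [mg ig] mH iH.
(* Young's inequality, with [H * g] grouped against [x]: the square of the former is a tensor
   product and therefore integrable. *)
apply: (@le_integrableR _ _ _ (P \x mu)%E _ measurableT _
   (fun z => H z.1 ^+ 2 * g z.2 ^+ 2 + x z ^+ 2)).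
- apply: measurable_funM; first exact: measurableT_comp mg measurable_snd.
  by apply: measurable_funM => //; exact: measurableT_comp mH measurable_fst.
- move=> z _; rewrite ler_norml; apply/andP.
  have := sqr_ge0 (H z.1 * g z.2 - x z); have := sqr_ge0 (H z.1 * g z.2 + x z).
  have := sqr_ge0 (H z.1 * g z.2); have := sqr_ge0 (x z).
  by rewrite exprMn; split; nra.
- by apply: integrableRD => //; exact: (integrable_tensor iH ig).
Qed.

Let iP1 : P.-integrable setT (EFin \o (fun w => (1 : R) ^+ 2)).
Proof.
apply: measurable_bounded_integrable => //.
  by rewrite (_ : _ setT = 1%E) ?ltry//; exact: probability_setT.
by exists 1; split => // t t1 y _; rewrite expr1n normr1 ltW.
Qed.

Lemma integrable_functional (g : T -> R) : sqr_integrable g ->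
  (P \x mu)%E.-integrable setT (EFin \o (fun z => g z.2 * x z)).
Proof.
move=> Lg; have := @integrable_functional_mul g (fun=> 1) Lg (measurable_cst _) iP1.
by under eq_fun do rewrite mulr1.
Qed.

Lemma ae_integrable_functional (g : T -> R) : sqr_integrable g ->
  {ae P, forall w, mu.-integrable setT (EFin \o (fun u => g u * x (w, u)))}.
Proof. by move=> Lg; exact: (ae_integrable1 (integrable_functional Lg)). Qed.

Lemma measurable_functional (g : T -> R) : sqr_integrable g ->
  measurable_fun setT (functional g x).
Proof.
move=> Lg; apply/measurable_EFinP.
by have /integrableP[] := Rintegrable_fubini1 (integrable_functional Lg).
Qed.

(** Cauchy-Schwarz in [u], valid for almost every [w] because almost every section is square
    integrable, followed by Fubini. *)
Lemma functional_sqr_le (g : T -> R) : sqr_integrable g ->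
  P.-integrable setT (EFin \o (fun w => functional g x w ^+ 2)) /\
  \int[P]_w (functional g x w ^+ 2) <=
    (\int[mu]_u (g u ^+ 2)) * \int[mu]_u \int[P]_w (x (w, u) ^+ 2).
Proof.
move=> Lg; have [mg ig] := Lg; set G := \int[mu]_u (g u ^+ 2).
have ix := Rintegrable_fubini1 ix2.
have ixG := integrableRZ measurableT G ix.
have mF2 : measurable_fun setT (fun w => functional g x w ^+ 2).
  by apply: measurable_funX; exact: measurable_functional.
have le : {ae P, forall w, functional g x w ^+ 2 <= G * \int[mu]_u (x (w, u) ^+ 2)}.
  apply: filterS field_ae_sqr_integrable => w iw.
  exact: Rintegral_CauchySchwarz.
have lei : (\int[P]_w (functional g x w ^+ 2)%:E <= \int[P]_w (G * \int[mu]_u (x (w, u) ^+ 2))%:E)%E.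
  apply: ae_ge0_le_integral => //.
  - by move=> w _; rewrite lee_fin sqr_ge0.
  - exact/measurable_EFinP.
  - by move=> w _; rewrite lee_fin mulr_ge0// Rintegral_ge0// => u _; exact: sqr_ge0.
  - by have /integrableP[] := ixG.
  - by apply: filterS le => w h _; rewrite lee_fin.
have fin : (\int[P]_w (functional g x w ^+ 2)%:E < +oo)%E.
  by apply: (le_lt_trans lei); have /integrable_fin_num := ixG; rewrite ltey_eq => ->.
have iF : P.-integrable setT (EFin \o (fun w => functional g x w ^+ 2)).
  by apply: ge0_integrable_lty => // w _; exact: sqr_ge0.
split => //.
rewrite -(Rfubini ix2) -RintegralZl// /Rintegral.
apply: fine_le => //; exact: integrable_fin_num.
Qed.

Lemma integrable_functional_expectation (g : T -> R) (H : Omega -> R) :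
  sqr_integrable g -> measurable_fun setT H ->
  P.-integrable setT (EFin \o (fun w => H w ^+ 2)) ->
  mu.-integrable setT (EFin \o (fun u => g u * \int[P]_w (x (w, u) * H w))).
Proof.
move=> Lg mH iH.
have := Rintegrable_fubini2 (integrable_functional_mul Lg mH iH).
apply: eq_integrable => // u _ /=; congr EFin.
rewrite RintegralZl//; case: Lx => _ h _.
exact: integrable_mul_of_sqr.
Qed.

(** This exchange of integrals turns moments of functionals into integrals of the covariance kernel,
    and so into values of [Xi]. *)
Lemma functional_expectation (g : T -> R) (H : Omega -> R) :
  sqr_integrable g -> measurable_fun setT H ->
  P.-integrable setT (EFin \o (fun w => H w ^+ 2)) ->
  \int[P]_w (functional g x w * H w) = \int[mu]_u (g u * \int[P]_w (x (w, u) * H w)).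
Proof.
move=> Lg mH iH; have ik := integrable_functional_mul Lg mH iH.
transitivity (\int[P]_w \int[mu]_u (g u * (x (w, u) * H w))).
  apply: ae_eq_Rintegral.
  - by apply: measurable_funM => //; exact: measurable_functional.
  - by apply/measurable_EFinP; have /integrableP[] := Rintegrable_fubini1 ik.
  apply: filterS (ae_integrable_functional Lg) => w iw.
  rewrite /functional mulrC -RintegralZl//; apply: eq_Rintegral => u _; ring.
rewrite (Rfubini ik); apply: eq_Rintegral => u _.
by rewrite /= RintegralZl//; case: Lx => _ h _; exact: integrable_mul_of_sqr.
Qed.

(** Linearity is only almost sure: it is established where both sections are integrable, since
    elsewhere a real integral may be a default value. *)
Lemma functional_lin (g1 g2 : T -> R) (a b : R) : sqr_integrable g1 -> sqr_integrable g2 ->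
  {ae P, forall w, functional (fun u => a * g1 u + b * g2 u) x w =
     a * functional g1 x w + b * functional g2 x w}.
Proof.
move=> L1 L2; apply: filterS2 (ae_integrable_functional L1) (ae_integrable_functional L2) => w i1 i2.
rewrite /functional -!RintegralZl// -RintegralD//; try exact: integrableRZ.
by apply: eq_Rintegral => u _; ring.
Qed.

End fixed_field.

Lemma L2field_sub (x y : Omega * T -> R) : L2field x -> L2field y ->
  L2field (fun z => x z - y z).
Proof.
move=> [mx ix ix2] [my iy iy2]; split.
- exact: measurable_funB.
- move=> u.
  rewrite (_ : (fun w => _) = (fun w => (1 * x (w, u) + (-1) * y (w, u)) ^+ 2)); last first.
    by apply/funext => w; rewrite mul1r mulN1r.
  apply: integrable_sqrD => //.
    exact: measurableT_comp mx (pair2_measurable u).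
  exact: measurableT_comp my (pair2_measurable u).
- rewrite (_ : (fun z => _) = (fun z => (1 * x z + (-1) * y z) ^+ 2)); last first.
    by apply/funext => w; rewrite mul1r mulN1r.
  exact: integrable_sqrD.
Qed.

Lemma functional_sub (g : T -> R) (x y : Omega * T -> R) : sqr_integrable g ->
  L2field x -> L2field y ->
  {ae P, forall w, functional g (fun z => x z - y z) w = functional g x w - functional g y w}.
Proof.
move=> Lg Lx Ly.
apply: filterS2 (ae_integrable_functional Lx Lg) (ae_integrable_functional Ly Lg) => w i1 i2.
by rewrite /functional -RintegralB//; apply: eq_Rintegral => u _; rewrite mulrBr.
Qed.

End random_field.

(** * Rounding to a grid of the interval *)

Section grid.
Context {R : realType} (a b : R).
Hypothesis ab : a < b.
Implicit Types (N i : nat) (u : R).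

Definition grid_point N i : R := a + (b - a) * (i%:R / N.+1%:R).

(* The largest grid point not exceeding [u], for [u] in [a, b]; writing the
   index as a sum of indicators makes measurability immediate. *)
Definition grid_round N u : R :=
  a + (b - a) * ((\sum_(i < N.+1) ((grid_point N i.+1 <= u)%R : nat)%:R) / N.+1%:R).

Lemma grid_pointS_le N i u : (grid_point N i.+1 <= u) = (i.+1%:R <= (u - a) / (b - a) * N.+1%:R).
Proof.
have p : 0 < b - a by rewrite subr_gt0.
have q : 0 < N.+1%:R :> R by [].
rewrite /grid_point -lerBrDl mulrC -ler_pdivlMr// ler_pdivrMr//.
Qed.

Lemma measurable_grid_round N : measurable_fun setT (grid_round N).
Proof.
apply: measurable_funD => //; apply: measurable_funM => //; apply: measurable_funM => //.
apply: measurable_sum => i.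
rewrite (_ : (fun u => _) = \1_(`[grid_point N i.+1, +oo[)); last first.
  apply/funext => u; rewrite indicE; congr ((nat_of_bool _)%:R).
  by apply/idP/idP; rewrite inE/= in_itv/= andbT.
exact: measurable_indic.
Qed.

(** The index is the integer part of [(u - a) / (b - a) * (N + 1)]. It reaches [N + 1] at [u = b],
    whence [N.+2] grid points. *)
Lemma grid_roundP N u : u \in `[a, b] ->
  exists2 i : 'I_N.+2, grid_round N u = grid_point N i & `|grid_point N i - u| <= (b - a) / N.+1%:R.
Proof.
rewrite in_itv/= => /andP[au ub].
have p : 0 < b - a by rewrite subr_gt0.
have q : 0 < N.+1%:R :> R by [].
set y := (u - a) / (b - a) * N.+1%:R.
have y0 : 0 <= y by rewrite mulr_ge0// divr_ge0 ?subr_ge0// ltW.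
have yN : y <= N.+1%:R.
  by rewrite ler_piMl// ler_pdivrMr// mul1r lerB.
have tN : (Num.truncn y <= N.+1)%N.
  by rewrite -(ler_nat R); apply: le_trans yN; rewrite truncn_le.
have tN' : (Num.truncn y < N.+2)%N by rewrite ltnS.
exists (Ordinal tN') => /=.
  rewrite /grid_round /grid_point; congr (_ + _ * (_ / _)).
  under eq_bigr do rewrite grid_pointS_le -/y -truncn_gt_nat.
  rewrite -natr_sum; congr (_%:R).
  rewrite -[RHS]card_ord -sum1_card (big_ord_widen _ (fun=> 1%N) tN) [RHS]big_mkcond/=.
  by apply: eq_bigr => i _; case: ltnP.
have /andP[h1 h2] := truncn_itv y0.
have -> : grid_point N (Num.truncn y) - u = - ((y - (Num.truncn y)%:R) * ((b - a) / N.+1%:R)).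
  rewrite /grid_point /y; field.
  by rewrite nat1r pnatr_eq0/= subr_eq0 gt_eqF.
rewrite normrN ger0_norm; last by rewrite mulr_ge0 ?subr_ge0// divr_ge0// ltW.
rewrite ler_piMl ?divr_ge0 ?(ltW p)//.
by rewrite lerBlDl natr1 ltW.
Qed.

Lemma grid_point_itv N (i : 'I_N.+2) : grid_point N i \in `[a, b].
Proof.
have p : 0 <= b - a by rewrite subr_ge0 ltW.
rewrite in_itv/= /grid_point lerDl mulr_ge0//= -lerBrDl ler_piMr//.
by rewrite ler_pdivrMr// mul1r ler_nat -ltnS.
Qed.

Lemma grid_round_cvg u : u \in `[a, b] -> grid_round ^~ u @ \oo --> u.
Proof.
move=> uab; apply/cvgrPdist_le => e e0.
have p : 0 < b - a by rewrite subr_gt0.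
near=> N.
have [i -> h] := grid_roundP N uab.
rewrite distrC; apply: (le_trans h).
rewrite ler_pdivrMr//.
rewrite mulrC -ler_pdivrMr//.
near: N; exists (Num.truncn ((b - a) / e)).+1 => // N /= hN.
apply: ltW; apply: lt_le_trans (truncnS_gt _) _.
by rewrite ler_nat ltnW// ltnS ltnW.
Unshelve. all: by end_near.
Qed.

End grid.

(** * Gaussianity of integrals of the curves *)

Section curves.
Context d {Omega : measurableType d} {R : realType} (P : probability Omega R).
Variables (a b : R) (p : nat) (X : int -> 'I_p -> R -> Omega -> R).
Hypotheses (ab : a < b) (RC : random_curves a b X) (JG : jointly_gaussian P a b X).
Hypotheses (MZ : mean_zero P a b X) (CS : cov_stationary P a b X).
Local Notation leb := (@lebesgue_measure R : {sigma_finite_measure set (measurableTypeR R) -> \bar R}).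

Lemma gaussian_point (t : int) j u : u \in `[a, b] -> gaussian_rv P (X t j u).
Proof.
move=> uab; have := JG (fun=> 1) (fun=> t) (fun=> j) (fun _ : 'I_1 => uab).
by under eq_fun do rewrite big_ord1 mul1r.
Qed.

Lemma centered_point (t : int) j u : u \in `[a, b] -> centered_gaussian P (X t j u).
Proof. by move=> uab; apply: gaussian_rv_centered (gaussian_point _ _ uab) (MZ _ _ uab). Qed.

Lemma integrable_point (t : int) j u : u \in `[a, b] -> P.-integrable setT (EFin \o X t j u).
Proof.
move=> uab; have [m i2 _ _] := centered_point t j uab.
exact: integrable_abs_of_sqr.
Qed.

Lemma centered_combo (m : nat) (c : 'I_m -> R) (t : 'I_m -> int) (j : 'I_m -> 'I_p)
    (u : 'I_m -> R) : (forall i, u i \in `[a, b]) ->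
  centered_gaussian P (fun w => \sum_(i < m) c i * X (t i) (j i) (u i) w).
Proof.
move=> uab; apply: gaussian_rv_centered; first exact: JG.
have ii i : P.-integrable setT (EFin \o (fun w => c i * X (t i) (j i) (u i) w)).
  by apply: integrableRZ => //; exact: integrable_point.
rewrite unlock.
transitivity ((\int[P]_w (\sum_(i < m) c i * X (t i) (j i) (u i) w))%:E).
  rewrite /Rintegral fineK//; apply: integrable_fin_num => //.
  exact: integrableR_sum.
rewrite Rintegral_sum// big1// => i _.
rewrite RintegralZl//; last exact: integrable_point.
by have := MZ (t i) (j i) (uab i); rewrite unlock /Rintegral => ->; rewrite mulr0.
Qed.

Lemma centered_combo_fin (I : finType) (c : I -> R) (t : I -> int) (j : I -> 'I_p)
    (u : I -> R) : (forall i, u i \in `[a, b]) ->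
  centered_gaussian P (fun w => \sum_i c i * X (t i) (j i) (u i) w).
Proof.
move=> uab.
have := @centered_combo #|I| (c \o enum_val) (t \o enum_val) (j \o enum_val) (u \o enum_val)
  (fun i => uab _).
congr centered_gaussian; apply/funext => w.
by rewrite (reindex _ (onW_bij _ (enum_val_bij I))).
Qed.

Lemma covariance_point (t s : int) j k u v : u \in `[a, b] -> v \in `[a, b] ->
  fine (covariance P (X t j u) (X s k v)) = \int[P]_w (X t j u w * X s k v w).
Proof.
move=> uab vab; rewrite unlock MZ// MZ//= unlock /Rintegral; congr fine.
by apply: eq_integral => w _; rewrite /GRing.mul/= !subr0.
Qed.

Lemma Rintegral_Sigma (t h : int) j k u v : u \in `[a, b] -> v \in `[a, b] ->
  \int[P]_w (X t j u w * X (t + h) k v w) = Sigma P X h j k u v.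
Proof. by move=> uab vab; rewrite -covariance_point// CS. Qed.

(** Extension by zero, so that product measures can be taken over the whole line. *)
Definition curve (t : int) (j : 'I_p) (z : Omega * measurableTypeR R) : R :=
  if z.2 \in `[a, b] then X t j z.2 z.1 else 0.

Variable B : R.
Hypothesis SB : forall (j : 'I_p) (u v : R), u \in `[a, b] -> v \in `[a, b] ->
  `|Sigma P X 0 j j u v| <= B.

Lemma measurable_field t j : measurable_fun setT (curve t j).
Proof.
have mD : measurable (setT `*` `[a, b]%classic : set (Omega * measurableTypeR R)).
  exact: measurableX.
have := (measurable_restrictT _ mD).1 (RC t j).
apply: eq_measurable_fun => z _; rewrite patchE /curve.
suff -> : (z \in [set: Omega] `*` `[a, b]%classic) = (z.2 \in `[a, b]) by [].
by apply/idP/idP; rewrite !inE/=; [case|].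
Qed.

Lemma second_moment_le t j u : u \in `[a, b] -> \int[P]_w (X t j u w ^+ 2) <= B.
Proof.
move=> uab; have := Rintegral_Sigma t 0 j j uab uab; rewrite addr0 => h.
under eq_Rintegral do rewrite expr2; rewrite h.
by apply: le_trans (SB j uab uab); exact: ler_norm.
Qed.

Let leb_itv : leb `[a, b]%classic = (b - a)%:E.
Proof. by have := lebesgue_measure_itv `[a, b]; rewrite /= lte_fin ab EFinB. Qed.

(** By Tonelli the product integral is at most [C * (b - a)]: the second moments are bounded on the
    interval and the field vanishes outside. *)
Lemma L2field_of (x : Omega * measurableTypeR R -> R) (C : R) : measurable_fun setT x ->
  (forall u, P.-integrable setT (EFin \o (fun w => x (w, u) ^+ 2))) ->
  (forall u, u \in `[a, b] -> \int[P]_w (x (w, u) ^+ 2) <= C) ->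
  (forall w u, u \notin `[a, b] -> x (w, u) = 0) -> L2field P leb x.
Proof.
move=> mx ix xC x0; split => //.
have mx2 : measurable_fun setT (fun z => (x z ^+ 2)%:E).
  by apply/measurable_EFinP; exact: measurable_funX.
apply/integrable21ltyP; first exact: mx2.
apply: (@le_lt_trans _ _ (\int[leb]_u (C%:E * (\1_`[a, b]%classic u)%:E))%E).
  apply: ge0_le_integral => //.
  - by move=> u _; apply: integral_ge0.
  - have := @measurable_fun_fubini_tonelli_G _ _ _ _ _ P (fun z => `|(x z ^+ 2)%:E|%E).
    by apply => //; exact: measurableT_comp.
  - apply/measurable_EFinP; apply: measurable_funM => //.
  move=> u _; rewrite -EFinM.
  have -> : (\int[P]_w `|(x (w, u) ^+ 2)%:E| = (\int[P]_w (x (w, u) ^+ 2))%:E)%E.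
    rewrite /Rintegral fineK; last exact: (integrable_fin_num measurableT (ix u)).
    by apply: eq_integral => w _; rewrite /= ger0_norm// sqr_ge0.
  rewrite lee_fin indicE; have [uab|uab] := boolP (u \in `[a, b]).
    by rewrite mem_set// mulr1 xC.
  rewrite memNset//; last exact/negP.
  under eq_Rintegral do rewrite x0// expr0n.
  by rewrite mulr0 Rintegral_prob_cst.
have C0 : 0 <= C.
  have aab : a \in `[a, b] by rewrite in_itv/= lexx ltW.
  by apply: le_trans (xC a aab); apply: Rintegral_ge0 => w _; exact: sqr_ge0.
rewrite ge0_integralZl_EFin//; last first.
  by apply/measurable_EFinP.
rewrite (_ : (\int[_]_u _ = (b - a)%:E)%E) -?EFinM ?ltry//.
by rewrite integral_indic// setIT; exact: leb_itv.
Qed.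

Lemma integrable_sqr_section t j u :
  P.-integrable setT (EFin \o (fun w => (if u \in `[a, b] then X t j u w else 0) ^+ 2)).
Proof.
have [uab|uab] := boolP (u \in `[a, b]); first by have [] := centered_point t j uab.
exact: Pfin.
Qed.

Lemma L2field_field t j : L2field P leb (curve t j).
Proof.
apply: (@L2field_of _ B); first exact: measurable_field.
- by move=> u; exact: integrable_sqr_section.
- by move=> u uab; rewrite /curve/= uab second_moment_le.
- by move=> w u /negbTE; rewrite /curve/= => ->.
Qed.

Definition grid_field N (t : int) (j : 'I_p) (z : Omega * measurableTypeR R) : R :=
  if z.2 \in `[a, b] then X t j (grid_round a b N z.2) z.1 else 0.

Lemma grid_round_itv N u : u \in `[a, b] -> grid_round a b N u \in `[a, b].
Proof. by move=> uab; have [i -> _] := grid_roundP ab N uab; exact: grid_point_itv. Qed.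

Lemma L2field_grid N t j : L2field P leb (grid_field N t j).
Proof.
apply: (@L2field_of _ B).
- have mD : measurable (setT `*` `[a, b]%classic : set (Omega * measurableTypeR R)).
    exact: measurableX.
  have mf : measurable_fun setT (fun z : Omega * measurableTypeR R =>
      curve t j (z.1, grid_round a b N z.2)).
    apply: measurableT_comp; first exact: measurable_field.
    apply: measurable_fun_pair; first exact: measurable_fst.
    exact: measurableT_comp (measurable_grid_round _ _ _) measurable_snd.
  have := (measurable_restrictT _ mD).1 (measurable_funTS mf).
  apply: eq_measurable_fun => z _; rewrite patchE /curve /grid_field/=.
  have -> : (z \in [set: Omega] `*` `[a, b]%classic) = (z.2 \in `[a, b]).
    by apply/idP/idP; rewrite !inE/=; [case|].
  by case: ifPn => // zab; rewrite grid_round_itv.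
- move=> u; rewrite /grid_field/=; have [uab|uab] := boolP (u \in `[a, b]).
    by have [] := centered_point t j (grid_round_itv N uab).
  exact: Pfin.
- by move=> u uab; rewrite /grid_field/= uab second_moment_le// grid_round_itv.
- by move=> w u /negbTE; rewrite /grid_field/= => ->.
Qed.

Let cell N i : set R := `[a, b]%classic `&` grid_round a b N @^-1` [set grid_point a b N i].

Let measurable_cell N i : measurable (cell N i).
Proof.
apply: measurableI => //; rewrite -[X in measurable X]setTI.
exact: measurable_grid_round.
Qed.

Lemma grid_point_inj N : injective (grid_point a b N).
Proof.
move=> i k /addrI; have p0 : b - a != 0 by rewrite subr_eq0 gt_eqF.
move/(mulfI p0); have q : N.+1%:R^-1 != 0 :> R by rewrite invr_neq0.
by move/(mulIf q)/eqP; rewrite eqr_nat => /eqP.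
Qed.

(** The step field involves finitely many values of the process, so its integral is a finite linear
    combination of them, to which joint Gaussianity applies. *)
Lemma functional_grid N t j (phi : R -> R) w : sqr_integrable leb phi ->
  functional leb phi (grid_field N t j) w =
  \sum_(i < N.+2) (\int[leb]_u (phi u * \1_(cell N i) u)) * X t j (grid_point a b N i) w.
Proof.
move=> [mphi iphi].
have i1 (i : 'I_N.+2) : leb.-integrable setT (EFin \o (fun u => phi u * \1_(cell N i) u)).
  apply: (@integrable_mul_of_sqr _ (measurableTypeR R) R leb) => //.
    by apply: measurable_indic; exact: measurable_cell.
  rewrite (_ : (fun u => _) = \1_(cell N i)); last first.
    by apply/funext => u; rewrite indicE; case: (_ \in _); rewrite ?expr1n ?expr0n.
  apply/integrableP; split.
    by apply/measurable_EFinP; apply: measurable_indic; exact: measurable_cell.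
  under eq_integral do rewrite /= ger0_norm//.
  rewrite integral_indic//; last exact: measurable_cell.
  rewrite setIT; apply: (@le_lt_trans _ _ (leb `[a, b]%classic)).
    by apply: le_measure; rewrite ?inE//; [exact: measurable_cell|exact: subIsetl].
  by rewrite leb_itv ltry.
transitivity (\int[leb]_u (\sum_(i < N.+2) X t j (grid_point a b N i) w * (phi u * \1_(cell N i) u))).
  apply: eq_Rintegral => u _; rewrite /grid_field/=; case: ifPn => uab; last first.
    rewrite mulr0 big1// => i _; rewrite indicE memNset ?mulr0//.
    by case => h _; rewrite /= in h; rewrite h in uab.
  have [i hi _] := grid_roundP ab N uab.
  rewrite (bigD1 i)//= indicE mem_set ?mulr1; last by split.
  rewrite hi mulrC big1 ?addr0// => k ki.
  rewrite indicE memNset ?mulr0 ?mulr0// => -[_ /=]; rewrite hi => /grid_point_inj/val_inj ik.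
  by rewrite ik eqxx in ki.
rewrite (@Rintegral_sum _ (measurableTypeR R) R leb)//; last first.
  by move=> i _; apply: integrableRZ => //; exact: i1.
by apply: eq_bigr => i _; rewrite RintegralZl// mulrC.
Qed.

Hypothesis SC : forall j : 'I_p, {within (`[a, b] `*` `[a, b]),
     continuous (fun z : R * R => Sigma P X 0 j j z.1 z.2)}.

Lemma grid_errorE N t j u : u \in `[a, b] ->
  \int[P]_w ((curve t j (w, u) - grid_field N t j (w, u)) ^+ 2) =
  Sigma P X 0 j j u u - 2 * Sigma P X 0 j j u (grid_round a b N u) +
  Sigma P X 0 j j (grid_round a b N u) (grid_round a b N u).
Proof.
move=> uab; rewrite /curve /grid_field/= uab; have vab := grid_round_itv N uab.
set v := grid_round a b N u in vab *.
have S (r s : R) : r \in `[a, b] -> s \in `[a, b] ->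
    \int[P]_w (X t j r w * X t j s w) = Sigma P X 0 j j r s.
  by move=> h h'; rewrite -(Rintegral_Sigma t 0 j j h h') addr0.
have ii (r s : R) : r \in `[a, b] -> s \in `[a, b] ->
    P.-integrable setT (EFin \o (fun w => X t j r w * X t j s w)).
  move=> h h'; have [m1 i1 _ _] := centered_point t j h; have [m2 i2 _ _] := centered_point t j h'.
  exact: integrable_mul_of_sqr.
rewrite -!S//.
transitivity (\int[P]_w (X t j u w * X t j u w - 2 * (X t j u w * X t j v w) + X t j v w * X t j v w)).
  by apply: eq_Rintegral => w _; ring.
rewrite RintegralD//; last 2 first.
- by apply: integrableRB => //; [exact: ii|apply: integrableRZ => //; exact: ii].
- exact: ii.
rewrite RintegralB//; last 2 first.
- exact: ii.
- by apply: integrableRZ => //; exact: ii.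
by rewrite RintegralZl//; exact: ii.
Qed.

(** Continuity of the marginal covariance on the square makes the process mean-square continuous at
    each [u]; the error is dominated by [4 * B] on the interval, so dominated convergence
    applies. *)
Lemma grid_error_cvg t j :
  (fun N => \int[leb]_u \int[P]_w ((curve t j (w, u) - grid_field N t j (w, u)) ^+ 2)) @ \oo --> (0 : R).
Proof.
pose e N u := \int[P]_w ((curve t j (w, u) - grid_field N t j (w, u)) ^+ 2).
have e0 N u : u \notin `[a, b] -> e N u = 0.
  move=> /negbTE uab; rewrite /e /curve /grid_field/= uab.
  by under eq_Rintegral do rewrite subr0 expr0n; rewrite Rintegral_prob_cst.
have Le N := L2field_sub (L2field_field t j) (L2field_grid N t j).
have me N : measurable_fun setT (EFin \o e N).
  have [_ _ i2] := Le N.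
  by have /integrableP[] := Rintegrable_fubini2 i2.
have cvge (u : R) : e ^~ u @ \oo --> (0 : R).
  have [uab|uab] := boolP (u \in `[a, b]); last first.
    by apply: cvg_near_cst; apply: nearW => N; exact: e0.
  pose S (z : R * R) := Sigma P X 0 j j z.1 z.2.
  have lim (y : nat -> R * R) (z : R * R) : y @ \oo --> z ->
      (forall N, (`[a, b] `*` `[a, b]) (y N)) -> (`[a, b] `*` `[a, b]) z -> S (y N) @[N --> \oo] --> S z.
    move=> yz yA zA; have h : S @ (within (`[a, b] `*` `[a, b]) (nbhs z)) --> S z.
      by move: z zA {yz}; apply/subspace_continuousP; exact: SC.
    apply: cvg_comp h => A /= hA.
    have hN : \forall N \near \oo, (`[a, b] `*` `[a, b]) (y N) -> A (y N) := yz _ hA.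
    by apply: filterS hN => N; apply.
  have c1 := @grid_round_cvg _ a b ab u uab.
  have l1 : S (u, grid_round a b N u) @[N --> \oo] --> S (u, u).
    apply: (lim (fun N => (u, grid_round a b N u))) => //; first exact: (cvg_pair (cvg_cst u) c1).
    by move=> N; split => //=; exact: grid_round_itv.
  have l2 : S (grid_round a b N u, grid_round a b N u) @[N --> \oo] --> S (u, u).
    apply: (lim (fun N => (grid_round a b N u, grid_round a b N u))) => //; first exact: (cvg_pair c1 c1).
    by move=> N; split => /=; exact: grid_round_itv.
  have : S (u, u) - 2 * S (u, grid_round a b N u) + S (grid_round a b N u, grid_round a b N u)
      @[N --> \oo] --> S (u, u) - 2 * S (u, u) + S (u, u).
    apply: cvgD; last exact: l2.
    by apply: cvgB; [exact: cvg_cst|apply: cvgM; [exact: cvg_cst|exact: l1]].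
  rewrite (_ : _ - _ + _ = 0); last by ring.
  apply: cvg_trans; apply: near_eq_cvg; apply: nearW => N.
  by rewrite /e grid_errorE.
have eB N u : `|e N u| <= 4 * B * \1_`[a, b]%classic u.
  have [uab|uab] := boolP (u \in `[a, b]); last by rewrite e0// normr0 indicE memNset ?mulr0//; exact/negP.
  rewrite /e grid_errorE// indicE mem_set// mulr1.
  have rab := grid_round_itv N uab.
  have /ler_normlP[] := SB j uab uab; have /ler_normlP[] := SB j uab rab.
  have /ler_normlP[] := SB j rab rab; move=> *.
  by rewrite ler_norml; apply/andP; split; lra.
have i1 : leb.-integrable setT (EFin \o (fun u : R => 4 * B * \1_`[a, b]%classic u)).
  apply: integrableRZ => //; apply/integrableP; split; first by apply/measurable_EFinP.
  under eq_integral do rewrite /= ger0_norm//.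
  rewrite (_ : (\int[_]_u _ = (b - a)%:E)%E) ?ltry//.
  by rewrite integral_indic// setIT; exact: leb_itv.
have h : (\int[leb]_u (e N u)%:E)%E @[N --> \oo] --> 0%E.
  rewrite -[X in _ --> X](@integral0 _ (measurableTypeR R) R leb setT).
  apply: (@dominated_cvg _ (measurableTypeR R) R leb setT measurableT (fun N => EFin \o e N) (cst
    0%E) _ me _ _ i1) => //.
    by move=> u _; apply: cvg_EFin; [exact: nearW|exact: cvge].
  by move=> N u _; rewrite /= lee_fin.
exact: (fine_cvg h).
Qed.

(** Each grid approximation is a finite combination of values of the process. Its mean-square error
    is controlled by the grid error through [functional_sqr_le], and [centered_gaussian_lim] passes
    to the limit. *)
Lemma functional_centered (I : finType) (c : I -> R) (t : I -> int) (j : I -> 'I_p)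
    (phi : I -> R -> R) : (forall i, sqr_integrable leb (phi i)) ->
  centered_gaussian P (fun w => \sum_i c i * functional leb (phi i) (curve (t i) (j i)) w).
Proof.
move=> Lphi.
have Lf i := L2field_field (t i) (j i).
have Lg N i := L2field_grid N (t i) (j i).
have mF i := measurable_functional (Lf i) (Lphi i).
have mG N i := measurable_functional (Lg N i) (Lphi i).
have [iF iG] : (forall i, P.-integrable setT (EFin \o (fun w => functional leb (phi i) (curve (t i)
  (j i)) w ^+ 2)))
    /\ (forall N i, P.-integrable setT (EFin \o (fun w => functional leb (phi i) (grid_field N (t
      i) (j i)) w ^+ 2))).
  by split => [i|N i]; [have [] := functional_sqr_le (Lf i) (Lphi i)|have [] := functional_sqr_le
    (Lg N i) (Lphi i)].
pose err N i := \int[leb]_u \int[P]_w ((curve (t i) (j i) (w, u) - grid_field N (t i) (j i) (w, u)) ^+ 2).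
pose G N w := \sum_i c i * functional leb (phi i) (grid_field N (t i) (j i)) w.
apply: (@centered_gaussian_lim _ _ _ P G).
- move=> N; pose J := (I * 'I_N.+2)%type.
  pose kap i k := \int[leb]_u (phi i u * \1_(cell N k) u).
  have := @centered_combo_fin J (fun z => c z.1 * kap z.1 z.2) (fun z => t z.1) (fun z => j z.1)
    (fun z => grid_point a b N z.2) (fun z => grid_point_itv ab z.2).
  congr centered_gaussian; apply/funext => w.
  rewrite -(pair_bigA _ (fun i (k : 'I_N.+2) => c i * kap i k * X (t i) (j i) (grid_point a b N k) w))/=.
  apply: eq_bigr => i _; rewrite functional_grid// mulr_sumr.
  by apply: eq_bigr => k _; rewrite mulrA.
- by apply: measurable_sum => i; exact: measurable_funM.
- exact: integrable_sqr_sum.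
pose bound N := #|I|%:R * \sum_i c i ^+ 2 * ((\int[leb]_u (phi i u ^+ 2)) * err N i).
have b0 : bound @ \oo --> (0 : R).
  rewrite -[X in _ --> X](mulr0 #|I|%:R); apply: cvgM; first exact: cvg_cst.
  rewrite [X in _ --> X](_ : 0 = \sum_(i : I) c i ^+ 2 * ((\int[leb]_u (phi i u ^+ 2)) * 0)); last first.
    by rewrite big1// => i _; rewrite !mulr0.
  apply: cvg_big => //; first exact: add_continuous.
  move=> i _; apply: cvgM; first exact: cvg_cst.
  by apply: cvgM; [exact: cvg_cst|exact: grid_error_cvg].
apply: (squeeze_cvgr _ (cvg_cst 0) b0).
apply: nearW => N; rewrite Rintegral_ge0/=; last by move=> w _; exact: sqr_ge0.
pose D i w := functional leb (phi i) (curve (t i) (j i)) w - functional leb (phi i) (grid_field N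
  (t i) (j i)) w.
have iD i : P.-integrable setT (EFin \o (fun w => D i w ^+ 2)).
  rewrite (_ : (fun w => _) = (fun w => (1 * functional leb (phi i) (curve (t i) (j i)) w +
    (-1) * functional leb (phi i) (grid_field N (t i) (j i)) w) ^+ 2)).
    exact: integrable_sqrD.
  by apply/funext => w; rewrite mul1r mulN1r.
have mD i : measurable_fun setT (D i) by exact: measurable_funB.
(* Cauchy-Schwarz over the finite index set separates the errors of the individual functionals. *)
apply: (@le_trans _ _ (\int[P]_w (#|I|%:R * \sum_i c i ^+ 2 * D i w ^+ 2))).
  apply: le_Rintegral => //.
  - rewrite (_ : (fun w => _) = (fun w => (\sum_i c i * D i w) ^+ 2)); first exact: integrable_sqr_sum.
    by apply/funext => w; rewrite /G -sumrB; under eq_bigr do rewrite -mulrBr.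
  - by apply: integrableRZ => //; apply: integrableR_sum => // i _; exact: integrableRZ.
  move=> w _; rewrite /G -sumrB; under eq_bigr do rewrite -mulrBr.
  apply: le_trans (sqr_sum_le _ _) _; rewrite cardT enumT -/(index_enum I).
  by rewrite ler_wpM2l//; apply: ler_sum => i _; rewrite exprMn.
rewrite RintegralZl//; last by apply: integrableR_sum => // i _; exact: integrableRZ.
rewrite ler_wpM2l// Rintegral_sum//; last by move=> i _; exact: integrableRZ.
apply: ler_sum => i _; rewrite RintegralZl// ler_wpM2l ?sqr_ge0//.
have [i2 le2] := functional_sqr_le (L2field_sub (Lf i) (Lg N i)) (Lphi i).
apply: le_trans le2; rewrite le_eqVlt; apply/orP; left; apply/eqP.
apply: ae_eq_Rintegral.
- exact: measurable_funX.
- apply: measurable_funX; apply: measurable_functional => //; exact: L2field_sub.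
by apply: filterS (functional_sub (Lphi i) (Lf i) (Lg N i)) => w ->.
Qed.

End curves.

(** * Covariances of the scores and the operators [Xi] *)

Section covariances.
Context d {Omega : measurableType d} {R : realType} (P : probability Omega R).
Variables (a b : R) (p : nat) (X : int -> 'I_p -> R -> Omega -> R) (B : R).
Hypotheses (ab : a < b) (RC : random_curves a b X) (JG : jointly_gaussian P a b X).
Hypotheses (MZ : mean_zero P a b X) (CS : cov_stationary P a b X).
Hypothesis SB : forall (j : 'I_p) (u v : R), u \in `[a, b] -> v \in `[a, b] ->
  `|Sigma P X 0 j j u v| <= B.
Local Notation leb := (@lebesgue_measure R : {sigma_finite_measure set (measurableTypeR R) -> \bar R}).
Local Notation field := (curve a b X).

Definition cutoff (f : R -> R) (u : R) : R := if u \in `[a, b] then f u else 0.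

Lemma ext_restrict f : cutoff f = f \_ `[a, b]%classic.
Proof.
apply/funext => u; rewrite patchE /cutoff.
by case: ifPn => uab; [rewrite mem_set|rewrite memNset//; exact/negP].
Qed.

Lemma Rintegral_ext f : \int[leb]_(u in `[a, b]) f u = \int[leb]_u cutoff f u.
Proof. by rewrite ext_restrict; exact: Rintegral_mkcond. Qed.

Lemma integral_ext f : (\int[leb]_(u in `[a, b]) (f u)%:E = \int[leb]_u (cutoff f u)%:E)%E.
Proof.
rewrite integral_mkcond; apply: eq_integral => u _.
by rewrite ext_restrict !patchE; case: ifP.
Qed.

Lemma measurable_ext f : measurable_fun `[a, b] f <-> measurable_fun setT (cutoff f).
Proof. by rewrite ext_restrict; apply: measurable_restrictT. Qed.

Lemma integrable_ext f : leb.-integrable `[a, b] (EFin \o f) <->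
  leb.-integrable setT (EFin \o cutoff f).
Proof.
have -> : EFin \o cutoff f = (EFin \o f) \_ `[a, b]%classic.
  by apply/funext => u; rewrite ext_restrict /= !patchE; case: ifP.
exact: integrable_mkcond.
Qed.

Lemma L2_ext f : L2 a b f <-> sqr_integrable leb (cutoff f).
Proof.
have sq u : cutoff (fun u => f u ^+ 2) u = cutoff f u ^+ 2.
  by rewrite /cutoff; case: ifP => //; rewrite expr0n.
split => [[mf fy]|[mf fy]].
  have mf' := (measurable_ext f).1 mf; split => //.
  apply: ge0_integrable_lty => //; [exact: measurable_funX|by move=> u _; exact: sqr_ge0|].
  by under eq_integral do rewrite -sq; rewrite -integral_ext.
split; first exact/measurable_ext.
rewrite integral_ext; under eq_integral do rewrite sq.
have := integrable_fin_num measurableT fy.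
by rewrite ge0_fin_numE//; apply: integral_ge0 => u _; rewrite lee_fin sqr_ge0.
Qed.

Definition score (t : int) (Phi : 'I_p -> R -> R) (w : Omega) : R :=
  \sum_j functional leb (cutoff (Phi j)) (field t j) w.

Let Lf t j : L2field P leb (field t j). Proof. exact: (L2field_field ab RC JG MZ CS SB). Qed.

Lemma measurable_Y t Phi : Hp a b p Phi -> measurable_fun setT (score t Phi).
Proof.
move=> hPhi; apply: measurable_sum => j; apply: measurable_functional => //.
by apply/L2_ext; exact: hPhi.
Qed.

Lemma integrable_sqr_Y t Phi : Hp a b p Phi -> P.-integrable setT (EFin \o (fun w => score t Phi w ^+ 2)).
Proof.
move=> hPhi; have LP j : sqr_integrable leb (cutoff (Phi j)) by apply/L2_ext; exact: hPhi.
rewrite (_ : (fun w => _) = (fun w => (\sum_j 1 * functional leb (cutoff (Phi j)) (field t j) w) ^+ 2)).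
  apply: integrable_sqr_sum => j; first exact: measurable_functional.
  by have [] := functional_sqr_le (Lf t j) (LP j).
by apply/funext => w; under [in RHS]eq_bigr do rewrite mul1r.
Qed.

(** Regularity is assumed of the marginal kernels at lag 0 only. Reading [Xi] as a covariance with a
    score gives its measurability and bounds at all lags. *)
Lemma expectation_point_Y t h j Phi u : Hp a b p Phi -> u \in `[a, b] ->
  \int[P]_w (X t j u w * score (t + h) Phi w) = Xi P a b X h Phi j u.
Proof.
move=> hPhi uab; have LP k : sqr_integrable leb (cutoff (Phi k)) by apply/L2_ext; exact: hPhi.
have [mX iX _ _] := centered_point JG MZ t j uab.
rewrite /Xi /kernel_op.
transitivity (\int[P]_w (\sum_k functional leb (cutoff (Phi k)) (field (t + h) k) w * X t j u w)).
  by apply: eq_Rintegral => w _; rewrite mulr_sumr; apply: eq_bigr => k _; rewrite mulrC.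
rewrite Rintegral_sum//; last first.
  move=> k _; apply: integrable_mul_of_sqr => //; first exact: measurable_functional.
  by have [] := functional_sqr_le (Lf (t + h) k) (LP k).
apply: eq_bigr => k _; rewrite functional_expectation// Rintegral_ext.
apply: eq_Rintegral => v _; rewrite /cutoff /curve/=; case: ifPn => vab; last by rewrite mul0r.
rewrite mulrC; congr (_ * _); rewrite -(Rintegral_Sigma MZ CS t h j k uab vab).
by apply: eq_Rintegral => w _; rewrite mulrC.
Qed.

Lemma expectation_point_Y0 h j Phi u : Hp a b p Phi -> u \in `[a, b] ->
  \int[P]_w (X 0 j u w * score h Phi w) = Xi P a b X h Phi j u.
Proof. by move=> hPhi uab; have := expectation_point_Y 0 h j hPhi uab; rewrite add0r. Qed.

Lemma integrable_Xi t h j (f : R -> R) Phi : L2 a b f -> Hp a b p Phi ->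
  leb.-integrable `[a, b] (EFin \o (fun u => f u * Xi P a b X h Phi j u)) /\
  \int[leb]_(u in `[a, b]) (f u * Xi P a b X h Phi j u) =
  \int[P]_w (functional leb (cutoff f) (field t j) w * score (t + h) Phi w).
Proof.
move=> /L2_ext Lff hPhi.
have mY := measurable_Y (t + h) hPhi; have iY := integrable_sqr_Y (t + h) hPhi.
have E u : cutoff (fun u => f u * Xi P a b X h Phi j u) u =
    cutoff f u * \int[P]_w (field t j (w, u) * score (t + h) Phi w).
  rewrite /cutoff /curve/=; case: ifPn => uab; last by rewrite mul0r.
  by rewrite expectation_point_Y.
split.
  apply/integrable_ext.
  have := integrable_functional_expectation (Lf t j) Lff mY iY.
  by apply: eq_integrable => // u _ /=; rewrite E.
rewrite Rintegral_ext functional_expectation//.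
by apply: eq_Rintegral => u _; rewrite E.
Qed.

Lemma expectation_YY t h Phi Psi : Hp a b p Phi -> Hp a b p Psi ->
  \int[P]_w (score t Phi w * score (t + h) Psi w) = innerp a b Phi (Xi P a b X h Psi).
Proof.
move=> hPhi hPsi; rewrite /innerp /L2inner.
under [RHS]eq_bigr do rewrite (integrable_Xi t h _ (hPhi _) hPsi).2.
rewrite -Rintegral_sum//.
  by apply: eq_Rintegral => w _; rewrite mulr_suml.
move=> j _; have LP : sqr_integrable leb (cutoff (Phi j)) by apply/L2_ext; exact: hPhi.
apply: integrable_mul_of_sqr.
- exact: measurable_functional.
- exact: measurable_Y.
- by have [] := functional_sqr_le (Lf t j) LP.
- exact: integrable_sqr_Y.
Qed.

(** By [expectation_point_Y0] and Cauchy-Schwarz the square at [u] is at most [B] times the second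
    moment of the score; measurability comes from Fubini, tested against the function 1. *)
Lemma L2_Xi h j Phi : Hp a b p Phi -> L2 a b (Xi P a b X h Phi j).
Proof.
move=> hPhi; apply/L2_ext.
have mY := measurable_Y h hPhi; have iY := integrable_sqr_Y h hPhi.
have L1 : L2 a b (fun=> 1 : R).
  split => //; under eq_integral do rewrite expr1n.
  rewrite integral_cst//= mul1e lebesgue_measure_itv/= lte_fin ab.
  by rewrite -EFinD ltry.
have E u : cutoff (Xi P a b X h Phi j) u = cutoff (fun=> 1) u * \int[P]_w (field 0 j (w, u) * score h Phi w).
  rewrite /cutoff /curve/=; case: ifPn => uab; last by rewrite mul0r.
  by rewrite mul1r expectation_point_Y0.
have L1' := (L2_ext _).1 L1.
have mXi : measurable_fun setT (cutoff (Xi P a b X h Phi j)).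
  have /integrableP[/measurable_EFinP m _] := integrable_functional_expectation (Lf 0 j) L1' mY iY.
  by apply: eq_measurable_fun m => u _; rewrite E.
split => //; set C := \int[P]_w (score h Phi w ^+ 2).
have C0 : 0 <= C by apply: Rintegral_ge0 => w _; exact: sqr_ge0.
apply: (@le_integrableR _ (measurableTypeR R) R leb setT measurableT _ (fun u => B * C * cutoff
  (fun=> 1) u ^+ 2)).
- exact: measurable_funX.
- move=> u _; rewrite ger0_norm ?sqr_ge0// /cutoff; case: ifPn => uab; last by rewrite expr0n mulr0.
  rewrite expr1n mulr1 -expectation_point_Y0//.
  have [mX iX _ _] := centered_point JG MZ 0 j uab.
  apply: le_trans (Rintegral_CauchySchwarz mX mY iX iY) _.
  by rewrite ler_wpM2r// (second_moment_le MZ CS SB).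
- by apply: integrableRZ => //; case: L1'.
Qed.

End covariances.

Lemma sum_even (R : comNzRingType) (f : int -> R) (N : nat) : (forall h, f (- h) = f h) ->
  \sum_(i < (2 * N).+1) f (i%:Z - N%:Z) =
  \sum_(0 <= h < N.+1) (if h == 0%N then f 0 else 2 * f h%:Z).
Proof.
move=> fN; elim: N => [|N IH].
  by rewrite big_ord_recl big_ord0 addr0 big_nat1.
rewrite big_nat_recr//= -IH (_ : (2 * N.+1).+1 = (2 * N).+3); last by rewrite mulnS.
rewrite big_ord_recr big_ord_recl/=.
rewrite (eq_bigr (fun i : 'I_(2 * N).+1 => f (i%:Z - N%:Z))); last first.
  by move=> i _; congr f; rewrite /bump/= add1n; lia.
rewrite (_ : 0%:Z - N.+1%:Z = - N.+1%:Z); last by rewrite sub0r.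
rewrite fN (_ : _ - N.+1%:Z = N.+1%:Z); last by lia.
by ring.
Qed.

(** * From the spectral density to the Toeplitz form *)

Section spectral.
Context d {Omega : measurableType d} {R : realType} (P : probability Omega R).
Variables (a b : R) (p : nat) (X : int -> 'I_p -> R -> Omega -> R) (B : R).
Hypotheses (ab : a < b) (RC : random_curves a b X) (JG : jointly_gaussian P a b X).
Hypotheses (MZ : mean_zero P a b X) (CS : cov_stationary P a b X).
Hypothesis SB : forall (j : 'I_p) (u v : R), u \in `[a, b] -> v \in `[a, b] ->
  `|Sigma P X 0 j j u v| <= B.
Variable F : R -> ('I_p -> R -> R) -> 'I_p -> R -> R[i].
Hypothesis SD : is_spectral_density P a b X F.
Local Notation leb := (@lebesgue_measure R : {sigma_finite_measure set (measurableTypeR R) -> \bar R}).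
Local Notation Y := (score a b X).

Definition autocov (Phi : 'I_p -> R -> R) (h : int) : R := innerp a b Phi (Xi P a b X h Phi).

(** Stationarity with base time [h]: the lag [- h] leads from [h] back to 0. *)
Lemma gam_even Phi h : Hp a b p Phi -> autocov Phi (- h) = autocov Phi h.
Proof.
move=> hPhi; rewrite /autocov -(expectation_YY ab RC JG MZ CS SB h (- h) hPhi hPhi).
rewrite -(expectation_YY ab RC JG MZ CS SB 0 h hPhi hPhi) subrr add0r.
by apply: eq_Rintegral => w _; rewrite mulrC.
Qed.

Lemma expectation_Y2 Phi (s t : nat) : Hp a b p Phi ->
  \int[P]_w (Y s%:Z Phi w * Y t%:Z Phi w) = autocov Phi (s - t + (t - s))%N%:Z.
Proof.
move=> hPhi.
wlog st : s t / (s <= t)%N.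
  move=> h; have [/h//|/ltnW/h] := leqP s t; rewrite addnC => <-.
  by apply: eq_Rintegral => w _; rewrite mulrC.
have -> : (s - t + (t - s))%N = (t - s)%N by lia.
have e : t%:Z = s%:Z + (t - s)%N%:Z by lia.
by rewrite /autocov -(expectation_YY ab RC JG MZ CS SB s%:Z (t - s)%N%:Z hPhi hPhi) -e.
Qed.

Definition re_partial N (theta : R) (Phi : 'I_p -> R -> R) (j : 'I_p) (u : R) : R :=
  \sum_(i < (2 * N).+1) ((2 * pi)^-1 * cos ((i%:Z - N%:Z)%:~R * theta)) *
    Xi P a b X (i%:Z - N%:Z) Phi j u.

Lemma re_partialE N theta Phi j u :
  complex.Re (spectral_partial_sum P a b X N theta Phi j u) = re_partial N theta Phi j u.
Proof.
rewrite /spectral_partial_sum /re_partial.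
rewrite (_ : forall (x : R) (z : R[i]), complex.Re (x%:C%C * z) = x * complex.Re z); last first.
  by move=> x [r s]; rewrite /GRing.mul/= mul0r subr0.
rewrite raddf_sum mulr_sumr; apply: eq_bigr => i _ /=.
by rewrite mul0r subr0 cosN; ring.
Qed.

Lemma innerp_re_partial N theta Phi : Hp a b p Phi ->
  2 * pi * innerp a b Phi (re_partial N theta Phi) =
  \sum_(0 <= h < N.+1) (if h == 0%N then autocov Phi 0 else 2 * autocov Phi h%:Z) * cos (h%:R * theta).
Proof.
move=> hPhi.
have pi0 : 2 * pi != 0 :> R by rewrite mulf_neq0// gt_eqF// pi_gt0.
have iXi h j := integrable_Xi ab RC JG MZ CS SB 0 h j (hPhi j) hPhi.
transitivity (\sum_(i < (2 * N).+1) cos ((i%:Z - N%:Z)%:~R * theta) * autocov Phi (i%:Z - N%:Z)).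
  rewrite /innerp mulr_sumr /autocov /innerp.
  under [RHS]eq_bigr do rewrite mulr_sumr.
  rewrite [RHS]exchange_big/=; apply: eq_bigr => j _.
  rewrite /L2inner /re_partial.
  transitivity (2 * pi * \int[leb]_(u in `[a, b]) (\sum_(i < (2 * N).+1)
     ((2 * pi)^-1 * cos ((i%:Z - N%:Z)%:~R * theta)) * (Phi j u * Xi P a b X (i%:Z - N%:Z) Phi j u))).
    congr (_ * _); apply: eq_Rintegral => u _; rewrite mulr_sumr; apply: eq_bigr => i _.
    by rewrite mulrCA.
  rewrite (@Rintegral_sum _ (measurableTypeR R) R leb)//; last first.
    by move=> i _; apply: integrableRZ => //; exact: (iXi _ _).1.
  rewrite mulr_sumr; apply: eq_bigr => i _.
  rewrite RintegralZl//; last exact: (iXi _ _).1.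
  by rewrite !mulrA mulfV// mul1r.
rewrite (@sum_even _ (fun h => cos (h%:~R * theta) * autocov Phi h)); last first.
  by move=> h; rewrite gam_even// mulrNz mulNr cosN.
apply: eq_big_nat => -[|h] _ /=; first by rewrite mulrC.
by rewrite mulrA mulrAC.
Qed.

Definition im_partial N (theta : R) (Phi : 'I_p -> R -> R) (j : 'I_p) (u : R) : R :=
  \sum_(i < (2 * N).+1) ((2 * pi)^-1 * sin (- ((i%:Z - N%:Z)%:~R * theta))) *
    Xi P a b X (i%:Z - N%:Z) Phi j u.

Lemma im_partialE N theta Phi j u :
  complex.Im (spectral_partial_sum P a b X N theta Phi j u) = im_partial N theta Phi j u.
Proof.
rewrite /spectral_partial_sum /im_partial.
rewrite (_ : forall (x : R) (z : R[i]), complex.Im (x%:C%C * z) = x * complex.Im z); last first.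
  by move=> x [r s]; rewrite /GRing.mul/= mul0r addr0.
rewrite raddf_sum mulr_sumr; apply: eq_bigr => i _ /=.
by rewrite mul0r addr0; ring.
Qed.

Lemma L2_lincomb (I : finType) (k : I -> R) (h : I -> int) Phi j : Hp a b p Phi ->
  L2 a b (fun u => \sum_i k i * Xi P a b X (h i) Phi j u).
Proof.
move=> hPhi; apply/L2_ext.
have E : cutoff a b (fun u => \sum_i k i * Xi P a b X (h i) Phi j u) =
    (fun u => \sum_i k i * cutoff a b (Xi P a b X (h i) Phi j) u).
  apply/funext => u; rewrite /cutoff; case: ifP => // _.
  by rewrite big1// => i _; rewrite mulr0.
have L i := (L2_ext a b _).1 (L2_Xi ab RC JG MZ CS SB (h i) j hPhi).
rewrite E; split.
  by apply: measurable_sum => i; apply: measurable_funM => //; case: (L i).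
by apply: (@integrable_sqr_sum _ (measurableTypeR R)) => i; case: (L i).
Qed.

Lemma innerp_sub_sqr_le (Phi G H : 'I_p -> R -> R) (e : R) :
  Hp a b p Phi -> Hp a b p G -> Hp a b p H ->
  (forall j, (\int[leb]_(u in `[a, b]) ((G j u - H j u) ^+ 2)%:E <= e%:E)%E) ->
  (innerp a b Phi G - innerp a b Phi H) ^+ 2 <=
    (p%:R * \sum_j \int[leb]_u (cutoff a b (Phi j) u ^+ 2)) * e.
Proof.
move=> hPhi hG hH le_e.
have LP j := (L2_ext a b _).1 (hPhi j).
have LG j := (L2_ext a b _).1 (hG j).
have LH j := (L2_ext a b _).1 (hH j).
have extM (f g : R -> R) u : cutoff a b (fun u => f u * g u) u = cutoff a b f u * cutoff a b g u.
  by rewrite /cutoff; case: ifP => //; rewrite mul0r.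
rewrite /innerp -sumrB.
have p_size : size (index_enum 'I_p) = p by rewrite -[RHS](card_ord p) cardT enumT.
apply: le_trans (sqr_sum_le _ _) _; rewrite p_size -mulrA ler_wpM2l// mulr_suml.
apply: ler_sum => j _; rewrite /L2inner !Rintegral_ext.
have [[mP iP] [mG iG] [mH iH]] := And3 (LP j) (LG j) (LH j).
have iD : leb.-integrable setT (EFin \o (fun u => (cutoff a b (G j) u - cutoff a b (H j) u) ^+ 2)).
  rewrite (_ : (fun u => _) = (fun u => (1 * cutoff a b (G j) u + (-1) * cutoff a b (H j) u) ^+ 2)).
    exact: (@integrable_sqrD _ (measurableTypeR R)).
  by apply/funext => w; rewrite mul1r mulN1r.
under eq_Rintegral do rewrite extM.
under [X in _ - X]eq_Rintegral do rewrite extM.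
rewrite -RintegralB//; try exact: (@integrable_mul_of_sqr _ (measurableTypeR R) R leb).
under eq_Rintegral do rewrite -mulrBr.
have CSj := @Rintegral_CauchySchwarz _ (measurableTypeR R) R leb _ _ mP (measurable_funB mG mH) iP iD.
apply: (le_trans CSj); rewrite ler_wpM2l//; first by apply: Rintegral_ge0 => u _; exact: sqr_ge0.
rewrite -lee_fin /Rintegral fineK; last exact: (integrable_fin_num measurableT iD).
apply: le_trans (le_e j); rewrite integral_ext le_eqVlt; apply/orP; left; apply/eqP.
apply: eq_integral => u _; congr EFin.
by rewrite /cutoff/=; case: ifP => // _; rewrite subrr expr0n.
Qed.

(** Norm convergence of the partial sums gives convergence of their inner products with [Phi], by
    Cauchy-Schwarz; evenness of the autocovariance makes the real parts a cosine series. *)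
Lemma spectral_series_cvg Phi theta : Hp a b p Phi -> theta \in `[- pi, pi] ->
  series (fun h => (if h == 0%N then autocov Phi 0 else 2 * autocov Phi h%:Z) * cos (h%:R * theta)) @ \oo -->
    2 * pi * complex.Re (innerC a b Phi (F theta Phi)).
Proof.
move=> hPhi th; have [[hRe hIm] cv] := SD th hPhi.
suff cvI : (fun N => 2 * pi * innerp a b Phi (re_partial N theta Phi)) @ \oo -->
    2 * pi * innerp a b Phi (Re_fun (F theta Phi)).
  rewrite -cvg_shiftS; apply: cvg_trans cvI; apply: near_eq_cvg; apply: nearW => N.
  by rewrite innerp_re_partial.
apply: cvgM; first exact: cvg_cst.
set G := F theta Phi in hRe hIm cv *.
have LR N : Hp a b p (re_partial N theta Phi) by move=> j; exact: L2_lincomb.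
have LI N : Hp a b p (im_partial N theta Phi) by move=> j; exact: L2_lincomb.
pose K := p%:R * \sum_j \int[leb]_u (cutoff a b (Phi j) u ^+ 2).
have K0 : 0 <= K.
  by rewrite mulr_ge0// sumr_ge0// => j _; apply: Rintegral_ge0 => u _; exact: sqr_ge0.
apply/cvgrPdist_le => e e0.
(* [K] is the factor in [innerp_sub_sqr_le]; the squared error will be at most
   [K * (e ^+ 2 / (K + 1)) <= e ^+ 2]. *)
have d0 : 0 < e ^+ 2 / (K + 1) by rewrite divr_gt0 ?exprn_gt0// ltr_wpDl.
have ev : \forall N \near \oo, (sqnormC a b (fun j u =>
   (spectral_partial_sum P a b X N theta Phi j u - G j u)%R) <= (e ^+ 2 / (K + 1))%:E)%E.
  have [fn /cvgrPdist_le/(_ _ d0) fcv] := (fine_cvgP _ _).1 cv.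
  apply: filterS2 fn fcv => N fN; rewrite sub0r normrN => h.
  by rewrite -[X in (X <= _)%E]fineK// lee_fin; apply: le_trans h; exact: ler_norm.
apply: filterS ev => N hN.
have le2 : (innerp a b Phi (re_partial N theta Phi) - innerp a b Phi (Re_fun G)) ^+ 2 <= K * (e ^+
  2 / (K + 1)).
  apply: innerp_sub_sqr_le => // j.
  apply: le_trans hN; rewrite /sqnormC (bigD1 j)//=.
  have nn i : (0 <= \int[leb]_(u in `[a, b]) (Normc.normc (spectral_partial_sum P a b X N theta Phi
    i u - G i u)%R ^+ 2)%:E)%E.
    by apply: integral_ge0 => u _; rewrite lee_fin sqr_ge0.
  apply: (@le_trans _ _ (\int[leb]_(u in `[a, b]) (Normc.normc (spectral_partial_sum P a b X N
    theta Phi j u - G j u)%R ^+ 2)%:E)%E); last first.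
    by rewrite leeDl// sume_ge0.
  have E u : Normc.normc (spectral_partial_sum P a b X N theta Phi j u - G j u) ^+ 2 =
      (re_partial N theta Phi j u - Re_fun G j u) ^+ 2 + (im_partial N theta Phi j u - Im_fun G j u) ^+ 2.
    rewrite -re_partialE -im_partialE /Re_fun /Im_fun.
    case: (spectral_partial_sum _ _ _ _ _ _ _ _ _) => r s; case: (G j u) => r' s' /=.
    by rewrite sqr_sqrtr// addr_ge0 ?sqr_ge0.
  apply: ge0_le_integral => //.
  - by move=> u _; rewrite lee_fin sqr_ge0.
  - apply/measurable_EFinP; apply: measurable_funX; apply: measurable_funB.
      by have [] := LR N j.
    by have [] := hRe j.
  - apply/measurable_EFinP.
    apply: (@eq_measurable_fun _ _ _ _ _ (fun u => (re_partial N theta Phi j u - Re_fun G j u) ^+ 2 +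
      (im_partial N theta Phi j u - Im_fun G j u) ^+ 2)); first by move=> u _; rewrite -E.
    apply: measurable_funD; apply: measurable_funX; apply: measurable_funB.
    + by have [] := LR N j.
    + by have [] := hRe j.
    + by have [] := LI N j.
    + by have [] := hIm j.
  - by move=> u _; rewrite lee_fin E lerDl sqr_ge0.
rewrite -(@ler_pXn2r _ 2)// ?nnegrE ?(ltW e0)// real_normK ?num_real//.
rewrite -sqrrN opprB /innerC/=; apply: (le_trans le2).
rewrite mulrCA ler_piMr ?sqr_ge0// ler_pdivrMr ?mul1r ?lerDl//.
by rewrite ltr_wpDl.
Qed.

(** The left side is the Toeplitz form of [autocov Phi] at the distances of the indices, so
    [toeplitz_le_ae_pi] applies to the cosine series of [spectral_series_cvg]. *)
Lemma quadratic_form_le Phi (M : R) n (c : 'I_n -> R) : Hp a b p Phi ->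
  leb.-negligible (`[- pi, pi]%classic `&`
    [set x | (M < 2 * pi * complex.Re (innerC a b Phi (F x Phi)))%R]) ->
  \int[P]_w ((\sum_(t < n) c t * Y (t.+1)%:Z Phi w) ^+ 2) <= M * \sum_(t < n) c t ^+ 2.
Proof.
move=> hPhi neg.
have := @toeplitz_le_ae_pi R (fun h => autocov Phi h%:Z) _ M (fun x hx => spectral_series_cvg hPhi
  hx) neg n c.
apply: le_trans; rewrite le_eqVlt; apply/orP; left; apply/eqP.
have mY t := measurable_Y ab RC JG MZ CS SB t hPhi.
have iY t := integrable_sqr_Y ab RC JG MZ CS SB t hPhi.
have iYY s t : P.-integrable setT (EFin \o (fun w => Y s Phi w * Y t Phi w)).
  exact: integrable_mul_of_sqr.
transitivity (\int[P]_w (\sum_s \sum_t (c s * c t) * (Y (s.+1)%:Z Phi w * Y (t.+1)%:Z Phi w))).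
  apply: eq_Rintegral => w _; rewrite expr2 mulr_suml; apply: eq_bigr => i _.
  by rewrite mulr_sumr; apply: eq_bigr => j _; ring.
rewrite Rintegral_sum//; last first.
  by move=> i _; apply: integrableR_sum => // j _; exact: integrableRZ.
apply: eq_bigr => s _; rewrite Rintegral_sum//; last by move=> j _; exact: integrableRZ.
apply: eq_bigr => t _; by rewrite RintegralZl// expectation_Y2// !subSS.
Qed.

End spectral.

(** * Tail bounds *)

Lemma measurable_param_Rintegral d1 d2 (T1 : measurableType d1) (T2 : measurableType d2)
    (R : realType) (mu : {sigma_finite_measure set T2 -> \bar R}) (f : T1 * T2 -> R) :
  measurable_fun setT f -> measurable_fun setT (fun x => \int[mu]_y f (x, y)).
Proof.
move=> mf; apply: measurableT_comp; first exact: fine_measurable.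
have mE : measurable_fun setT (EFin \o f) by exact/measurable_EFinP.
rewrite (_ : (fun x => _) = (fun x => (fubini_F mu ((EFin \o f)^\+)%E x - fubini_F mu ((EFin \o
  f)^\-)%E x)%E)); last first.
  apply/funext => x; rewrite integralE.
  by congr (_ - _)%E; apply: eq_integral => y _; rewrite ?funeposE ?funenegE.
apply: emeasurable_funB; apply: measurable_fun_fubini_tonelli_F => //.
- exact: measurable_funepos.
- exact: measurable_funeneg.
Qed.

Lemma le_measure_ae d (T : measurableType d) (R : realType) (mu : {measure set T -> \bar R})
    (A B : set T) : measurable A -> measurable B ->
  {ae mu, forall x, A x -> B x} -> (mu A <= mu B)%E.
Proof.
move=> mA mB [N [mN N0 hN]].
apply: (@le_trans _ _ (mu (B `|` N))).
  apply: le_measure; rewrite ?inE//; first exact: measurableU.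
  move=> x Ax; have [xB|xB] := pselect (B x); first by left.
  by right; apply: hN => /= /(_ Ax).
by apply: le_trans (measureU2 _ mB mN) _; rewrite [X in (_ + X <= _)%E](_ : _ = 0%E) ?adde0.
Qed.

(** * The empirical operator in terms of scores *)

Section deviation.
Context d {Omega : measurableType d} {R : realType} (P : probability Omega R).
Variables (a b : R) (p : nat) (X : int -> 'I_p -> R -> Omega -> R) (B : R).
Hypotheses (ab : a < b) (RC : random_curves a b X) (JG : jointly_gaussian P a b X).
Hypotheses (MZ : mean_zero P a b X) (CS : cov_stationary P a b X).
Hypothesis SB : forall (j : 'I_p) (u v : R), u \in `[a, b] -> v \in `[a, b] ->
  `|Sigma P X 0 j j u v| <= B.
Local Notation leb := (@lebesgue_measure R : {sigma_finite_measure set (measurableTypeR R) -> \bar R}).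
Local Notation field := (curve a b X).
Local Notation Y := (score a b X).
Local Notation ext := (cutoff a b).

Let Lf t j : L2field P leb (field t j). Proof. exact: (L2field_field ab RC JG MZ CS SB). Qed.

Let kern n (Psi : 'I_p -> R -> R) j k (z : (Omega * measurableTypeR R) * measurableTypeR R) : R :=
  (n%:R^-1 * \sum_(1 <= t < n.+1) field t%:Z j z.1 * field t%:Z k (z.1.1, z.2)) * ext (Psi k) z.2.

Let measurable_kern n Psi j k : Hp a b p Psi -> measurable_fun setT (kern n Psi j k).
Proof.
move=> hPsi; have [mP _] := (L2_ext a b _).1 (hPsi k).
apply: measurable_funM; last exact: measurableT_comp mP measurable_snd.
apply: measurable_funM => //; apply: measurable_sum => t.
have mf k' := measurable_field RC t%:Z k'.
apply: measurable_funM; first exact: measurableT_comp (mf j) measurable_fst.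
apply: measurableT_comp (mf k) _; apply: measurable_fun_pair; last exact: measurable_snd.
exact: measurableT_comp measurable_fst measurable_fst.
Qed.

Let hatE n Psi w j u : u \in `[a, b] ->
  Xi0_hat a b X n w Psi j u = \sum_k \int[leb]_v kern n Psi j k ((w, u), v).
Proof.
move=> uab; apply: eq_bigr => k _; rewrite Rintegral_ext; apply: eq_Rintegral => v _.
rewrite /kern /cutoff /curve/=; case: ifPn => vab; last by rewrite mulr0.
by rewrite uab.
Qed.

(** [le_measure_ae] compares measurable events, while [deviation] is tied to the scores only almost
    surely; its measurability is therefore obtained from its definition. *)
Lemma measurable_deviation n Phi Psi : Hp a b p Phi -> Hp a b p Psi ->
  measurable_fun setT (deviation P a b X n Phi Psi).
Proof.
move=> hPhi hPsi.
pose g j (z : Omega * measurableTypeR R) := ext (Phi j) z.2 *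
  (\sum_k \int[leb]_v kern n Psi j k (z, v) - ext (Xi P a b X 0 Psi j) z.2).
have -> : deviation P a b X n Phi Psi = (fun w => \sum_j \int[leb]_u g j (w, u)).
  apply/funext => w; apply: eq_bigr => j _; rewrite /L2inner Rintegral_ext.
  apply: eq_Rintegral => u _; rewrite /g {1 2}/cutoff/=; case: ifPn => uab; last by rewrite mul0r.
  by rewrite hatE// /cutoff uab.
apply: measurable_sum => j; apply: measurable_param_Rintegral.
have [mP _] := (L2_ext a b _).1 (hPhi j).
have [mXi _] := (L2_ext a b _).1 (L2_Xi ab RC JG MZ CS SB 0 j hPsi).
apply: measurable_funM; first exact: measurableT_comp mP measurable_snd.
apply: measurable_funB; last exact: measurableT_comp mXi measurable_snd.
apply: measurable_sum => k; apply: measurable_param_Rintegral; exact: measurable_kern.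
Qed.

(** Almost surely the finitely many functionals involved are all integrals of integrable functions;
    on that event the sums and integrals in [Xi0_hat] may be exchanged. *)
Lemma deviationE n Phi Psi : Hp a b p Phi -> Hp a b p Psi ->
  {ae P, forall w, deviation P a b X n Phi Psi w =
    n%:R^-1 * (\sum_(t < n) Y t.+1%:Z Phi w * Y t.+1%:Z Psi w) -
    innerp a b Phi (Xi P a b X 0 Psi)}.
Proof.
move=> hPhi hPsi.
have LPhi j := (L2_ext a b _).1 (hPhi j); have LPsi j := (L2_ext a b _).1 (hPsi j).
have ae1 : {ae P, forall w, forall (t : 'I_n) (j : 'I_p),
    leb.-integrable setT (EFin \o (fun u => ext (Phi j) u * field t.+1%:Z j (w, u)))}.
  apply: filter_forall => t; apply: filter_forall => j.
  exact: ae_integrable_functional.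
have ae2 : {ae P, forall w, forall (t : 'I_n) (j : 'I_p),
    leb.-integrable setT (EFin \o (fun u => ext (Psi j) u * field t.+1%:Z j (w, u)))}.
  apply: filter_forall => t; apply: filter_forall => j.
  exact: ae_integrable_functional.
apply: filterS2 ae1 ae2 => w i1 i2.
have hat j u : u \in `[a, b] -> Xi0_hat a b X n w Psi j u =
    n%:R^-1 * \sum_(t < n) X t.+1%:Z j u w * Y t.+1%:Z Psi w.
  move=> uab; rewrite hatE// /score.
  transitivity (\sum_k \int[leb]_v (\sum_(t < n) (n%:R^-1 * X t.+1%:Z j u w) * (ext (Psi k) v *
    field t.+1%:Z k (w, v)))).
    apply: eq_bigr => k _; apply: eq_Rintegral => v _.
    rewrite /kern big_add1/= big_mkord mulr_sumr mulr_suml; apply: eq_bigr => t _.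
    by rewrite {1}/curve/= uab; ring.
  rewrite mulr_sumr; under [RHS]eq_bigr do rewrite mulr_sumr mulr_sumr.
  rewrite [RHS]exchange_big/=; apply: eq_bigr => k _.
  rewrite (@Rintegral_sum _ (measurableTypeR R) R leb)//; last first.
    by move=> t _; apply: integrableRZ => //; exact: i2.
  apply: eq_bigr => t _; rewrite RintegralZl//; last exact: i2.
  by rewrite mulrA.
rewrite /deviation /innerp /L2inner.
transitivity (\sum_j (n%:R^-1 * (\sum_(t < n) functional leb (ext (Phi j)) (field t.+1%:Z j) w * Y
  t.+1%:Z Psi w) -
    \int[leb]_(u in `[a, b]) (Phi j u * Xi P a b X 0 Psi j u))); last first.
  rewrite sumrB; congr (_ - _); rewrite -mulr_sumr exchange_big/=; congr (_ * _).
  by apply: eq_bigr => t _; rewrite -mulr_suml.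
apply: eq_bigr => j _.
have [/integrable_ext iXi _] := integrable_Xi ab RC JG MZ CS SB 0 0 j (hPhi j) hPsi.
rewrite !Rintegral_ext.
transitivity (\int[leb]_u ((\sum_(t < n) (n%:R^-1 * Y t.+1%:Z Psi w) * (ext (Phi j) u * field
  t.+1%:Z j (w, u))) -
   ext (fun u => Phi j u * Xi P a b X 0 Psi j u) u)).
  apply: eq_Rintegral => u _; rewrite /cutoff /curve/=; case: ifPn => uab; last first.
    by rewrite big1 ?subr0// => t _; rewrite !mulr0.
  rewrite hat// mulrBr; congr (_ - _).
  rewrite mulr_sumr mulr_sumr; apply: eq_bigr => t _; ring.
rewrite RintegralB//; last first.
  apply: (@integrableR_sum _ (measurableTypeR R) R leb) => // t _.
  by apply: integrableRZ => //; exact: i1.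
congr (_ - _).
rewrite (@Rintegral_sum _ (measurableTypeR R) R leb)//; last first.
  by move=> t _; apply: integrableRZ => //; exact: i1.
rewrite mulr_sumr; apply: eq_bigr => t _; rewrite RintegralZl//; last exact: i1.
by rewrite -mulrA [Y _ _ _ * _]mulrC.
Qed.

End deviation.

Lemma sqrD_le (R : realType) (x y s : R) : s ^+ 2 = 1 ->
  (1 * x + s * y) ^+ 2 <= 2 * x ^+ 2 + 2 * y ^+ 2.
Proof.
by move=> s1; have := sqr_ge0 (x - s * y); rewrite mul1r sqrrB sqrrD !exprMn s1; lra.
Qed.

Lemma lin_comb_le (R : realType) (x y r g1 g2 q : R) : y <= r * g2 * q -> x <= r * g1 * q ->
  2 * x + 2 * y <= 2 * (r * (g1 + g2)) * q.
Proof. lra. Qed.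

Lemma lt_normB_split (R : realType) (x y r v eta : R) : r * eta * v * 4 < `|x - y| ->
  2 * (r * v) * eta < `|x| \/ 2 * (r * v) * eta < `|y|.
Proof.
move=> h; have [hx|hx] := ltP (2 * (r * v) * eta) `|x|; first by left.
by right; have := ler_normB x y; move: h hx; lra.
Qed.

(** * Concentration of the quadratic and bilinear forms *)

Section tails.
Context d {Omega : measurableType d} {R : realType} (P : probability Omega R).
Variables (a b : R) (p : nat) (X : int -> 'I_p -> R -> Omega -> R) (B : R).
Hypotheses (ab : a < b) (RC : random_curves a b X) (JG : jointly_gaussian P a b X).
Hypotheses (MZ : mean_zero P a b X) (CS : cov_stationary P a b X).
Hypothesis SB : forall (j : 'I_p) (u v : R), u \in `[a, b] -> v \in `[a, b] ->
  `|Sigma P X 0 j j u v| <= B.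
Hypothesis SC : forall j : 'I_p, {within (`[a, b] `*` `[a, b]),
  continuous (fun z : R * R => Sigma P X 0 j j z.1 z.2)}.
Variable F : R -> ('I_p -> R -> R) -> 'I_p -> R -> R[i].
Hypothesis SD : is_spectral_density P a b X F.
Local Notation leb := (@lebesgue_measure R : {sigma_finite_measure set (measurableTypeR R) -> \bar R}).
Local Notation Y := (score a b X).
Local Notation ext := (cutoff a b).
Local Notation gam := (autocov P a b X).

(** Outside one null set of frequencies the supremum over all directions is bounded, in particular
    the quotient at [Phi]. The measure there is Lebesgue measure restricted to [[-pi, pi]], so the
    null set is intersected with that interval. *)
Lemma stability_negligible k r Phi : (stability_k P a b X F k <= r%:E)%E ->
  H0p P a b X Phi -> (norm0 a b Phi <= k)%N ->
  leb.-negligible (`[- pi, pi]%classic `&`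
    [set x | (r * gam Phi 0 < 2 * pi * complex.Re (innerC a b Phi (F x Phi)))%R]).
Proof.
move=> stab [hPhi v0] nk.
have pi2 : 0 < 2 * pi :> R by rewrite mulr_gt0// pi_gt0.
move: stab; rewrite /stability_k /stability_on.
set es := ess_sup _ _ => stab.
have {stab} : (es <= (r / (2 * pi))%:E)%E.
  rewrite -(@lee_pmul2l _ (2 * pi)%:E)// -EFinM.
  by rewrite [2 * pi * (r / _)]mulrC mulfVK// gt_eqF.
move=> /ess_supP[N [mN N0 hN]].
exists (N `&` `[- pi, pi]%classic); split => //.
- exact: measurableI.
move=> x [xpi /= lt]; split => //; apply: hN => /= le.
have : ((rayleigh P a b X F x Phi)%:E <= (r / (2 * pi))%:E)%E.
  apply: le_trans le; apply: ereal_sup_ubound; exists Phi => //.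
rewrite lee_fin /rayleigh -/(gam Phi 0) => h.
move: lt; apply/negP; rewrite -leNgt.
move: h; rewrite ler_pdivrMr// mulrAC ler_pdivlMr//.
by rewrite mulrC.
Qed.

Lemma Y_form_le k r Phi n (c : 'I_n -> R) : (stability_k P a b X F k <= r%:E)%E ->
  H0p P a b X Phi -> (norm0 a b Phi <= k)%N ->
  \int[P]_w ((\sum_(t < n) c t * Y (t.+1)%:Z Phi w) ^+ 2) <= r * gam Phi 0 * \sum_(t < n) c t ^+ 2.
Proof.
move=> stab hPhi nk; apply: (quadratic_form_le ab RC JG MZ CS SB SD) => //; first by case: hPhi.
exact: stability_negligible nk.
Qed.

Lemma expectation_YY0 t Phi Psi : Hp a b p Phi -> Hp a b p Psi ->
  \int[P]_w (Y t Phi w * Y t Psi w) = innerp a b Phi (Xi P a b X 0 Psi).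
Proof. by move=> h1 h2; rewrite -(expectation_YY ab RC JG MZ CS SB t 0 h1 h2) addr0. Qed.

(** The form bound for a single observation reads [gam Phi 0 <= r * gam Phi 0]. It makes the scale
    [r * gam Phi 0] positive and excludes the value [-oo] of the stability measure. *)
Lemma stability_ge1 k r Phi : (stability_k P a b X F k <= r%:E)%E ->
  H0p P a b X Phi -> (norm0 a b Phi <= k)%N -> 1 <= r.
Proof.
move=> stab hPhi nk; have := @Y_form_le k r Phi 1 (fun=> 1) stab hPhi nk.
case: hPhi => hPhi v0.
rewrite big_ord1 expr1n mulr1.
under eq_Rintegral do rewrite big_ord1 mul1r expr2.
by rewrite expectation_YY0// -/(gam Phi 0) -{1}[gam Phi 0]mul1r ler_pM2r.
Qed.

Lemma Y_centered Phi n (c : 'I_n -> R) : Hp a b p Phi ->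
  centered_gaussian P (fun w => \sum_(t < n) c t * Y t.+1%:Z Phi w).
Proof.
move=> hPhi.
have := @functional_centered _ _ _ P a b p X ab RC JG MZ CS B SB SC ('I_n * 'I_p)%type
  (fun z => c z.1) (fun z => z.1.+1%:Z) (fun z => z.2) (fun z => ext (Phi z.2))
  (fun z => (L2_ext a b _).1 (hPhi z.2)).
congr centered_gaussian; apply/funext => w.
rewrite -(pair_bigA _ (fun (t : 'I_n) j => c t * functional leb (ext (Phi j)) (curve a b X t.+1%:Z j) w))/=.
by apply: eq_bigr => t _; rewrite mulr_sumr.
Qed.

Lemma Hp_lin Phi Psi (x y : R) : Hp a b p Phi -> Hp a b p Psi ->
  Hp a b p (fun j u => x * Phi j u + y * Psi j u).
Proof.
move=> h1 h2 j; apply/L2_ext.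
have [m1 i1] := (L2_ext a b _).1 (h1 j); have [m2 i2] := (L2_ext a b _).1 (h2 j).
rewrite (_ : ext _ = (fun u => x * ext (Phi j) u + y * ext (Psi j) u)).
  split; first by apply: measurable_funD; apply: measurable_funM.
  exact: (@integrable_sqrD _ (measurableTypeR R)).
by apply/funext => u; rewrite /cutoff; case: ifP => // _; rewrite !mulr0 addr0.
Qed.

Lemma Y_lin t Phi Psi (x y : R) : Hp a b p Phi -> Hp a b p Psi ->
  {ae P, forall w, Y t (fun j u => x * Phi j u + y * Psi j u) w = x * Y t Phi w + y * Y t Psi w}.
Proof.
move=> h1 h2.
have : {ae P, forall w, forall j, functional leb (fun u => x * ext (Phi j) u + y * ext (Psi j) u)
  (curve a b X t j) w =
    x * functional leb (ext (Phi j)) (curve a b X t j) w + y * functional leb (ext (Psi j)) (curve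
      a b X t j) w}.
  apply: filter_forall => j; apply: functional_lin.
  - exact: (L2field_field ab RC JG MZ CS SB).
  - exact: ((L2_ext a b _).1 (h1 j)).
  - exact: ((L2_ext a b _).1 (h2 j)).
apply: filterS => w h; rewrite /score !mulr_sumr -big_split/=; apply: eq_bigr => j _.
rewrite -h; congr functional; apply/funext => u.
by rewrite /cutoff; case: ifP => // _; rewrite !mulr0 addr0.
Qed.

Variables (n : nat) (eta : R).
Hypotheses (n0 : (0 < n)%N) (eta0 : 0 < eta).

Let avg (f : 'I_n -> R) : R := n%:R^-1 * \sum_t f t.

Let dev Phi w : R := avg (fun t => Y t.+1%:Z Phi w ^+ 2) - gam Phi 0.

Let measurable_dev Phi : Hp a b p Phi -> measurable_fun setT (dev Phi).
Proof.
move=> hPhi; apply: measurable_funB => //; apply: measurable_funM => //.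
by apply: measurable_sum => t; apply: measurable_funX; exact: (measurable_Y ab RC JG MZ CS SB).
Qed.

Let avg_cst (x : R) : avg (fun=> x) = x.
Proof.
by rewrite /avg sumr_const card_ord -(mulr_natl x) mulKf// pnatr_eq0 -lt0n.
Qed.

Let bound : R := expR (- (16^-1 * n%:R * Num.min (eta ^+ 2) eta)).

Lemma Y_tail Phi K : Hp a b p Phi -> 0 < K ->
  (forall c : 'I_n -> R, \int[P]_w ((\sum_(t < n) c t * Y t.+1%:Z Phi w) ^+ 2) <= K * \sum_(t < n)
    c t ^+ 2) ->
  (P [set w | (K * eta < `|dev Phi w|)%R] <= (2 * bound)%:E)%E.
Proof.
move=> hPhi K0 form.
have := gaussian_vector_concentration n0 K0 (fun c => @Y_centered Phi n c hPhi) form eta0.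
suff -> : n%:R^-1 * (\sum_(t < n) \int[P]_w (Y t.+1%:Z Phi w ^+ 2)) = gam Phi 0 by [].
rewrite -[RHS]avg_cst; congr (_ * _); apply: eq_bigr => t _.
by under eq_Rintegral do rewrite expr2; rewrite expectation_YY0.
Qed.

Lemma diag_tail k r Phi : (stability_k P a b X F k <= r%:E)%E ->
  H0p P a b X Phi -> (norm0 a b Phi <= k)%N ->
  (P [set w | (r * eta < `|deviation P a b X n Phi Phi w / gam Phi 0|)%R] <= (2 * bound)%:E)%E.
Proof.
move=> stab H nk; have [hPhi v0] := H; rewrite -/(gam Phi 0) in v0.
have r0 : 0 < r by apply: lt_le_trans (stability_ge1 stab H nk).
have K0 : 0 < r * gam Phi 0 by rewrite mulr_gt0.
have := Y_tail hPhi K0 (fun c => @Y_form_le k r Phi n c stab H nk).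
apply: le_trans; apply: le_measure_ae.
- apply: measurable_set_gt; apply: measurableT_comp => //; apply: measurable_funM => //.
  exact: (measurable_deviation ab RC JG MZ CS SB).
- by apply: measurable_set_gt; apply: measurableT_comp => //; exact: measurable_dev.
apply: filterS (deviationE ab RC JG MZ CS SB n hPhi hPhi) => w /= ->.
rewrite normrM normfV (gtr0_norm v0) ltr_pdivlMr// mulrAC.
by rewrite /dev /avg; under eq_bigr do rewrite -expr2.
Qed.

(* Polarization; only the variances of [Phi +- Psi], not their supports, are needed,
   and those are controlled by the parallelogram inequality. *)
Lemma cross_tail k r Phi Psi : (stability_k P a b X F k <= r%:E)%E ->
  H0p P a b X Phi -> (norm0 a b Phi <= k)%N ->
  H0p P a b X Psi -> (norm0 a b Psi <= k)%N ->
  (P [set w | (r * eta < `|deviation P a b X n Phi Psi w / (gam Phi 0 + gam Psi 0)|)%R] <= (4 * bound)%:E)%E.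
Proof.
move=> stab H1 nk1 H2 nk2; have [h1 v1] := H1; have [h2 v2] := H2.
rewrite -/(gam Phi 0) in v1; rewrite -/(gam Psi 0) in v2.
have r0 : 0 < r by apply: lt_le_trans (stability_ge1 stab H1 nk1).
pose v := gam Phi 0 + gam Psi 0; have v0 : 0 < v := addr_gt0 v1 v2.
(* For both signs [s], the variance form of the scores of [S s] is at most twice the sum of those
   for [Phi] and [Psi]. *)
pose K := 2 * (r * v); have K0 : 0 < K by rewrite !mulr_gt0.
pose S (s : R) : 'I_p -> R -> R := fun j u => 1 * Phi j u + s * Psi j u.
have hS s : Hp a b p (S s) by exact: Hp_lin.
have YS s t : {ae P, forall w, Y t (S s) w = 1 * Y t Phi w + s * Y t Psi w} by exact: Y_lin.
have mY t Phi' : Hp a b p Phi' -> measurable_fun setT (Y t Phi').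
  exact: (measurable_Y ab RC JG MZ CS SB).
have iY t Phi' : Hp a b p Phi' -> P.-integrable setT (EFin \o (fun w => Y t Phi' w ^+ 2)).
  exact: (integrable_sqr_Y ab RC JG MZ CS SB).
have iC (c : 'I_n -> R) Phi' : Hp a b p Phi' ->
    P.-integrable setT (EFin \o (fun w => (\sum_t c t * Y t.+1%:Z Phi' w) ^+ 2)).
  by move=> h; apply: integrable_sqr_sum => t; [exact: mY|exact: iY].
have mC (c : 'I_n -> R) Phi' : Hp a b p Phi' -> measurable_fun setT (fun w => \sum_t c t * Y t.+1%:Z Phi' w).
  by move=> h; apply: measurable_sum => t; apply: measurable_funM => //; exact: mY.
have form s : s ^+ 2 = 1 -> forall c : 'I_n -> R,
    \int[P]_w ((\sum_(t < n) c t * Y t.+1%:Z (S s) w) ^+ 2) <= K * \sum_(t < n) c t ^+ 2.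
  move=> s1 c.
  pose A w := \sum_t c t * Y t.+1%:Z Phi w; pose C w := \sum_t c t * Y t.+1%:Z Psi w.
  have iA : P.-integrable setT (EFin \o (fun w => A w ^+ 2)) by exact: iC.
  have iCC : P.-integrable setT (EFin \o (fun w => C w ^+ 2)) by exact: iC.
  have -> : \int[P]_w ((\sum_(t < n) c t * Y t.+1%:Z (S s) w) ^+ 2) = \int[P]_w ((1 * A w + s * C w) ^+ 2).
    apply: ae_eq_Rintegral.
    - by apply: measurable_funX; exact: mC.
    - apply: measurable_funX; apply: measurable_funD; apply: measurable_funM => //; exact: mC.
    have : {ae P, forall w, forall t : 'I_n, Y t.+1%:Z (S s) w = 1 * Y t.+1%:Z Phi w + s * Y t.+1%:Z Psi w}.
      by apply: filter_forall => t; exact: YS.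
    apply: filterS => w h; congr (_ ^+ 2); rewrite /A /C !mulr_sumr -big_split/=.
    by apply: eq_bigr => t _; rewrite h; ring.
  apply: (@le_trans _ _ (\int[P]_w (2 * A w ^+ 2 + 2 * C w ^+ 2))).
    apply: le_Rintegral => //.
    - by apply: integrable_sqrD => //; exact: mC.
    - by apply: integrableRD => //; exact: integrableRZ.
    by move=> w _; exact: sqrD_le.
  rewrite RintegralD//; try exact: integrableRZ.
  rewrite !RintegralZl//.
  have : \int[P]_w (A w ^+ 2) <= r * gam Phi 0 * \sum_(t < n) c t ^+ 2 := @Y_form_le k r Phi n c stab H1 nk1.
  have : \int[P]_w (C w ^+ 2) <= r * gam Psi 0 * \sum_(t < n) c t ^+ 2 := @Y_form_le k r Psi n c stab H2 nk2.
  by rewrite /K /v; exact: lin_comb_le.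
pose Bp := [set w | (K * eta < `|dev (S 1) w|)%R].
pose Bm := [set w | (K * eta < `|dev (S (-1)) w|)%R].
have mBp : measurable Bp by apply: measurable_set_gt; apply: measurableT_comp => //; exact: measurable_dev.
have mBm : measurable Bm by apply: measurable_set_gt; apply: measurableT_comp => //; exact: measurable_dev.
have tp : (P Bp <= (2 * bound)%:E)%E by apply: Y_tail => //; apply: form; rewrite expr1n.
have tm : (P Bm <= (2 * bound)%:E)%E by apply: Y_tail => //; apply: form; rewrite sqrrN expr1n.
have gS s : s ^+ 2 = 1 -> gam (S s) 0 = v + 2 * s * innerp a b Phi (Xi P a b X 0 Psi).
  move=> s1; rewrite /v /autocov -(expectation_YY0 0)// -!(expectation_YY0 0)//.
  transitivity (\int[P]_w ((Y 0 Phi w * Y 0 Phi w + Y 0 Psi w * Y 0 Psi w) + 2 * s * (Y 0 Phi w * Y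
    0 Psi w))).
    apply: ae_eq_Rintegral.
    - by apply: measurable_funM; exact: mY.
    - by apply: measurable_funD; [apply: measurable_funD|]; apply: measurable_funM => //; try
      apply: measurable_funM => //; exact: mY.
    apply: filterS (YS s 0) => w ->.
    transitivity (Y 0 Phi w * Y 0 Phi w + s ^+ 2 * (Y 0 Psi w * Y 0 Psi w) + 2 * s * (Y 0 Phi w * Y
      0 Psi w)); first by ring.
    by rewrite s1 mul1r.
  have ii Phi' Psi' : Hp a b p Phi' -> Hp a b p Psi' -> P.-integrable setT (EFin \o (fun w => Y 0
    Phi' w * Y 0 Psi' w)).
    by move=> h h'; apply: integrable_mul_of_sqr; [exact: mY|exact: mY|exact: iY|exact: iY].
  rewrite RintegralD//; last 2 first.
  - by apply: integrableRD => //; exact: ii.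
  - by apply: integrableRZ => //; exact: ii.
  rewrite RintegralD//; try exact: ii.
  by rewrite RintegralZl//; exact: ii.
apply: (@le_trans _ _ (P (Bp `|` Bm))).
  apply: le_measure_ae.
  - apply: measurable_set_gt; apply: measurableT_comp => //; apply: measurable_funM => //.
    exact: (measurable_deviation ab RC JG MZ CS SB).
  - exact: (measurableU _ _ mBp mBm).
  have aeY s : {ae P, forall w, forall t : 'I_n, Y t.+1%:Z (S s) w = 1 * Y t.+1%:Z Phi w + s * Y
    t.+1%:Z Psi w}.
    by apply: filter_forall => t; exact: YS.
  have aeD := deviationE ab RC JG MZ CS SB n h1 h2.
  apply: filterS3 aeD (aeY 1) (aeY (-1)) => w /= -> e1 e2.
  set I := innerp a b Phi (Xi P a b X 0 Psi).
  (* Polarization, for the empirical form and for its mean alike. As [K * eta = 2 * (r * v) * eta],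
     a difference exceeding [4 * (r * eta * v)] forces one of the two terms above its threshold. *)
  have -> : n%:R^-1 * (\sum_(t < n) Y t.+1%:Z Phi w * Y t.+1%:Z Psi w) - I = (dev (S 1) w - dev (S
    (-1)) w) / 4.
    rewrite /dev !gS ?sqrrN ?expr1n// -/I /avg.
    rewrite (_ : \sum_(t < n) Y t.+1%:Z Phi w * Y t.+1%:Z Psi w =
      (\sum_(t < n) Y t.+1%:Z (S 1) w ^+ 2 - \sum_(t < n) Y t.+1%:Z (S (-1)) w ^+ 2) / 4); first by
        field; rewrite pnatr_eq0 -lt0n.
    rewrite -sumrB mulr_suml; by apply: eq_bigr => t _; rewrite e1 e2; field.
  rewrite normrM normfV (gtr0_norm v0) ltr_pdivlMr// normrM normfV [`|4|]ger0_norm// ltr_pdivlMr//.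
  rewrite /Bp /Bm /K /= => h.
  exact: lt_normB_split h.
apply: le_trans (measureU2 _ mBp mBm) _.
by apply: (le_trans (leeD tp tm)); rewrite -EFinD lee_fin -mulrDl -natrD.
Qed.

End tails.

Theorem theorem1 (R : realType) :
  exists c : R, 0 < c /\
  forall (d : measure_display) (Omega : measurableType d)
    (P : probability Omega R) (a b : R) (p : nat)
    (X : int -> 'I_p -> R -> Omega -> R)
    (F : R -> ('I_p -> R -> R) -> 'I_p -> R -> R[i])
    (n k : nat) (Phi1 Phi2 : 'I_p -> R -> R),
  a < b ->
  random_curves a b X ->
  jointly_gaussian P a b X ->
  mean_zero P a b X ->
  cov_stationary P a b X ->
  is_spectral_density P a b X F ->
  (stability P a b X F < +oo)%E ->
  (forall j : 'I_p, {within (`[a, b] `*` `[a, b]),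
     continuous (fun z : R * R => Sigma P X 0 j j z.1 z.2)}) ->
  (exists B : R, forall (j : 'I_p) (u v : R), u \in `[a, b] -> v \in `[a, b] ->
     `|Sigma P X 0 j j u v| <= B) ->
  (lambda0 P a b X < +oo)%E ->
  (0 < n)%N ->
  (1 <= k <= p)%N ->
  H0p P a b X Phi1 ->
  H0p P a b X Phi2 ->
  (maxn (norm0 a b Phi1) (norm0 a b Phi2) <= k)%N ->
  forall eta : R, 0 < eta ->
  (P [set w | stability_k P a b X F k * eta%:E <
       `|deviation P a b X n Phi1 Phi1 w /
         innerp a b Phi1 (Xi P a b X 0 Phi1)|%:E]
     <= (2 * expR (- (c * n%:R * Num.min (eta ^+ 2) eta)))%:E)%E
  /\
  (P [set w | stability_k P a b X F k * eta%:E <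
       `|deviation P a b X n Phi1 Phi2 w /
         (innerp a b Phi1 (Xi P a b X 0 Phi1)
          + innerp a b Phi2 (Xi P a b X 0 Phi2))|%:E]
     <= (4 * expR (- (c * n%:R * Num.min (eta ^+ 2) eta)))%:E)%E.
Proof.
exists 16^-1; split; first by rewrite invr_gt0.
move=> d Omega P a b p X F n k Phi1 Phi2 ab RC JG MZ CS SD _ SC [B SB] _ n0 _ H1 H2 nk eta eta0.
have [nk1 nk2] : (norm0 a b Phi1 <= k)%N /\ (norm0 a b Phi2 <= k)%N.
  by apply/andP; rewrite -geq_max.
(* Infinite values are treated apart: [+oo] makes both events empty because [eta > 0], and [-oo]
   contradicts [stability_ge1] at [r = 0]. *)
case stabE : (stability_k P a b X F k) => [r| |].
- have stab : (stability_k P a b X F k <= r%:E)%E by rewrite stabE.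
  split; under eq_set do rewrite -EFinM lte_fin.
    exact: (diag_tail ab RC JG MZ CS SB SC SD n0 eta0 stab H1 nk1).
  exact: (cross_tail ab RC JG MZ CS SB SC SD n0 eta0 stab H1 nk1 H2 nk2).
- have empty (f : Omega -> R) : [set w | (+oo * eta%:E < (f w)%:E)%E] = set0.
    by apply/seteqP; split => w //=; rewrite gt0_mulye ?lte_fin.
  by rewrite !empty measure0 !lee_fin !mulr_ge0 ?expR_ge0.
- have : (stability_k P a b X F k <= 0%:E)%E by rewrite stabE leNye.
  by move=> /(stability_ge1 ab RC JG MZ CS SB SD)/(_ H1 nk1); rewrite ler10.
Qed.
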